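(* Let $\{X_t:t\ge 0\}$ be a continuous time random walk in a uniformly elliptic time-dependent random environment $\omega$ on $\mathbb{Z}^d$ (as defined in the context), with environmental process satisfying assumption (EC). Then there exists a convex continuous rate function $I_c:\mathbb{R}^d\to[0,\infty)$ such that the following hold. (i) For every open set $O\subset\mathbb{R}^d$, $Q_\mu^c$-a.s. $$\liminf_{t\to\infty}\frac1t\log P_{0,\omega}^c\left(\frac{X_t}{t}\in O\right)\ge-\inf_{x\in O}I_c(x).$$ (ii) For every closed set $C\subset\mathbb{R}^d$, $Q_\mu^c$-a.s. $$\limsup_{t\to\infty}\frac1t\log P_{0,\omega}^c\left(\frac{X_t}{t}\in C\right)\le-\inf_{x\in C}I_c(x).$$
   Context: Environment. Fix $d\ge1$ and $\kappa_2>\kappa_1>0$. Let $G=\{e\in\mathbb{Z}^d:|e|_1=1\}$ be the set of unit vectors of $\mathbb{Z}^d$. Let $\mathcal{Q}=\{v=\{v(e):e\in G\}:\kappa_1\le\inf_{e\in G}v(e)\le\sup_{e\in G}v(e)\le\kappa_2\}$ and $\Omega_c=\mathcal{Q}^{\mathbb{Z}^d}$. The continuous time environmental process is a continuous time Markov process $\omega=\{\omega_t:t\ge0\}$ with state space $\Omega_c$, $\omega_t=\{\omega_t(x):x\in\mathbb{Z}^d\}$, $\omega_t(x)=\{\omega_t(x,e):e\in G\}\in\mathcal{Q}$. For each initial condition $\eta\in\Omega_c$ it defines a probability measure $Q^c_\eta$ on the Skorokhod space $D([0,\infty);\Omega_c)$. $\mu$ is a probability measure on $\Omega_c$ that is invariant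 for this Markov process (i.e. $\int E_{Q^c_\eta}[f(\omega_t)]\,d\mu(\eta)=\int f\,d\mu$ for all bounded continuous $f:\Omega_c\to\mathbb{R}$ and $t\ge0$) and invariant under the action of space translations. Set $Q^c_\mu=\int Q^c_\eta\,d\mu(\eta)$. Random walk. For a given trajectory $\omega\in D([0,\infty);\Omega_c)$, $\{X_t:t\ge0\}$ is the time-inhomogeneous continuous time Markov process on $\mathbb{Z}^d$ with generator at time $s\ge0$ given by $L_sf(x)=\sum_{e\in G}\omega_s(x,e)(f(x+e)-f(x))$; $P^c_{x,\omega}$ denotes its law on $D([0,\infty);\mathbb{Z}^d)$ with $X_0=x$ (the quenched law). Assumption (EC). For $s>0$ and $x\in\mathbb{Z}^d$ define $T_{s,x}:D([0,\infty);\Omega_c)\to D([0,\infty);\Omega_c)$ by $(T_{s,x}\omega)_t(y)=\omega_{t+s}(y+x)$. The family $\{T_{s,x}:s>0,x\in\mathbb{Z}^d\}$ is an ergodic family of (measure preserving) transformations on $(D([0,\infty);\Omega_c),\mathcal{B}(D([0,\infty);\Omega_c)),Q^c_\mu)$: whenever $A\in\mathcal{B}(D([0,\infty);\Omega_c))$ satisfies $T_{s,x}^{-1}A=A$ for every $s>0$ and $x\in\mathbb{Z}^d$, then $Q^c_\mu(A)\in\{0,1\}$. *)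

(* Defs.v *)
From HB Require Import structures.
From mathcomp Require Import all_boot all_order all_algebra.
From mathcomp Require Import all_classical all_reals all_analysis.
From mathcomp Require Import lra zify.

Set Implicit Arguments.
Unset Strict Implicit.
Unset Printing Implicit Defensive.

Import Order.TTheory GRing.Theory Num.Theory.
Import numFieldNormedType.Exports.

Local Open Scope classical_set_scope.
Local Open Scope ring_scope.

Notation Borel T := (g_sigma_algebraType (@open T)).

Section SkorokhodSpace.
Variable R : realType.

Section Paths.
Variable E : puniformType.

(* A path on [0, oo[ is encoded by its extension to R that is constant on
   ]-oo, 0]; this makes the encoding of each path unique, and the conditions at
   times t <= 0 add nothing but right-continuity at 0. *)
Definition cadlag (x : R -> E) : Prop :=
  [/\ forall t, t <= 0 -> x t = x 0,
      forall t, x s @[s --> t^'+] --> x t &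
      forall t, exists l : E, x s @[s --> t^'-] --> l].

Record cadlag_path := CadlagPath {
  path_fun :> R -> E;
  path_cadlag : cadlag path_fun }.

Lemma cadlag_pathP (x y : cadlag_path) :
  (forall t, 0 <= t -> x t = y t) -> x = y.
Proof.
case: x => x hx; case: y => y hy /= xy.
have e : x = y.
  apply/funext => t; have [|/ltW t0] := leP 0 t; first exact: xy.
  by have [-> // _ _] := hx; have [-> // _ _] := hy; rewrite xy.
by move: hx; rewrite e => hx; congr CadlagPath; exact: Prop_irrelevance.
Qed.

Lemma cadlag_cst (c : E) : cadlag (fun=> c).
Proof.
by split=> // t; [exact: cvg_cst | exists c; exact: cvg_cst].
Qed.

HB.instance Definition _ := gen_eqMixin cadlag_path.
HB.instance Definition _ := gen_choiceMixin cadlag_path.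
HB.instance Definition _ :=
  isPointed.Build cadlag_path (CadlagPath (cadlag_cst point)).

(* Increasing bijections of [0, oo[ (hence continuous). *)
Definition time_change (l : R -> R) : Prop :=
  set_bij `[0, +oo[ `[0, +oo[ l /\
  {in `[0, +oo[ &, {homo l : s t / s < t}}.

Definition skorokhod_cvg (x_ : nat -> cadlag_path) (x : cadlag_path) : Prop :=
  exists l : nat -> R -> R,
    [/\ forall n, time_change (l n),
        forall eps : R, 0 < eps ->
          \forall n \near \oo, forall s, 0 <= s -> `|l n s - s| < eps &
        forall (T : R) (V : set (E * E)), entourage V ->
          \forall n \near \oo, forall s, 0 <= s <= T ->
            V (x_ n (l n s), x s)].

(* For metrizable E the Skorokhod (J1) topology is metrizable, so that its open
   sets are the sequentially open ones. *)
Definition skorokhod_open : set_system cadlag_path :=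
  [set A | forall x x_, A x -> skorokhod_cvg x_ x ->
             \forall n \near \oo, A (x_ n)].

Lemma skorokhod_openT : skorokhod_open setT.
Proof. by move=> x x_ _ _; exact: nearW. Qed.

Lemma skorokhod_openI : setI_closed skorokhod_open.
Proof.
move=> A B oA oB x x_ [Ax Bx] xx.
by apply: filterI; [exact: (oA x)|exact: (oB x)].
Qed.

Lemma skorokhod_open_bigU (I : Type) (f : I -> set cadlag_path) :
  (forall i, skorokhod_open (f i)) -> skorokhod_open (\bigcup_i f i).
Proof.
move=> of_ x x_ [i _ fix_] xx.
have := of_ i x x_ fix_ xx.
by apply: filterS => n ?; exists i.
Qed.

HB.instance Definition _ := isOpenTopological.Build cadlag_path
  skorokhod_openT skorokhod_openI skorokhod_open_bigU.

(* The sigma-algebra generated by the coordinates up to time s. *)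
Definition past (s : R) : set (set cadlag_path) :=
  <<s [set A | exists (u : R) (B : set (Borel E)),
         [/\ 0 <= u <= s, measurable B & A = [set x : cadlag_path | B (x u)]] ] >>.

(* Markov property of the coordinate process under P, p s t x B being the
   probability of being in B at time t given the state x at time s. *)
Definition markov_law (P : {measure set (Borel cadlag_path) -> \bar R})
    (p : R -> R -> E -> set E -> \bar R) : Prop :=
  forall s t : R, 0 <= s -> s <= t ->
  forall (A : set cadlag_path) (B : set (Borel E)), past s A -> measurable B ->
    P (A `&` [set x : cadlag_path | B (x t)]) = (\int[P]_(x in A) p s t (x s) B)%E.

Definition markov_process (Q : R.-pker Borel E ~> Borel cadlag_path) : Prop :=
  forall eta : E,
    Q eta [set x : cadlag_path | x 0 = eta] = 1%E /\
    markov_law (Q eta) (fun s t xi B => Q xi [set x : cadlag_path | B (x (t - s))]).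

Definition invariant_measure (Q : R.-pker Borel E ~> Borel cadlag_path)
    (mu : probability (Borel E) R) : Prop :=
  forall f : E -> R, continuous f -> bounded_fun f -> forall t : R, 0 <= t ->
    \int[mu]_eta (\int[Q eta]_x f (x t)) = \int[mu]_eta f eta.

Lemma cadlag_shift (x : R -> E) (g : E -> E) (s : R) : continuous g ->
  cadlag x -> cadlag (fun t => g (x (Num.max t 0 + s))).
Proof.
move=> cg [_ rx lx]; split=> [t t0|t|t].
- by rewrite max_r// maxxx.
- apply: (@cvg_comp _ _ _ (fun t => x (Num.max t 0 + s)) g); last exact: cg.
  move=> A; have [t0|t0] := leP 0 t.
    move=> /rx [e /= e0 He]; exists e => //= u ute tu.
    rewrite max_l; last by rewrite (le_trans t0)// ltW.
    by apply: He => /=; rewrite ?ltrD2r// opprD addrACA subrr addr0.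
  move=> /nbhs_singleton Ax; exists (- t); first by rewrite /= oppr_gt0.
  move=> u /=; rewrite ltr_norml => /andP[+ _] _.
  rewrite opprK => tu; rewrite max_r//; lra.
- have [t0|t0] := ltP 0 t.
    have [l xl] := lx (t + s); exists (g l).
    apply: (@cvg_comp _ _ _ (fun t => x (Num.max t 0 + s)) g); last exact: cg.
    move=> A /xl [e /= e0 He]; exists (Num.min e t); first by rewrite /= lt_min e0.
    move=> u /=; rewrite lt_min => /andP[ute].
    rewrite ltr_norml => /andP[_ u0] ut.
    rewrite max_l; last lra.
    by apply: He => /=; rewrite ?ltrD2r// opprD addrACA subrr addr0.
  exists (g (x s)) => A /nbhs_singleton Ax.
  exists 1 => //= u _ ut.
  by rewrite max_r ?add0r// (le_trans (ltW ut)).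
Qed.

End Paths.

End SkorokhodSpace.

Section Lattice.
Variable d : nat.

Definition lattice : Type := 'rV[int]_d.

HB.instance Definition _ := Countable.copy lattice 'rV[int]_d.
HB.instance Definition _ := GRing.Zmodule.copy lattice 'rV[int]_d.
HB.instance Definition _ := isPointed.Build lattice 0.
HB.instance Definition _ := Uniform.copy lattice (discrete_topology 'rV[int]_d).

Definition norm1 (x : lattice) : int := \sum_(i < d) `|(x : 'rV[int]_d) 0 i|.

Record unit_vector := UnitVector {
  unit_vector_val :> lattice;
  unit_vectorP : norm1 unit_vector_val == 1 }.

HB.instance Definition _ := [isSub for unit_vector_val].
HB.instance Definition _ := [Countable of unit_vector by <:].

Definition signed_delta (u : 'I_d * bool) : lattice :=
  (-1) ^+ u.2 *: delta_mx 0 u.1 : 'rV[int]_d.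

Lemma unit_vector_signed_delta (e : unit_vector) :
  exists u, signed_delta u == e :> lattice.
Proof.
case: e => e /= /eqP e1.
have [i ei0] : exists i, (e : 'rV[int]_d) 0 i != 0.
  apply/existsP; apply: contraT; rewrite negb_exists => /forallP e0.
  move: e1; rewrite /norm1 big1// => i _.
  by move: (e0 i); rewrite negbK => /eqP ->; rewrite normr0.
have := e1; rewrite /norm1 (bigD1 i)//=; set rest := \sum_(j | _) _ => es.
have rest0 : 0 <= rest by exact: sumr_ge0.
have ei1 : 1 <= `|(e : 'rV[int]_d) 0 i| by rewrite -gtz0_ge1 normr_gt0.
have r0 : rest = 0 by lia.
have {}ei1 : `|(e : 'rV[int]_d) 0 i| = 1 by lia.
exists (i, (e : 'rV[int]_d) 0 i < 0); apply/eqP/(@rowP int d) => j.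
rewrite /signed_delta !mxE eqxx /=; have [->|ji] := eqVneq j i.
  by rewrite mulr1 [RHS]numEsign ei1 mulr1.
rewrite mulr0; apply/esym/normr0_eq0.
by move: r0; rewrite /rest => /psumr_eq0P -> //.
Qed.

Definition unit_vector_index (e : unit_vector) : 'I_d * bool :=
  xchoose (unit_vector_signed_delta e).

Lemma unit_vector_indexK :
  pcancel unit_vector_index
    (fun u => insub (signed_delta u) : option unit_vector).
Proof.
move=> e; have /eqP := xchooseP (unit_vector_signed_delta e).
by rewrite -/(unit_vector_index e) => ->; exact: valK.
Qed.

HB.instance Definition _ := fintype.isFinite.Build unit_vector (pcan_enumP unit_vector_indexK).

End Lattice.

Record ellipticity (R : realType) := Ellipticity {
  kappa1 : R;
  kappa2 : R;
  kappa1_gt0 : 0 < kappa1;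
  kappa1_lt2 : kappa1 < kappa2 }.

Section Environment.
Variables (R : realType) (d : nat) (K : ellipticity R).

Definition rate : Type := [set r : R | kappa1 K <= r <= kappa2 K].

Lemma rate_kappa1 :
  kappa1 K \in [set r : R | kappa1 K <= r <= kappa2 K].
Proof. by rewrite inE /= lexx ltW// kappa1_lt2. Qed.

HB.instance Definition _ := Uniform.on rate.
HB.instance Definition _ := isPointed.Build rate (SigSub rate_kappa1).

Definition elliptic_rates : Type := {ptws unit_vector d -> rate}.

HB.instance Definition _ := Uniform.on elliptic_rates.
HB.instance Definition _ := Pointed.on elliptic_rates.

Definition environment : Type := {ptws lattice d -> elliptic_rates}.

HB.instance Definition _ := Uniform.on environment.
HB.instance Definition _ := Pointed.on environment.

Definition jump_rate (eta : environment) (x : lattice d) (e : unit_vector d) : R :=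
  set_val (eta x e).

Definition translate (z : lattice d) (eta : environment) : environment :=
  fun y => eta (y + z).

Lemma translate_continuous (z : lattice d) : continuous (translate z).
Proof.
move=> eta; apply/cvg_sup => y A [_ [[C oC <-] Cy CA]].
apply: filterS CA _.
apply: (@proj_continuous _ (fun=> elliptic_rates) (y + z) eta).
exact: open_nbhs_nbhs.
Qed.
Arguments translate_continuous : clear implicits.

Definition env_path := cadlag_path R environment.
Definition walk_path := cadlag_path R (lattice d).

Definition space_time_shift (s : R) (z : lattice d) (omega : env_path) : env_path :=
  CadlagPath (cadlag_shift s (translate_continuous z) (path_cadlag omega)).

Definition env_mixture (Q : R.-pker Borel environment ~> Borel env_path)
    (mu : probability (Borel environment) R) : set (Borel env_path) -> \bar R :=
  fun A => (\int[mu]_eta Q eta A)%E.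

Definition translation_invariant (mu : probability (Borel environment) R) : Prop :=
  forall (z : lattice d) (A : set (Borel environment)), measurable A ->
    mu (translate z @^-1` A) = mu A.

(* Ergodicity of the family of shifts by s > 0 and z, which is understood to
   include that each of them is measurable and preserves M. *)
Definition ergodic_environment (M : set (Borel env_path) -> \bar R) : Prop :=
  (forall (s : R) (z : lattice d) (A : set (Borel env_path)),
     0 < s -> measurable A ->
     measurable (space_time_shift s z @^-1` A : set (Borel env_path)) /\
     M (space_time_shift s z @^-1` A) = M A) /\
  (forall A : set (Borel env_path), measurable A ->
     (forall (s : R) (z : lattice d), 0 < s ->
        space_time_shift s z @^-1` A = A) ->
     M A = 0%E \/ M A = 1%E).

(* The generator L_s of the walk, as a function of eta = omega_s. *)
Definition generator (eta : environment) (f : lattice d -> R) (x : lattice d) : R :=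
  \sum_(e : unit_vector d) jump_rate eta x e * (f (x + (e : lattice d)) - f x).

Definition transition_function
    (p : R -> R -> lattice d -> probability (Borel (lattice d)) R) : Prop :=
  (forall (s : R) (x : lattice d) (A : set (Borel (lattice d))),
     0 <= s -> measurable A -> p s s x A = \d_(x : Borel (lattice d)) A) /\
  (forall (s t u : R) (x : lattice d) (A : set (Borel (lattice d))),
     0 <= s -> s <= t -> t <= u -> measurable A ->
     p s u x A = (\int[p s t x]_y p t u y A)%E).

(* The continuity in t excludes deterministic jump times, which the right
   derivatives at t = s do not detect. *)
Definition has_generator
    (p : R -> R -> lattice d -> probability (Borel (lattice d)) R)
    (L : R -> (lattice d -> R) -> lattice d -> R) : Prop :=
  forall f : lattice d -> R, bounded_fun f ->
  forall (s : R) (x : lattice d), 0 <= s ->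
    {within `[s, +oo[, continuous (fun t : R => \int[p s t x]_y f y)} /\
    h^-1 * (\int[p s (s + h) x]_y f y - f x) @[h --> 0^'+] --> L s f x.

(* The rates are bounded and right-continuous in time, so that omega determines
   p, hence every P x. *)
Definition quenched_law (omega : env_path)
    (P : lattice d -> probability (Borel walk_path) R) : Prop :=
  exists p : R -> R -> lattice d -> probability (Borel (lattice d)) R,
    [/\ transition_function p,
        has_generator p (fun s => generator (omega s)) &
        forall x : lattice d,
          P x [set X : walk_path | X 0 = x] = 1%E /\
          markov_law (P x) (fun s t y B => p s t y B)].

Definition log_rate (P : probability (Borel walk_path) R) (A : set 'rV[R]_d)
    (t : R) : \bar R :=
  ((t^-1)%:E *
   lne (P [set X : walk_path |
           A (t^-1 *: map_mx intr (X t : 'rV[int]_d))]))%E.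

End Environment.

(* Main.v *)
(* By Chapman-Kolmogorov the cost [- ln p_{s,t}(x, y)] is subadditive, and by uniform
   ellipticity it is at most linear in every cone [|y - x| <= k (t - s)]. Kingman's
   theorem along the shifts [T_{q,z}] shows that almost surely, for all directions
   [z / q] at once, the cost of being at [n z] at time [n q] grows linearly in [n], at a
   rate which depends only on the mean costs; the latter are subadditive and so define
   a convex rate function [I]. The family of all shifts has trivial invariant events,
   although [T_{q,z}] alone may have nontrivial ones: a shift changes the cost by a
   bounded amount, again by ellipticity.

   Lower bound: reach [n z] at a time [n q] slightly before [t], then wait until [t].
   Upper bound: if [X_t / t] is close to [x], then at small cost the walk can go on to
   [n z] at a time [n q] slightly after [t], so that [X_t / t] is not much more likely
   to be close to [x] than [X_{n q}] to be [n z]; closed sets are dealt with by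
   compactness and exponential tightness.

   The costs are measurable in the environment because the transition probabilities
   are the only bounded solution of the backward equation, hence limits of Picard
   iterates. The same uniqueness shows that they are covariant under the shifts. *)

Require Import Defs.
From mathcomp Require Import all_boot all_order all_algebra.
From mathcomp Require Import all_classical all_reals all_analysis.
From HB Require Import structures.
From mathcomp Require Import measurable_realfun ring lra zify.
Import Order.TTheory GRing.Theory Num.Theory.
Import numFieldNormedType.Exports.

Set Implicit Arguments.
Unset Strict Implicit.
Unset Printing Implicit Defensive.

Local Open Scope classical_set_scope.
Local Open Scope ring_scope.

(** The hypothesis [has_generator] gives right derivatives only, and only on the diagonal [t = s];
    the rates are merely right continuous. Everything about [p] is therefore drawn from monotonicity
    criteria with one-sided derivatives, applied to Chapman-Kolmogorov sums over a point and its
    neighbours.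

    The quenched laws are a family chosen separately for each [omega]: measurability in [omega] and
    covariance under shifts have to be recovered from the fact that the environment determines the
    transition probabilities.

    Ellipticity bounds the cost of a displacement only over durations bounded away from 0, since its
    probability vanishes at short times. Hence the recurring condition that durations be at least 1,
    also for the shifts in the zero-one law.

    The rate function is the lower limit of the mean cost of [(n, z)] per unit time as [z / n] tends
    to [x]. The lower bound on probabilities uses one cheap pair close to [x], the upper bound an
    estimate for all pairs close to [x]. *)

Section Dini.
Variable R : realType.
Implicit Types (g : R -> R) (a b : R).

(** * Monotonicity from one-sided derivatives *)

Lemma continuous_affine (k a : R) : continuous (fun t => k * (t - a)).
Proof.
move=> t; apply: cvgM; first exact: cvg_cst.
by apply: cvgB; [exact: cvg_id|exact: cvg_cst].
Qed.

Lemma within_continuous_affine (A : set R) (k a : R) :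
  {within A, continuous (fun t => k * (t - a))}.
Proof. by apply: continuous_subspaceT; exact: continuous_affine. Qed.

(** Tilting [g] by [k (t - a)] absorbs the error [e * h]. The set [S] of times at which the tilted
    function is at least its value at [a] contains its supremum by continuity, and the Dini bound at
    [sup S] would carry [S] further unless [sup S = b]. *)
Lemma dini_nondecreasing g a b : a <= b -> {within `[a, b], continuous g} ->
  (forall t e, a <= t < b -> 0 < e ->
     \forall h \near 0^'+, g t - e * h <= g (t + h)) ->
  g a <= g b.
Proof.
move=> ab cg dg; apply/ler_addgt0Pr => e e0.
(* The [+ 1] keeps the denominator positive when [a = b]; what matters is [k * (b - a) <= e]. *)
pose k := e / (b - a + 1).
have k0 : 0 < k by rewrite divr_gt0// ltr_wpDl// subr_ge0.
have kb : k * (b - a) <= e.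
  by rewrite /k mulrAC ler_pdivrMr ?ltr_wpDl// ?subr_ge0// ler_wpM2l// ?ltW//; lra.
suff : g a <= g b + k * (b - a) by lra.
pose G t := g t + k * (t - a).
have Ga : G a = g a by rewrite /G subrr mulr0 addr0.
have cG : {within `[a, b], continuous G}.
  move=> t; apply: cvgD; first exact: cg.
  exact: within_continuous_affine.
pose S := [set t | a <= t <= b /\ G a <= G t].
have S0 : S a by rewrite /S /= !lexx ab.
have hS : has_sup S by split; [exists a | exists b => t [] /andP[]].
have aS : a <= sup S by apply: sup_ubound => //; case: hS.
have Sb : sup S <= b by apply: ge_sup => [|t [] /andP[]//]; case: hS.
have SS : S (sup S).
  split; first by rewrite aS Sb.
  rewrite leNgt; apply/negP => Gs.
  move/subspace_continuousP: cG => /(_ (sup S)); rewrite /= in_itv /= aS Sb.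
  move=> /(_ isT) /cvgrPdist_lt /(_ (G a - G (sup S))).
  rewrite subr_gt0 => /(_ Gs) [d /= d0 Hd].
  have [t St dt] := sup_adherent d0 hS.
  have ts : t <= sup S by apply: sup_ubound => //; case: hS.
  case: St => abt Gt.
  have : `|G (sup S) - G t| < G a - G (sup S).
    apply: Hd; last by rewrite in_itv.
    by rewrite /ball_ /= ger0_norm ?subr_ge0//; lra.
  rewrite ltr_norml; lra.
have [sb|sb] := eqVneq (sup S) b.
  by case: SS => _; rewrite Ga /G sb.
have {}sb : sup S < b by rewrite lt_neqAle sb.
have := dg (sup S) k; rewrite aS sb => /(_ isT k0) [d /= d0 Hd].
pose h := Num.min (d / 2) (b - sup S).
have h0 : 0 < h by rewrite lt_min divr_gt0//= subr_gt0.
have hd : h < d by rewrite gt_min; apply/orP; left; lra.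
have hb : sup S + h <= b by rewrite addrC -lerBrDr ge_min lexx orbT.
have Hh : g (sup S) - k * h <= g (sup S + h).
  by apply: Hd => //=; rewrite sub0r normrN gtr0_norm.
have : S (sup S + h).
  split; first by rewrite hb; lra.
  case: SS => _; rewrite Ga /G; nra.
move=> /sup_ubound; have : has_ubound S by case: hS.
by move=> /[swap] /[apply]; lra.
Qed.

Lemma rderiv_nondecreasing g a b : a <= b -> {within `[a, b], continuous g} ->
  (forall t, a <= t < b ->
     exists2 l : R, 0 <= l & h^-1 * (g (t + h) - g t) @[h --> 0^'+] --> l) ->
  g a <= g b.
Proof.
move=> ab cg dg; apply: dini_nondecreasing => // t e tab e0.
have [l l0 /cvgrPdist_lt /(_ e e0) H] := dg t tab.
near=> h; have h0 : 0 < h by [].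
have : `|l - h^-1 * (g (t + h) - g t)| < e by near: h.
rewrite ltr_norml => /andP[_].
rewrite ltrBlDr -(ltr_pM2l h0) mulrDr mulrA divff ?mul1r ?gt_eqF//.
nra.
Unshelve. all: by end_near. Qed.

End Dini.

(** * Probability measures on the lattice *)

Section LatticeMeasure.
Variables (R : realType) (d : nat).
Implicit Types (m : probability (Borel (lattice d)) R) (B : set (lattice d)).

Lemma lattice_measurable (B : set (Borel (lattice d))) : measurable B.
Proof. by apply: sub_sigma_algebra; exact: discrete_open. Qed.

Lemma lattice_integrable m (B : set (Borel (lattice d))) (g : lattice d -> R) :
  (forall y, 0 <= g y <= 1) -> m.-integrable B (EFin \o g).
Proof.
move=> g01; apply: (@le_integrable _ _ _ m _ _ _ (cst 1%E)) => //.
- exact: lattice_measurable.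
- by move=> _ U _; exact: lattice_measurable.
- move=> y _ /=; rewrite lee_fin normr1; have /andP[g0 g1] := g01 y.
  by rewrite ger0_norm.
- by apply: finite_measure_integrable_cst; exact: lattice_measurable.
Qed.

Definition mass m B : R := fine (m B).

Lemma massE m B : (mass m B)%:E = m B.
Proof. by rewrite /mass fineK// fin_num_measure//; exact: lattice_measurable. Qed.

Lemma mass_ge0 m B : 0 <= mass m B.
Proof. by rewrite -lee_fin massE. Qed.

Lemma mass_le1 m B : mass m B <= 1.
Proof. by rewrite -lee_fin massE probability_le1//; exact: lattice_measurable. Qed.

Lemma massT m : mass m setT = 1.
Proof. by apply: EFin_inj; rewrite massE probability_setT. Qed.

Lemma massU m A B : [disjoint A & B] -> mass m (A `|` B) = mass m A + mass m B.
Proof.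
move=> /disj_setPS AB; apply: EFin_inj; rewrite EFinD !massE.
rewrite measureU//; try exact: lattice_measurable.
by apply/seteqP; split.
Qed.

Lemma le_mass m A B : A `<=` B -> mass m A <= mass m B.
Proof.
by move=> AB; rewrite -lee_fin !massE le_measure ?inE//; exact: lattice_measurable.
Qed.

Lemma le_massU m A B : mass m (A `|` B) <= mass m A + mass m B.
Proof.
have -> : A `|` B = A `|` (B `\` A).
  apply/seteqP; split => y; last by case=> [|[]]; [left|right].
  by case: (pselect (A y)) => [|Ay [|]]; [left|left|right].
rewrite massU ?lerD2l; first by apply: le_mass => y [].
by apply/disj_setPS => y [Ay []].
Qed.


Lemma massC m B : mass m (~` B) = 1 - mass m B.
Proof.
have BC : [disjoint B & ~` B] by apply/disj_setPS => x [].
by have := massU m BC; rewrite setUv massT => ->; rewrite addrAC subrr add0r.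
Qed.

Lemma mass_integral m (g : lattice d -> R) (s : seq (lattice d)) :
  (forall y, 0 <= g y <= 1) -> uniq s ->
  \sum_(y <- s) mass m [set y] * g y <= \int[m]_y g y
    <= \sum_(y <- s) mass m [set y] * g y + (1 - \sum_(y <- s) mass m [set y]).
Proof.
move=> g01 us.
have ig B : m.-integrable B (EFin \o g) by exact: lattice_integrable.
have H : \int[m]_(y in [set` s]) g y = \sum_(y <- s) mass m [set y] * g y /\
         mass m [set` s] = \sum_(y <- s) mass m [set y].
  elim: s us => [_|x s IH /= /andP[xs us]].
    by rewrite classical_sets.set_nil !big_nil Rintegral_set0 /mass measure0.
  have [IH1 IH2] := IH us; rewrite !big_cons.
  have -> : [set` x :: s] = [set x] `|` [set` s].
    apply/seteqP; split=> y /=; rewrite inE; first by case/orP => [/eqP|]; [left|right].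
    by case=> [->|->]; rewrite ?eqxx ?orbT.
  have dxs : [disjoint [set x] & [set` s]].
    by apply/disj_setPS => y [/= ->]; rewrite (negbTE xs).
  rewrite -IH1 -IH2 massU// Rintegral_setU//; try exact: lattice_measurable.
  split=> //; congr (_ + _).
  rewrite (@eq_Rintegral _ _ _ m [set x] (cst (g x))).
    by rewrite Rintegral_cst; [rewrite mulrC|exact: lattice_measurable].
  by move=> y; rewrite inE /= => ->.
have [<- <-] := H.
have -> : \int[m]_y g y = \int[m]_(y in [set` s]) g y + \int[m]_(y in ~` [set` s]) g y.
  have dC : [disjoint [set` s] & ~` [set` s]] by apply/disj_setPS => x [].
  by rewrite -Rintegral_setU ?setUv//; exact: lattice_measurable.
apply/andP; split.
  by rewrite lerDl Rintegral_ge0// => y _; have /andP[] := g01 y.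
rewrite lerD2l -massC -[leRHS]mul1r.
rewrite -(@Rintegral_cst _ _ _ m (~` [set` s]))//; last exact: lattice_measurable.
apply: le_Rintegral => //; first exact: lattice_measurable.
- by apply: lattice_integrable => y; rewrite lexx ler01.
- by move=> y _; have /andP[] := g01 y.
Qed.

Lemma integral_ge_mass m (g : lattice d -> R) B (a : R) :
  (forall y, 0 <= g y <= 1) -> (forall y, B y -> a <= g y) ->
  a * mass m B <= \int[m]_y g y.
Proof.
move=> g01 aB.
have [a0|a0] := leP a 0.
  apply: (@le_trans _ _ 0); first by rewrite mulr_le0_ge0// mass_ge0.
  by apply: Rintegral_ge0 => y _; have /andP[] := g01 y.
have [->|/set0P[y0 By0]] := eqVneq B set0.
  rewrite /mass measure0 mulr0.
  by apply: Rintegral_ge0 => y _; have /andP[] := g01 y.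
have a1 : a <= 1 by rewrite (le_trans (aB _ By0))//; have /andP[] := g01 y0.
rewrite -(@Rintegral_cst _ _ _ m B)//; last exact: lattice_measurable.
rewrite Rintegral_mkcond; apply: le_Rintegral => //.
- apply: lattice_integrable => y; rewrite patchE; case: ifP => _.
    by rewrite a1 ltW.
  by rewrite lexx ler01.
- exact: lattice_integrable.
- move=> y _; rewrite patchE; case: ifPn => [|_]; first by rewrite inE => /aB.
  by have /andP[] := g01 y.
Qed.

End LatticeMeasure.

(** * Transition probabilities and the backward equation *)

Section Rates.
Variables (R : realType) (d : nat) (K : ellipticity R).
Implicit Types (eta : environment d K) (x : lattice d) (e : unit_vector d).

Definition max_rate : R := #|{: unit_vector d}|%:R * kappa2 K.

Lemma jump_rate_bounds eta x e : kappa1 K <= jump_rate eta x e <= kappa2 K.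
Proof. by have := valP (eta x e); rewrite inE. Qed.

Lemma kappa2_gt0 : 0 < kappa2 K.
Proof. exact: lt_trans (kappa1_gt0 K) (kappa1_lt2 K). Qed.

Lemma max_rate_ge0 : 0 <= max_rate.
Proof. by rewrite mulr_ge0// ltW// kappa2_gt0. Qed.

Lemma jump_rate_ge0 eta x e : 0 <= jump_rate eta x e.
Proof. by have /andP[+ _] := jump_rate_bounds eta x e; apply: le_trans; exact/ltW/kappa1_gt0. Qed.

Lemma total_rate_le eta x : \sum_e jump_rate eta x e <= max_rate.
Proof.
apply: (@le_trans _ _ (\sum_(e : unit_vector d) kappa2 K)).
  by apply: ler_sum => e _; have /andP[] := jump_rate_bounds eta x e.
by rewrite sumr_const -mulr_natl.
Qed.

Lemma unit_vector_neq0 e : (e : lattice d) != 0.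
Proof.
apply/eqP => e0; have := unit_vectorP e; rewrite e0 /norm1 big1//.
by move=> i _; rewrite mxE normr0.
Qed.

Lemma addr_unit_vector_neq x e : x + (e : lattice d) != x.
Proof. by rewrite -subr_eq0 addrAC subrr add0r unit_vector_neq0. Qed.

Lemma generator_indic_self eta x :
  generator eta \1_[set x] x = - \sum_e jump_rate eta x e.
Proof.
rewrite /generator -sumrN; apply: eq_bigr => e _.
rewrite !indicE (@mem_set _ _ x)// memNset ?sub0r ?mulrN1//=.
exact/eqP/addr_unit_vector_neq.
Qed.

Lemma generator_indic_step eta x e :
  generator eta \1_[set x + (e : lattice d)] x = jump_rate eta x e.
Proof.
rewrite /generator (bigD1 e)//= !indicE (@mem_set _ _ (x + _))//.
have xN : x \in [set x + (e : lattice d)] = false.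
  by apply: memNset => /= /esym/eqP; rewrite (negbTE (addr_unit_vector_neq _ _)).
rewrite xN subr0 mulr1 big1 ?addr0// => e' e'e.
rewrite !indicE memNset ?subr0 ?mulr0//= => /addrI /val_inj ee.
by rewrite ee eqxx in e'e.
Qed.

End Rates.

Section Transition.
Variables (R : realType) (d : nat) (K : ellipticity R) (omega : env_path d K).
Variable p : R -> R -> lattice d -> probability (Borel (lattice d)) R.
Hypothesis tf : transition_function p.
Hypothesis hg : has_generator p (fun s => generator (omega s)).
Implicit Types (s t u : R) (x y : lattice d) (B C : set (lattice d)).

Local Notation c := (max_rate d K).
Local Notation rt s x e := (jump_rate (omega s) x e).

Lemma mass_indic (m : probability (Borel (lattice d)) R) B :
  \int[m]_y \1_B y = mass m B.
Proof.
rewrite /Rintegral integral_indic ?setIT//; exact: lattice_measurable.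
Qed.

Lemma bounded_indic B : bounded_fun (\1_B : lattice d -> R).
Proof.
exists 1; split=> // M M1 x _ /=; rewrite indicE; case: (_ \in _).
  by rewrite normr1 ltW.
by rewrite normr0 ltW// (lt_trans ltr01).
Qed.

Lemma trans_diag s x B : 0 <= s -> mass (p s s x) B = \1_B x.
Proof.
move=> s0; have [H _] := tf.
by rewrite /mass (H s x B s0 (lattice_measurable B)).
Qed.

Lemma trans_continuous s x B : 0 <= s ->
  {within `[s, +oo[, continuous (fun t => mass (p s t x) B)}.
Proof.
move=> s0; have [+ _] := hg (bounded_indic B) x s0.
by under [X in {within _, continuous X} -> _]eq_fun do rewrite mass_indic.
Qed.

Lemma trans_continuous_itv s t x B : 0 <= s ->
  {within `[s, t], continuous (fun t => mass (p s t x) B)}.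
Proof.
move=> s0; have := @trans_continuous s x B s0; apply: continuous_subspaceW.
by apply: subset_itvl.
Qed.

Lemma trans_rderiv s x B : 0 <= s ->
  h^-1 * (mass (p s (s + h) x) B - \1_B x) @[h --> 0^'+] -->
  generator (omega s) \1_B x.
Proof.
move=> s0; have [_] := hg (bounded_indic B) x s0.
by under eq_fun do rewrite mass_indic.
Qed.

Lemma chapman_kolmogorov s t u x B : 0 <= s -> s <= t -> t <= u ->
  mass (p s u x) B = \int[p s t x]_y mass (p t u y) B.
Proof.
move=> s0 st tu; have [_ H] := tf.
rewrite /mass /Rintegral (H s t u x B s0 st tu (lattice_measurable B)).
congr fine; apply: eq_integral => y _; exact/esym/massE.
Qed.

Lemma mass01 (m : probability (Borel (lattice d)) R) B : 0 <= mass m B <= 1.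
Proof. by rewrite mass_ge0 mass_le1. Qed.

Lemma chapman_ge s t u x B C (a : R) : 0 <= s -> s <= t -> t <= u ->
  (forall y, B y -> a <= mass (p t u y) C) ->
  a * mass (p s t x) B <= mass (p s u x) C.
Proof.
move=> s0 st tu aB; rewrite (chapman_kolmogorov _ _ s0 st tu).
by apply: integral_ge_mass => // y; exact: mass01.
Qed.

Lemma chapman_ge1 s t u x y C : 0 <= s -> s <= t -> t <= u ->
  mass (p s t x) [set y] * mass (p t u y) C <= mass (p s u x) C.
Proof. by move=> s0 st tu; rewrite mulrC; apply: chapman_ge => // z ->. Qed.

Lemma near_stay t x (e : R) : 0 <= t -> 0 < e ->
  \forall h \near 0^'+, 1 - (c + e) * h <= mass (p t (t + h) x) [set x].
Proof.
move=> t0 e0; have := @trans_rderiv t x [set x] t0.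
rewrite generator_indic_self => /cvgrPdist_lt /(_ _ e0) H.
near=> h; have h0 : 0 < h by [].
have : `|- (\sum_e rt t x e) -
    h^-1 * (mass (p t (t + h) x) [set x] - \1_[set x] x)| < e by near: h.
rewrite indicE mem_set//= ltr_norml => /andP[_] He.
have ce := total_rate_le (omega t) x.
have : - (c + e) <= h^-1 * (mass (p t (t + h) x) [set x] - 1) by lra.
by rewrite -(ler_pM2l h0) mulrA divff ?mul1r ?gt_eqF//; lra.
Unshelve. all: by end_near. Qed.

(** Keeping only the paths that are at [x] at time [u] gives [p_{s,u+h}(x, x) >= p_{s,u}(x, x) (1 -
    (c + e) h)], so that [p_{s,t}(x, x) + c (t - s)] satisfies the lower Dini bound in [t]. *)
Lemma stay_ge s t x : 0 <= s -> s <= t ->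
  1 - c * (t - s) <= mass (p s t x) [set x].
Proof.
move=> s0 st.
suff : mass (p s s x) [set x] + c * (s - s) <=
       mass (p s t x) [set x] + c * (t - s).
  by rewrite trans_diag// indicE mem_set//=; lra.
apply: (@dini_nondecreasing _ (fun t => mass (p s t x) [set x] + c * (t - s))) => //.
  move=> u; apply: cvgD; first exact: trans_continuous_itv.
  exact: within_continuous_affine.
move=> u e /andP[su ut] e0; have u0 : 0 <= u by lra.
have H := near_stay x u0 e0.
near=> h; have h0 : 0 < h by [].
have Hh : 1 - (c + e) * h <= mass (p u (u + h) x) [set x] by near: h.
have uh : u <= u + h by lra.
have := chapman_ge1 x x [set x] s0 su uh.
have := mass_ge0 (p s u x) [set x]; have := mass_le1 (p s u x) [set x].
set a := mass _ _ in Hh *; set b := mass _ _; have c0 := max_rate_ge0 d K => b1 b0 ab.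
have : b * (1 - (c + e) * h) <= b * a by rewrite ler_wpM2l.
have : b * ((c + e) * h) <= (c + e) * h by rewrite ler_piMl// mulr_ge0// ?addr_ge0// ltW.
lra.
Unshelve. all: by end_near. Qed.

End Transition.

(** * Calculus of right derivatives *)

Section RightDerivative.
Variable R : realType.
Implicit Types (f g : R -> R) (s l k : R).

Definition rderiv f s l := h^-1 * (f (s + h) - f s) @[h --> 0^'+] --> l.

Lemma rderivD f g s l k : rderiv f s l -> rderiv g s k ->
  rderiv (fun t => f t + g t) s (l + k).
Proof.
move=> fl gk; rewrite /rderiv.
under eq_fun do rewrite opprD addrACA mulrDr.
exact: cvgD.
Qed.

Lemma rderivZ k f s l : rderiv f s l -> rderiv (fun t => k * f t) s (k * l).
Proof.
move=> fl; rewrite /rderiv.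
under eq_fun do rewrite -mulrBr mulrCA.
by apply: cvgM => //; exact: cvg_cst.
Qed.

Lemma rderivN f s l : rderiv f s l -> rderiv (fun t => - f t) s (- l).
Proof.
move=> /(@rderivZ (- 1) _ _ _); rewrite mulN1r.
by under eq_fun do rewrite mulN1r.
Qed.

Lemma rderivB f g s l k : rderiv f s l -> rderiv g s k ->
  rderiv (fun t => f t - g t) s (l - k).
Proof. by move=> fl /rderivN gk; exact: rderivD. Qed.

Lemma cvg_at_right0 : h @[h --> (0 : R)^'+] --> (0 : R).
Proof. exact: cvg_at_right_filter. Qed.

Lemma rderiv_cvg f s l : rderiv f s l -> f (s + h) @[h --> 0^'+] --> f s.
Proof.
move=> fl; have : f s + h * (h^-1 * (f (s + h) - f s)) @[h --> 0^'+] --> f s + 0 * l.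
  apply: cvgD; first exact: cvg_cst.
  by apply: cvgM => //; exact: cvg_at_right0.
rewrite mul0r addr0; apply: cvg_trans; apply: near_eq_cvg.
near=> h; have h0 : 0 < h by [].
by rewrite mulrA divff ?gt_eqF// mul1r addrC subrK.
Unshelve. all: by end_near. Qed.

Lemma rderivM f g s l k : rderiv f s l -> rderiv g s k ->
  rderiv (fun t => f t * g t) s (l * g s + f s * k).
Proof.
move=> fl gk; rewrite /rderiv.
have -> : (fun h => h^-1 * (f (s + h) * g (s + h) - f s * g s)) =
    (fun h => (h^-1 * (f (s + h) - f s)) * g (s + h) +
              f s * (h^-1 * (g (s + h) - g s))).
  by apply/funext => h; ring.
apply: cvgD; apply: cvgM => //; first exact: rderiv_cvg gk.
exact: cvg_cst.
Qed.

Lemma rderiv_expR k a s :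
  rderiv (fun t => expR (k * (a - t))) s (- k * expR (k * (a - s))).
Proof.
have E t : expR (k * (a - t)) = expR (k * a) * expR (- k * t).
  by rewrite -expRD; congr expR; ring.
rewrite E mulrCA; under [X in rderiv X]eq_fun do rewrite E.
apply: (@rderivZ (expR (k * a)) (fun t => expR (- k * t))).
have D : is_derive s (1 : R) (fun t => expR (- k * t)) (- k * expR (- k * s)).
  have D1 : is_derive s (1 : R) ((- k) \*: (id : R -> R^o)) (- k *: (1 : R^o)).
    exact: is_deriveZ.
  have := is_derive1_comp (is_derive_expR (- k * s)) D1.
  by rewrite /GRing.scale /= mulr1 mulrC.
have [dD DE] := D; move/cvg_dnbhs_at_right: dD; rewrite -[lim _]/('D_1 _ s) DE.
rewrite /rderiv; apply: cvg_trans; apply: near_eq_cvg; near=> h.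
by rewrite /= /GRing.scale /= mulr1 [h + s]addrC.
Unshelve. all: by end_near. Qed.

Lemma rderiv_exp_within (A : set R) k a :
  {within A, continuous (fun t => expR (k * (a - t)))}.
Proof.
apply: continuous_subspaceT => t.
apply: (@continuous_comp _ _ _ (fun t => k * (a - t)) expR); last exact: continuous_expR.
apply: cvgM; first exact: cvg_cst.
by apply: cvgB; [exact: cvg_cst|exact: cvg_id].
Qed.

End RightDerivative.

(** * Comparison principle for the backward equation *)

Section Comparison.
Variables (R : realType) (d : nat) (K : ellipticity R).
Local Notation c := (max_rate d K).

(** Adding [c * f] makes the operator monotone: it combines values of [f] with nonnegative
    coefficients of sum [c], because [c] bounds the total jump rate. It takes the place of the
    generator once a solution is multiplied by [e^(c (T - s))]. *)
Definition uniformized (eta : environment d K) (f : lattice d -> R) (x : lattice d) : R :=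
  generator eta f x + c * f x.

Lemma uniformizedE (eta : environment d K) f x : uniformized eta f x =
  \sum_e jump_rate eta x e * f (x + (e : lattice d))
  + (c - \sum_e jump_rate eta x e) * f x.
Proof.
rewrite /uniformized /generator; under eq_bigr do rewrite mulrBr.
by rewrite sumrB -mulr_suml; ring.
Qed.

Lemma uniformized_le eta f x b : (forall y, f y <= b) -> uniformized eta f x <= c * b.
Proof.
move=> fb; rewrite uniformizedE.
have -> : c * b = \sum_e jump_rate eta x e * b + (c - \sum_e jump_rate eta x e) * b.
  by rewrite -mulr_suml; ring.
apply: lerD; last by rewrite ler_wpM2l// subr_ge0 total_rate_le.
by apply: ler_sum => e _; rewrite ler_wpM2l// jump_rate_ge0.
Qed.

(* Iterating the Duhamel formula for [e^(c (T - s)) v] halves the constant in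
   front of [e^(2 c (T - s))]. *)
Lemma backward_comparison (omega : env_path d K) (v : R -> lattice d -> R) (T M : R) :
  (forall x, {within `[0, T], continuous (v ^~ x)}) ->
  (forall s x, 0 <= s < T -> exists2 l : R,
      - generator (omega s) (v s) x <= l & rderiv (v ^~ x) s l) ->
  (forall s x, 0 <= s <= T -> v s x <= M) ->
  (forall x, v T x <= 0) ->
  forall s x, 0 <= s <= T -> v s x <= 0.
Proof.
move=> cv dv bv vT s0 x0 s0T.
have c0 := max_rate_ge0 d K.
pose M' := Num.max M 0.
have M'0 : 0 <= M' by rewrite le_max lexx orbT.
have H n : forall s x, 0 <= s <= T ->
    expR (c * (T - s)) * v s x <= M' / 2 ^+ n * expR (2 * c * (T - s)).
  elim: n => [s x sT|n IH s x /andP[s_ge0 sT]].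
    rewrite expr0 divr1; apply: (@le_trans _ _ (expR (c * (T - s)) * M')).
      by rewrite ler_wpM2l ?expR_ge0// le_max bv.
    rewrite mulrC ler_wpM2l// ler_expR -mulrA ler_peMl ?ler1n//.
    by case/andP: sT => _ sT; rewrite mulr_ge0// subr_ge0.
  (* The halving comes from the factor 2 in the exponent: the derivative of [q e^(2 c (T - s))] has
     size [2 c q e^(2 c (T - s))], and [2 q] is the constant of level [n]. *)
  pose q := M' / 2 ^+ n.+1.
  suff : expR (c * (T - s)) * v s x - q * expR (2 * c * (T - s)) <=
         expR (c * (T - T)) * v T x - q * expR (2 * c * (T - T)).
    rewrite subrr !mulr0 expR0 mul1r mulr1.
    have q0 : 0 <= q by rewrite divr_ge0// exprn_ge0.
    by have := vT x; rewrite -/q; lra.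
  apply: (@rderiv_nondecreasing _
    (fun s => expR (c * (T - s)) * v s x - q * expR (2 * c * (T - s)))) => //.
    move=> t; apply: cvgB; apply: cvgM.
    - exact: rderiv_exp_within.
    - have := cv x; move=> /(continuous_subspaceW (A := `[s, T])); apply.
      by apply: subset_itvr; rewrite bnd_simp.
    - exact: cvg_cst.
    - exact: rderiv_exp_within.
  move=> t /andP[st tT]; have t0T : 0 <= t < T by rewrite tT (le_trans s_ge0).
  have [l lv dl] := dv t x t0T.
  have D := rderivB (rderivM (@rderiv_expR R c T t) dl)
                    (@rderivZ R q _ _ _ (@rderiv_expR R (2 * c) T t)).
  eexists; last exact: D.
  have t0T' : 0 <= t <= T by case/andP: t0T => -> /ltW ->.
  set E := expR (c * (T - t)); set E2 := expR (2 * c * (T - t)).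
  have E0 : 0 < E by exact: expR_gt0.
  have := @uniformized_le (omega t) (v t) x (M' / 2 ^+ n * E2 / E).
  have H y : v t y <= M' / 2 ^+ n * E2 / E by rewrite ler_pdivlMr// mulrC IH.
  move=> /(_ H) {H}; rewrite /uniformized => H.
  have {}H : - l + c * v t x <= c * (M' / 2 ^+ n * E2 / E) by lra.
  move: H; rewrite -(ler_pM2l E0).
  have EA (A : R) : E * (c * (A * E2 / E)) = c * A * E2.
    by field; exact: lt0r_neq0.
  rewrite EA.
  have -> : q = M' / 2 ^+ n / 2 by rewrite /q exprS invfM; ring.
  lra.
have : expR (c * (T - s0)) * v s0 x0 <= 0.
  apply/ler_addgt0Pr => e e0; rewrite add0r.
  pose A := M' * expR (2 * c * (T - s0)).
  have A0 : 0 <= A by rewrite mulr_ge0// expR_ge0.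
  pose n := (Num.truncn (A / e)).+1.
  apply: le_trans (H n _ _ s0T) _.
  rewrite mulrAC -/A ler_pdivrMr ?exprn_gt0// -ler_pdivrMl// mulrC.
  apply: ltW; apply: lt_le_trans (truncnS_gt _) _.
  by rewrite -/n -natrX ler_nat ltnW// ltn_expl.
by rewrite pmulr_rle0// expR_gt0.
Qed.

End Comparison.

Lemma cvg_sum (R : realType) (I : finType) (F : set_system R) {FF : Filter F}
    (f : I -> R -> R) (l : I -> R) : (forall i, f i h @[h --> F] --> l i) ->
  \sum_i f i h @[h --> F] --> \sum_i l i.
Proof.
move=> fl; elim: (index_enum I) => [|i r IH].
  by rewrite big_nil; under eq_fun do rewrite big_nil; exact: cvg_cst.
by rewrite big_cons; under eq_fun do rewrite big_cons; exact: cvgD.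
Qed.

Section BackwardEquation.
Variables (R : realType) (d : nat) (K : ellipticity R) (omega : env_path d K).
Variable p : R -> R -> lattice d -> probability (Borel (lattice d)) R.
Hypothesis tf : transition_function p.
Hypothesis hg : has_generator p (fun s => generator (omega s)).
Implicit Types (s t u T : R) (x y : lattice d) (B C : set (lattice d)).

Local Notation c := (max_rate d K).
Local Notation rt s x e := (jump_rate (omega s) x e).

(** At time [t] the walk is at [x] except with probability at most [c (t - s)], and from [x] at time
    [t] the probability of ending in [B] is the second term. *)
Lemma backward_lipschitz s t T x B : 0 <= s -> s <= t -> t <= T ->
  `|mass (p s T x) B - mass (p t T x) B| <= c * (t - s).
Proof.
move=> s0 st tT.
have := @mass_integral _ _ (p s t x) (fun y => mass (p t T y) B) [:: x].
rewrite -(chapman_kolmogorov tf)// !big_seq1 => /(_ (fun y => mass01 _ _) isT).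
have := stay_ge tf hg x s0 st; have := mass_le1 (p s t x) [set x].
have /andP[] := mass01 (p t T x) B.
set a := mass (p s t x) _; set b := mass (p t T x) _ => b0 b1 a1 a0 /andP[h1 h2].
have : (1 - a) * b <= 1 - a by rewrite ler_piMr// subr_ge0.
have : 0 <= (1 - a) * b by rewrite mulr_ge0// subr_ge0.
by rewrite ler_norml; lra.
Qed.

Lemma within_lipschitz (f : R -> R) (k T : R) : 0 <= k ->
  (forall s t, 0 <= s -> s <= t -> t <= T -> `|f s - f t| <= k * (t - s)) ->
  {within `[0, T], continuous f}.
Proof.
move=> k0 lf; apply/subspace_continuousP => s /=; rewrite in_itv /= => /andP[s0 sT].
apply/cvgrPdist_lt => e e0.
exists (e / (k + 1)); first by rewrite /= divr_gt0// ltr_wpDl.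
move=> t /=; rewrite ltr_pdivlMr ?ltr_wpDl// => st; rewrite in_itv /= => /andP[t0 tT].
apply: le_lt_trans st.
have [ts|ts] := leP s t.
  apply: le_trans (lf _ _ s0 ts tT) _.
  by rewrite distrC ger0_norm ?subr_ge0//; nra.
rewrite distrC; apply: le_trans (lf _ _ t0 (ltW ts) sT) _.
by rewrite ger0_norm ?subr_ge0 ?ltW//; nra.
Qed.

Lemma backward_continuous T x B :
  {within `[0, T], continuous (fun s => mass (p s T x) B)}.
Proof.
apply: (within_lipschitz (max_rate_ge0 d K)) => s t s0 st tT.
exact: backward_lipschitz.
Qed.

Lemma backward_right_continuous s T x B : 0 <= s < T ->
  mass (p (s + h) T x) B @[h --> 0^'+] --> mass (p s T x) B.
Proof.
move=> /andP[s0 sT]; apply/cvgrPdist_le => e e0.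
have c1 : 0 < c + 1 by rewrite ltr_wpDl// max_rate_ge0.
near=> h; have h0 : 0 < h by [].
have hT : s + h <= T by rewrite -lerBrDl; near: h; apply: nbhs_right_le; rewrite subr_gt0.
have sh : s <= s + h by rewrite lerDl ltW.
apply: le_trans (backward_lipschitz x B s0 sh hT) _.
rewrite [s + h]addrC addrK.
have : h <= e / (c + 1) by near: h; apply: nbhs_right_le; rewrite divr_gt0.
by rewrite ler_pdivlMr//; lra.
Unshelve. all: by end_near. Qed.

(** Decompose according to the position at time [s + h]: [x], a neighbour, or elsewhere. The last
    case has probability [o(h)], because the rates towards the neighbours add up to the rate of
    leaving [x]; this squeezes the difference quotient. *)
Lemma backward_equation T x B s : 0 <= s < T ->
  rderiv (fun s => mass (p s T x) B) s
    (- generator (omega s) (fun y => mass (p s T y) B) x).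
Proof.
move=> /andP[s0 sT]; have s0T : 0 <= s < T by rewrite s0 sT.
pose v s y := mass (p s T y) B.
pose p0 h := mass (p s (s + h) x) [set x].
pose p1 h (e : unit_vector d) := mass (p s (s + h) x) [set x + (e : lattice d)].
have q0 : h^-1 * (p0 h - 1) @[h --> 0^'+] --> - \sum_e rt s x e.
  by have := @trans_rderiv _ _ _ _ _ hg s x [set x] s0;
    rewrite generator_indic_self indicE mem_set//=.
have q1 e : h^-1 * p1 h e @[h --> 0^'+] --> rt s x e.
  have := @trans_rderiv _ _ _ _ _ hg s x [set x + (e : lattice d)] s0.
  rewrite generator_indic_step indicE memNset/=; first by under eq_fun do rewrite subr0.
  by move=> /esym/eqP; rewrite (negbTE (addr_unit_vector_neq _ _)).
(* [- U h] is the difference quotient without the paths that are elsewhere at time [s + h]; [rho h]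
   is [h^-1] times the probability of these. *)
pose U h := \sum_e (h^-1 * p1 h e) * v (s + h) (x + (e : lattice d))
            + (h^-1 * (p0 h - 1)) * v (s + h) x.
pose rho h := - (h^-1 * (p0 h - 1)) - \sum_e h^-1 * p1 h e.
have cU : U h @[h --> 0^'+] --> generator (omega s) (v s) x.
  have -> : generator (omega s) (v s) x =
      \sum_e rt s x e * v s (x + (e : lattice d)) + (- \sum_e rt s x e) * v s x.
    rewrite /generator; under eq_bigr do rewrite mulrBr.
    by rewrite sumrB -mulr_suml; ring.
  apply: cvgD; last by apply: cvgM => //; exact: backward_right_continuous.
  apply: cvg_sum => e; apply: cvgM; first exact: q1.
  exact: backward_right_continuous.
have crho : rho h @[h --> 0^'+] --> (0 : R).
  have E0 : - - (\sum_e rt s x e) - \sum_e rt s x e = 0 by rewrite opprK subrr.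
  rewrite -[X in _ --> X]E0; apply: cvgB; first exact: (cvgN q0).
  by apply: cvg_sum => e; exact: q1.
have clow : - U h - rho h @[h --> 0^'+] --> - generator (omega s) (v s) x.
  rewrite -[X in _ --> X]subr0; apply: cvgB => //; exact: cvgN.
have cup : - U h @[h --> 0^'+] --> - generator (omega s) (v s) x by exact: cvgN.
apply: (squeeze_cvgr _ clow cup).
near=> h; have h0 : 0 < h by [].
have hT : s + h <= T by rewrite -lerBrDl; near: h; apply: nbhs_right_le; rewrite subr_gt0.
have sh : s <= s + h by rewrite lerDl ltW.
pose S := x :: [seq x + unit_vector_val e | e <- index_enum {: unit_vector d}].
have uS : uniq S.
  rewrite /= map_inj_uniq ?index_enum_uniq ?andbT.
    apply/mapP => -[e _] /esym/eqP; apply/negP; exact: addr_unit_vector_neq.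
  by move=> e e' /addrI /val_inj.
have := @mass_integral _ _ (p s (s + h) x) (v (s + h)) S (fun y => mass01 _ _) uS.
rewrite -(chapman_kolmogorov tf)// /S !big_cons !big_map /= -/(p0 h).
have EA : \sum_e h^-1 * p1 h e * v (s + h) (x + (e : lattice d)) =
    h^-1 * \sum_e p1 h e * v (s + h) (x + (e : lattice d)).
  by rewrite mulr_sumr; apply: eq_bigr => e _; rewrite mulrA.
rewrite /= /U /rho EA -mulr_sumr -/(v s x) -/(v (s + h) x) -/(p1 h _).
set A := \sum_(e : unit_vector d) p1 h e * v (s + h) _.
set D := \sum_(e : unit_vector d) p1 h e => H.
have hi : 0 < h^-1 by rewrite invr_gt0.
apply/andP; split.
  have -> : - (h^-1 * A + h^-1 * (p0 h - 1) * v (s + h) x) -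
    (- (h^-1 * (p0 h - 1)) - h^-1 * D) = h^-1 *
    (- A - (p0 h - 1) * v (s + h) x + (p0 h - 1) + D) by ring.
  rewrite ler_pM2l//; move/andP: H; lra.
have -> : - (h^-1 * A + h^-1 * (p0 h - 1) * v (s + h) x) =
  h^-1 * (- A - (p0 h - 1) * v (s + h) x) by ring.
rewrite ler_pM2l//; move/andP: H; lra.
Unshelve. all: by end_near. Qed.

(** Exponential tightness: jumps occur at total rate at most [c] and raise [nr] by at most 1, so
    that [e^nr] grows at rate at most [c e]. The comparison principle, applied with a truncated
    exponential, turns this into an exponential Markov bound. *)
Lemma trans_tail (nr : lattice d -> R) (x0 : lattice d) (k T : R) :
  (forall x (e : unit_vector d), nr (x + (e : lattice d)) <= nr x + 1) -> 0 <= T ->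
  mass (p 0 T x0) [set y | k <= nr y] <= expR (c * expR 1 * T + nr x0 - k).
Proof.
move=> nr1 T0; set B := [set y | _].
pose f x : R := Num.min (expR (nr x - k)) 1.
have f0 x : 0 <= f x by rewrite le_min expR_ge0 ler01.
have fe x (e : unit_vector d) : f (x + (e : lattice d)) <= expR 1 * f x.
  rewrite /f; have [h|h] := leP (expR (nr x - k)) 1.
    rewrite ge_min; apply/orP; left; rewrite -expRD ler_expR.
    by have := nr1 x e; lra.
  rewrite mulr1 ge_min; apply/orP; right.
  by rewrite -[leLHS]expR0 ler_expR ler01.
pose C := c * expR 1.
have Lf (eta : environment d K) x : generator eta f x <= C * f x.
  apply: (@le_trans _ _ (\sum_e jump_rate eta x e * (expR 1 * f x))).
    apply: ler_sum => e _; rewrite ler_wpM2l ?jump_rate_ge0//.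
    by have := fe x e; have := f0 x; lra.
  rewrite -mulr_suml /C -mulrA ler_wpM2r ?total_rate_le//.
  by rewrite mulr_ge0// expR_ge0.
(* [f x * expR (C * (T - s))] is a supersolution of the backward equation. *)
suff H : mass (p 0 T x0) B - f x0 * expR (C * (T - 0)) <= 0.
  have : f x0 <= expR (nr x0 - k) by rewrite /f ge_min lexx.
  rewrite -(ler_pM2l (expR_gt0 (C * (T - 0)))) -expRD.
  have -> : C * (T - 0) + (nr x0 - k) = C * T + nr x0 - k by rewrite subr0; lra.
  by rewrite -/C; lra.
apply: (@backward_comparison _ _ _ omega
  (fun s x => mass (p s T x) B - f x * expR (C * (T - s))) T 1); last 1 first.
- by rewrite lexx.
- move=> x t; apply: cvgB; first exact: backward_continuous.
  by apply: cvgM; [exact: cvg_cst|exact: rderiv_exp_within].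
- move=> s x sT; have D := rderivB (@backward_equation T x B s sT)
    (@rderivZ R (f x) _ _ _ (@rderiv_expR R C T s)).
  eexists; last exact: D.
  set E := expR _; have E0 : 0 < E by exact: expR_gt0.
  have -> : generator (omega s) (fun y => mass (p s T y) B - f y * E) x =
      generator (omega s) (fun y => mass (p s T y) B) x - E * generator (omega s) f x.
    rewrite /generator mulr_sumr -sumrB; apply: eq_bigr => e _; ring.
  have := Lf (omega s) x; rewrite -(ler_pM2l E0); lra.
- move=> s x sT; rewrite lerBlDr.
  apply: (@le_trans _ _ 1); first exact: mass_le1.
  by rewrite lerDl mulr_ge0// expR_ge0.
- move=> x; rewrite subrr mulr0 expR0 mulr1 (trans_diag tf)// subr_le0 indicE.
  case: (boolP (x \in B)) => [|_]; last by rewrite f0.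
  rewrite inE /B /= => kx; rewrite /f le_min lexx andbT -[leLHS]expR0 ler_expR.
  by rewrite subr_ge0.
Qed.

End BackwardEquation.

(** * Ellipticity *)

Section UnitSteps.
Variable d : nat.
Implicit Types z : lattice d.

Lemma norm1_signed_delta i b : norm1 (@signed_delta d (i, b)) = 1.
Proof.
rewrite /norm1 (bigD1 i)//= /signed_delta !mxE !eqxx /= big1 ?addr0.
  by rewrite mulr1 normrX normrN1 expr1n.
by move=> j ji; rewrite !mxE (negbTE ji) andbF mulr0 normr0.
Qed.

Lemma norm1_eq0 z : norm1 z = 0 -> z = 0.
Proof.
move=> z0; apply/(@rowP int d) => j; rewrite mxE; apply/normr0_eq0.
by move: z0; rewrite /norm1 => /psumr_eq0P -> //.
Qed.

Lemma norm1_ge0 z : 0 <= norm1 z.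
Proof. exact: sumr_ge0. Qed.

Lemma exists_unit_step z : z != 0 ->
  exists e : unit_vector d, norm1 (z - (e : lattice d)) = norm1 z - 1.
Proof.
move=> z0; have [i zi0] : exists i, (z : 'rV[int]_d) 0 i != 0.
  apply/existsP; apply: contraNT z0; rewrite negb_exists => /forallP z0.
  by apply/eqP/(@rowP int d) => j; rewrite mxE; apply/eqP; rewrite -[_ == _]negbK.
pose b := (z : 'rV[int]_d) 0 i < 0.
have e1 : norm1 (@signed_delta d (i, b)) == 1 by rewrite norm1_signed_delta.
exists (UnitVector e1); rewrite /norm1 (bigD1 i)// [in RHS](bigD1 i)//=.
rewrite addrAC; congr (_ + _); last first.
  apply: eq_bigr => j ji; congr `| _ |.
  by rewrite /signed_delta !mxE (negbTE ji) andbF mulr0 subr0.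
rewrite /signed_delta !mxE !eqxx /= mulr1 /b; move: zi0.
by case: ltP => /= ? ?; lia.
Qed.

End UnitSteps.

Section LowerBounds.
Variables (R : realType) (d : nat) (K : ellipticity R) (omega : env_path d K).
Variable p : R -> R -> lattice d -> probability (Borel (lattice d)) R.
Hypothesis tf : transition_function p.
Hypothesis hg : has_generator p (fun s => generator (omega s)).
Implicit Types (s t u T : R) (x y : lattice d) (B C : set (lattice d)).

Local Notation c := (max_rate d K).
Local Notation k1 := (kappa1 K).

Lemma near_step t x (e : unit_vector d) (eps : R) : 0 <= t -> 0 < eps ->
  \forall h \near 0^'+, (k1 - eps) * h <= mass (p t (t + h) x) [set x + (e : lattice d)].
Proof.
move=> t0 e0; have := @trans_rderiv _ _ _ _ _ hg t x [set x + (e : lattice d)] t0.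
rewrite generator_indic_step indicE memNset/=; last first.
  by move=> /esym/eqP; rewrite (negbTE (addr_unit_vector_neq _ _)).
move=> /cvgrPdist_lt /(_ _ e0) H.
near=> h; have h0 : 0 < h by [].
have : `|jump_rate (omega t) x e -
    h^-1 * (mass (p t (t + h) x) [set x + (e : lattice d)] - 0)| < eps by near: h.
rewrite subr0 ltr_norml => /andP[_].
have /andP[ke _] := jump_rate_bounds (omega t) x e => He.
have : k1 - eps <= h^-1 * mass (p t (t + h) x) [set x + (e : lattice d)] by lra.
by rewrite -(ler_pM2l h0) mulrA divff ?mul1r ?gt_eqF//; lra.
Unshelve. all: by end_near. Qed.

(** Up to this time, [c h (kappa1 + c) <= kappa1 / 2], the condition under which [step_ge] retains
    half of the rate [kappa1]. The [+ 1] keeps the denominator positive when [c = 0]. *)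
Definition small_time : R := k1 / 2 / (c * (k1 + c) + 1).

Lemma small_time_gt0 : 0 < small_time.
Proof.
have := kappa1_gt0 K; have := max_rate_ge0 d K => c0 k0.
by rewrite !divr_gt0// ltr_wpDl// mulr_ge0// addr_ge0// ltW.
Qed.

Lemma small_timeP (h : R) : 0 <= h -> h <= small_time ->
  c * h * (k1 + c) <= k1 / 2 /\ c * h <= 1 / 2.
Proof.
have k0 := kappa1_gt0 K; have c0 := max_rate_ge0 d K.
move=> h0; rewrite ler_pdivlMr => [H|]; last first.
  by rewrite ltr_wpDl// mulr_ge0// addr_ge0// ltW.
have H1 : c * h * (k1 + c) <= k1 / 2 by lra.
split=> //; have : c * h * k1 <= k1 / 2.
  have ch : 0 <= c * h * c := mulr_ge0 (mulr_ge0 c0 h0) c0.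
  lra.
by move=> H2; rewrite -(ler_pM2r k0); lra.
Qed.

(** Put [q = c (u - s)]. At time [u] the mass at [x] is at least [1 - q] and the mass at [y] at most
    [q], so that the mass at [y] grows at rate at least [(1 - q) kappa1 - q c], which is
    [kappa1 - q (kappa1 + c) >= kappa1 / 2]. *)
Lemma step_ge s t x (e : unit_vector d) : 0 <= s -> s <= t -> t - s <= small_time ->
  k1 / 2 * (t - s) <= mass (p s t x) [set x + (e : lattice d)].
Proof.
move=> s0 st tst; set y := x + _.
have yx : y != x by exact: addr_unit_vector_neq.
suff : mass (p s s x) [set y] - k1 / 2 * (s - s) <=
       mass (p s t x) [set y] - k1 / 2 * (t - s).
  rewrite (trans_diag tf)// subrr mulr0 subr0 indicE memNset/=; last first.
    by move=> /esym/eqP; rewrite (negbTE yx).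
  by lra.
apply: (@dini_nondecreasing _ (fun t => mass (p s t x) [set y] - k1 / 2 * (t - s))) => //.
  move=> u; apply: cvgB; first exact: (trans_continuous_itv hg).
  exact: within_continuous_affine.
move=> u eps /andP[su ut] eps0; have u0 : 0 <= u by lra.
have Hstay := near_stay hg y u0 eps0.
have Hstep := near_step x e u0 eps0.
near=> h; have h0 : 0 < h by [].
have h1 : 1 - (c + eps) * h <= mass (p u (u + h) y) [set y] by near: h.
have h2 : (k1 - eps) * h <= mass (p u (u + h) x) [set y] by near: h.
have uh : u <= u + h by lra.
have uS : uniq [:: x; y] by rewrite /= inE eq_sym yx.
have := @mass_integral _ _ (p s u x) (fun z => mass (p u (u + h) z) [set y])
   [:: x; y] (fun z => mass01 _ _) uS.
rewrite -(chapman_kolmogorov tf)// !big_cons !big_nil !addr0 => /andP[+ _].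
have a1 := stay_ge tf hg x s0 su.
have b1 : mass (p s u x) [set y] <= 1 - mass (p s u x) [set x].
  rewrite -massC; apply: le_mass => z /= ->; exact/eqP.
have b0 := mass_ge0 (p s u x) [set y].
have A0 := mass_ge0 (p u (u + h) x) [set y].
move: a1 b1 b0 A0 h1 h2.
set a := mass (p s u x) [set x]; set b := mass (p s u x) [set y].
set A := mass (p u (u + h) x) [set y]; set D := mass (p u (u + h) y) [set y].
move=> a1 b1 b0 A0 h1 h2 H.
have c0 := max_rate_ge0 d K; have k0 := kappa1_gt0 K.
have us0 : 0 <= u - s by rewrite subr_ge0.
have [q1 q2] : c * (u - s) * (k1 + c) <= k1 / 2 /\ c * (u - s) <= 1 / 2.
  by apply: small_timeP => //; lra.
move: a1 q1 q2 b1; set q := c * (u - s) => a1 q1 q2 b1.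
have q0 : 0 <= q by rewrite mulr_ge0.
have g1 : (1 - q) * ((k1 - eps) * h) <= a * A.
  apply: (@le_trans _ _ ((1 - q) * A)); first by rewrite ler_wpM2l//; lra.
  by rewrite ler_wpM2r.
have g2 : b - q * ((c + eps) * h) <= b * D.
  apply: (@le_trans _ _ (b * (1 - (c + eps) * h))); last by rewrite ler_wpM2l.
  have : b * ((c + eps) * h) <= q * ((c + eps) * h).
    have ceh : 0 <= (c + eps) * h by apply: mulr_ge0; lra.
    by apply: ler_wpM2r => //; lra.
  lra.
have g3 : k1 / 2 * h - eps * h <= (1 - q) * ((k1 - eps) * h) - q * ((c + eps) * h).
  have -> : (1 - q) * ((k1 - eps) * h) - q * ((c + eps) * h) =
    (k1 - q * (k1 + c) - eps) * h by ring.
  by rewrite -mulrBl; apply: ler_wpM2r; lra.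
lra.
Unshelve. all: by end_near. Qed.

(** Cut the time into [n] slots of length [h]. In each slot the walk steps towards [y], or stays if
    it is already there; the minimum bounds both probabilities from below. Waiting makes parity
    irrelevant. *)
Lemma path_ge (h : R) n s x y : 0 <= s -> 0 <= h -> h <= small_time ->
  norm1 (y - x) <= n%:Z ->
  (Num.min (1 / 2) (k1 / 2 * h)) ^+ n <= mass (p s (s + n%:R * h) x) [set y].
Proof.
move=> s0 h0 hs; set m := Num.min _ _.
have m0 : 0 <= m.
  by rewrite le_min divr_ge0//= mulr_ge0// divr_ge0// ltW// kappa1_gt0.
elim: n s x s0 => [|n IH] s x s0.
  move=> yx; have /norm1_eq0/eqP : norm1 (y - x) = 0.
    by apply/eqP; rewrite eq_le yx norm1_ge0.
  rewrite subr_eq0 => /eqP ->; rewrite expr0 mul0r addr0 (trans_diag tf)//.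
  by rewrite indicE mem_set.
move=> yx; have ssh : s <= s + h by lra.
have shn : s + h <= s + h + n%:R * h by rewrite lerDl mulr_ge0.
have -> : s + n.+1%:R * h = s + h + n%:R * h by rewrite -natr1; ring.
have sh0 : 0 <= s + h by lra.
have [yx0|yx0] := eqVneq (y - x) 0.
  have st : m <= mass (p s (s + h) x) [set x].
    apply: (@le_trans _ _ (1 - c * (s + h - s))); last exact: (stay_ge tf hg).
    have [_] := small_timeP h0 hs; rewrite [s + h]addrC addrK => H.
    by rewrite ge_min; apply/orP; left; lra.
  apply: le_trans (chapman_ge1 tf x x [set y] s0 ssh shn).
  rewrite exprS; apply: ler_pM => //; first exact: exprn_ge0.
  by apply: IH => //; rewrite yx0 /norm1 big1// => i _; rewrite mxE normr0.
have [e he] := exists_unit_step yx0.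
have st : m <= mass (p s (s + h) x) [set x + (e : lattice d)].
  apply: (@le_trans _ _ (k1 / 2 * (s + h - s))).
    by rewrite [s + h]addrC addrK ge_min lexx orbT.
  by apply: step_ge => //; lra.
apply: le_trans (chapman_ge1 tf x (x + (e : lattice d)) [set y] s0 ssh shn).
rewrite exprS; apply: ler_pM => //; first exact: exprn_ge0.
by apply: IH => //; rewrite opprD addrA he; lia.
Qed.

End LowerBounds.

Section EllipticBound.
Variables (R : realType) (d : nat) (K : ellipticity R).

Lemma elliptic_lower_bound (M : R) : exists2 C : R, 0 <= C &
  forall (omega : env_path d K)
    (p : R -> R -> lattice d -> probability (Borel (lattice d)) R),
  transition_function p -> has_generator p (fun s => generator (omega s)) ->
  forall s t x y, 0 <= s -> 1 <= t - s -> (norm1 (y - x))%:~R <= M * (t - s) ->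
  expR (- C * (t - s)) <= mass (p s t x) [set y].
Proof.
have k0 := kappa1_gt0 K; have t0 := small_time_gt0 d K.
(* The time is cut into between [k] and [2 k] slots per unit: [k >= M] allows enough steps to reach
   [y], the inverse of [small_time] makes the slots short, and [k >= 1] ensures that rounding up at
   most doubles their number. Then [m] is the bound for a slot of the least length [(2 k)^-1]. *)
pose k : R := `|M| + (small_time d K)^-1 + 1.
have tV0 : 0 < (small_time d K)^-1 by rewrite invr_gt0.
have kM : M <= k by rewrite /k; have := ler_norm M; lra.
have k_1 : 1 <= k by rewrite /k; have := normr_ge0 M; lra.
have kt : (small_time d K)^-1 <= k by rewrite /k; have := normr_ge0 M; lra.
have kgt0 : 0 < k by lra.
pose m := Num.min (1 / 2) (kappa1 K / 2 * (2 * k)^-1).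
have m0 : 0 < m by rewrite lt_min divr_gt0//= !mulr_gt0// invr_gt0 mulr_gt0.
have m1 : m <= 1 by rewrite ge_min; apply/orP; left; lra.
exists (- ln m * (2 * k)); first by rewrite mulr_ge0 ?oppr_ge0 ?ln_le0// mulr_ge0// ltW.
move=> omega p tf hg s t x y s0 ts yx.
pose n := (Num.truncn (k * (t - s))).+1.
have kts : 1 <= k * (t - s) by rewrite -[1]mulr1 ler_pM.
have n1 : k * (t - s) <= n%:R by rewrite ltW// truncnS_gt.
have n2 : n%:R <= 2 * k * (t - s).
  have : (Num.truncn (k * (t - s)))%:R <= k * (t - s) by rewrite truncn_le; lra.
  by rewrite /n -natr1; lra.
have n0 : 0 < n%:R :> R by rewrite ltr0n.
pose h := (t - s) / n%:R.
have hk : h <= k^-1.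
  by rewrite /h ler_pdivrMr// -(ler_pM2l kgt0) mulrA divff ?gt_eqF// mul1r.
have hs : h <= small_time d K.
  by apply: le_trans hk _; rewrite -[leRHS]invrK lef_pV2// posrE.
have h2 : (2 * k)^-1 <= h.
  rewrite /h ler_pdivlMr// -(ler_pM2l (_ : 0 < 2 * k)); last by lra.
  by rewrite mulrA divff ?mul1r//; apply: lt0r_neq0; lra.
have h0 : 0 <= h by rewrite /h divr_ge0//; lra.
have -> : t = s + n%:R * h by rewrite /h mulrC divfK ?gt_eqF//; lra.
have yxn : norm1 (y - x) <= n%:Z.
  rewrite -(ler_int R); apply: (le_trans yx); apply: le_trans n1.
  by rewrite ler_wpM2r//; lra.
apply: le_trans (path_ge tf hg s0 h0 hs yxn).
apply: (@le_trans _ _ (m ^+ n)); last first.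
  rewrite lerXn2r ?nnegrE//; first exact: ltW.
    by rewrite le_min divr_ge0//= mulr_ge0// divr_ge0// ltW.
  rewrite le_min ge_min lexx/= ge_min; apply/orP; right.
  by rewrite ler_wpM2l// divr_ge0// ltW.
rewrite -[leRHS]lnK ?posrE ?exprn_gt0// ler_expR lnXn// -mulr_natr.
have -> : s + n%:R * h - s = t - s.
  by rewrite addrC addKr /h mulrC divfK ?gt_eqF.
have : ln m <= 0 by exact: ln_le0.
nra.
Qed.

End EllipticBound.

(** * Measurable dependence on the environment *)

Section CadlagMeasurability.
Variables (R : realType) (E : puniformType).
Implicit Types (x : cadlag_path R E).

(* The coordinates are not continuous for the Skorokhod topology, but to visit an
   open set during an open time interval is an open condition. *)
Lemma open_hit (V : set E) (a b : R) : 0 <= a -> open V ->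
  open [set x : cadlag_path R E | exists2 s, a < s < b & V (x s)].
Proof.
move=> a0 oV.
change (skorokhod_open [set x : cadlag_path R E | exists2 s, a < s < b & V (x s)]).
move=> x x_ [s /andP[as_ sb] Vxs] [l [_ lid lx]].
have /nbhsP [W eW WV] : nbhs (x s) V by exact: open_nbhs_nbhs.
pose e := Num.min (s - a) (b - s).
have e0 : 0 < e by rewrite lt_min !subr_gt0 as_ sb.
have H1 := lid _ e0.
have H2 := lx s _ (entourage_inv eW).
near=> n; exists (l n s).
  have : `|l n s - s| < e by near: n; move: H1; apply: filterS => n; apply; lra.
  by rewrite lt_min !ltr_norml => /andP[/andP[? ?] /andP[? ?]]; lra.
apply: WV; rewrite /xsection /= inE.
have : W^-1%relation (x_ n (l n s), x s).
  by near: n; move: H2; apply: filterS => n; apply; lra.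
by [].
Unshelve. all: by end_near. Qed.

(** Right continuity turns the value at [t] into visits during open intervals to the right of [t]:
    for [t >= 0] this exhibits the condition as a countable intersection of the open events of
    [open_hit]. *)
Lemma coord_geE (g : E -> R) (t c : R) x : continuous g ->
  (c <= g (x t)) <-> forall k : nat,
    exists2 s, t < s < t + k.+1%:R^-1 & c - k.+1%:R^-1 < g (x s).
Proof.
move=> cg.
have gx : g (x s) @[s --> t^'+] --> g (x t).
  apply: (@cvg_comp _ _ _ x g); last exact: cg.
  by have [_ rx _] := path_cadlag x; exact: rx.
split=> [cx k|H].
  have k0 : 0 < k.+1%:R^-1 :> R by rewrite invr_gt0 ltr0n.
  move/cvgrPdist_lt : gx => /(_ _ k0) gx.
  have [s [st xs]] : exists s, t < s < t + k.+1%:R^-1 /\ `|g (x t) - g (x s)| < k.+1%:R^-1.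
    near t^'+ => s; exists s; split; last by near: s.
    by apply/andP; split; near: s; [exact: nbhs_right_gt|apply: nbhs_right_lt; rewrite ltrDl].
  move: st xs; move: (k.+1%:R^-1) => ek st xs; exists s => //.
  by move: xs; rewrite ltr_norml; lra.
rewrite leNgt; apply/negP => xc.
pose e := (c - g (x t)) / 2.
have e0 : 0 < e by rewrite divr_gt0// subr_gt0.
move/cvgrPdist_lt : gx => /(_ _ e0) [d /= d0 Hd].
pose k := (Num.truncn (d^-1 + e^-1)).
have ke : d^-1 + e^-1 < k.+1%:R by exact: truncnS_gt.
have kp : 0 < k.+1%:R :> R by rewrite ltr0n.
have dV : 0 < d^-1 by rewrite invr_gt0.
have eV : 0 < e^-1 by rewrite invr_gt0.
have k1 : k.+1%:R^-1 < d.
  by rewrite -[ltRHS]invrK ltf_pV2 ?posrE//; lra.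
have k2 : k.+1%:R^-1 < e.
  by rewrite -[ltRHS]invrK ltf_pV2 ?posrE//; lra.
have [s /andP[ts st] xs] := H k.
move: k1 k2 st xs; move: (k.+1%:R^-1) => ek k1 k2 st xs.
have : `|g (x t) - g (x s)| < e.
  by apply: Hd => //=; rewrite ltr0_norm; lra.
have : e = (c - g (x t)) / 2 by [].
by rewrite ltr_norml; lra.
Unshelve. all: by end_near. Qed.

Lemma measurable_coord (g : E -> R) (t : R) : 0 <= t -> continuous g ->
  measurable_fun setT (fun x : Borel (cadlag_path R E) => g (x t)).
Proof.
move=> t0 cg; apply: (measurability (@measurable_realfun.RGenCInfty.G R)) => [|/= _ [_] [c] -> <-].
  exact: measurable_realfun.RGenCInfty.measurableE.
rewrite setTI.
have -> : (fun x : cadlag_path R E => g (x t)) @^-1` `[c, +oo[ =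
   \bigcap_k [set x : cadlag_path R E |
     exists2 s, t < s < t + k.+1%:R^-1 & (g @^-1` `]c - k.+1%:R^-1, +oo[) (x s)].
  apply/seteqP; split => x /=; rewrite in_itv/= andbT.
    move=> /(coord_geE _ _ _ cg) H k _; have [s st xs] := H k.
    by exists s => //=; rewrite in_itv/= andbT.
  move=> H; apply/(coord_geE _ _ _ cg) => k; have [s st] := H k I.
  by rewrite /= in_itv/= andbT; exists s.
apply: bigcapT_measurable => k; apply: sub_sigma_algebra.
by apply: open_hit => //; apply: open_comp.
Qed.

(** The time integrals of [picard] require measurability in the pair. By right continuity the
    visiting times of [coord_geE] may be taken rational, which leaves countable unions of measurable
    rectangles. *)
Lemma measurable_coord_joint (g : E -> R) : continuous g ->
  measurable_fun setT (fun z : R * Borel (cadlag_path R E) => g (z.2 z.1)).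
Proof.
move=> cg; have mc (t : R) : measurable_fun setT (fun x : Borel (cadlag_path R E) => g (x t)).
  have [t0|t0] := leP 0 t; first exact: measurable_coord.
  rewrite (_ : (fun _ => _) = (fun x : cadlag_path R E => g (x 0))).
    exact: measurable_coord.
  by apply/funext => x; have [-> //] := path_cadlag x; exact: ltW.
apply: (measurability (@measurable_realfun.RGenCInfty.G R)) => [|/= _ [_] [c] -> <-].
  exact: measurable_realfun.RGenCInfty.measurableE.
rewrite setTI.
have -> : (fun z : R * cadlag_path R E => g (z.2 z.1)) @^-1` `[c, +oo[ =
   \bigcap_k \bigcup_(q : rat) ([set r : R | r < ratr q < r + k.+1%:R^-1] `*`
     [set x : cadlag_path R E | c - k.+1%:R^-1 < g (x (ratr q))]).
  apply/seteqP; split => -[r x] /=; rewrite in_itv/= andbT.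
    move=> /(coord_geE _ _ _ cg) H k _; have [s /andP[s1 s2] xs] := H k.
    have gx : g (x s') @[s' --> s^'+] --> g (x s).
      apply: (@cvg_comp _ _ _ x g); last exact: cg.
      by have [_ rx _] := path_cadlag x; exact: rx.
    have e0 : 0 < g (x s) - (c - k.+1%:R^-1) by rewrite subr_gt0.
    move/cvgrPdist_lt : gx => /(_ _ e0) [d /= d0 Hd].
    have sd : s < Num.min (s + d) (r + k.+1%:R^-1).
      by rewrite lt_min s2 ltrDl d0.
    have [q] := rat_in_itvoo sd; rewrite in_itv/= lt_min => /andP[q1 /andP[q2 q3]].
    exists q => //=; split; first by rewrite q3 andbT; lra.
    have : `|g (x s) - g (x (ratr q))| < g (x s) - (c - k.+1%:R^-1).
      by apply: Hd => //=; rewrite ltr0_norm; lra.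
    by rewrite ltr_norml => /andP[_]; rewrite ltrD2l ltrN2.
  move=> H; apply/(coord_geE _ _ _ cg) => k; have [q _ [/= q1 q2]] := H k I.
  by exists (ratr q).
apply: bigcapT_measurable => k; apply: bigcupT_measurable_rat => q.
apply: measurableX.
  rewrite (_ : [set _ | _] = `]ratr q - k.+1%:R^-1, ratr q[%classic).
    exact: measurable_itv.
  move: (k.+1%:R^-1) => ek; apply/seteqP; split => r /=; rewrite in_itv/=.
    by move=> /andP[? ?]; apply/andP; split; lra.
  by move=> /andP[? ?]; apply/andP; split; lra.
have := mc (ratr q) measurableT `]c - k.+1%:R^-1, +oo[%classic (measurable_itv _).
rewrite setTI; congr measurable.
by apply/seteqP; split => x /=; rewrite in_itv/= andbT.
Qed.

End CadlagMeasurability.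

Section ConcretePaths.
Variables (R : realType) (d : nat) (K : ellipticity R).

Lemma measurable_walk_coord (t : R) (B : set (lattice d)) : 0 <= t ->
  measurable ([set X | B (X t)] : set (Borel (walk_path R d))).
Proof.
move=> t0; pose g : lattice d -> R := \1_B.
have cg : continuous g.
  move=> x A /nbhs_singleton Agx.
  by apply: open_nbhs_nbhs; split; [exact: discrete_open|].
have := measurable_coord t0 cg measurableT (measurable_itv `[1, +oo[).
rewrite setTI; congr measurable; apply/seteqP; split => X /=.
  rewrite in_itv/= andbT /g indicE; case: (boolP (X t \in B)) => [|_].
    by rewrite inE.
  by rewrite ler10.
by move=> BX; rewrite in_itv/= andbT /g indicE mem_set.
Qed.

Lemma jump_rate_continuous (x : lattice d) (e : unit_vector d) :
  continuous (fun eta : environment d K => jump_rate eta x e).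
Proof.
move=> eta.
apply: (@cvg_comp _ _ _ (fun eta : environment d K => eta x e)
  (fun r : rate K => set_val r)).
  apply: (@cvg_comp _ _ _ (fun eta : environment d K => eta x)
    (fun q : elliptic_rates d K => q e)).
    exact: (@proj_continuous _ (fun=> elliptic_rates d K) x eta).
  exact: (@proj_continuous _ (fun=> rate K) e (eta x)).
exact: (@initial_continuous (set_type [set r : R | kappa1 K <= r <= kappa2 K]) R set_val).
Qed.

Lemma measurable_jump_rate (x : lattice d) (e : unit_vector d) :
  measurable_fun setT
    (fun z : R * Borel (env_path d K) => jump_rate (z.2 z.1) x e).
Proof.
exact: (@measurable_coord_joint R (environment d K)
  (fun eta : environment d K => jump_rate eta x e)
  (@jump_rate_continuous x e)).
Qed.

End ConcretePaths.

(** * Tail integrals and Picard iterates *)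

Section TailIntegral.
Variable R : realType.
Local Notation leb := (@lebesgue_measure R).

Lemma integrable_on_itv (G : R -> R) (a b N : R) : measurable_fun setT G ->
  (forall r, a <= r <= b -> `|G r| <= N) ->
  leb.-integrable `[a, b] (EFin \o G).
Proof.
move=> mG GN; apply: measurable_bounded_integrable => //.
- rewrite /= lebesgue_measure_itv/=; case: ifP => // _.
  by rewrite -EFinB ltry.
- exact: measurable_funTS.
- exists N; split; first exact: num_real.
  move=> M NM r /=; rewrite in_itv/= => rab.
  by apply: le_trans (GN r rab) _; exact: ltW.
Qed.

Lemma tail_integral_bounds (G : R -> R) (T s t a b N : R) :
  measurable_fun setT G -> s <= t -> t <= T ->
  (forall r, s <= r <= T -> `|G r| <= N) ->
  (forall r, s <= r < t -> a <= G r <= b) ->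
  a * (t - s) <= \int[leb]_(r in `[s, T]) G r - \int[leb]_(r in `[t, T]) G r
    <= b * (t - s).
Proof.
move=> mG st tT GN Gab.
have E : `[s, T]%classic = `[s, t[ `|` `[t, T] :> set R.
  apply/seteqP; split => r /=; rewrite !in_itv/=.
    by move=> /andP[-> ->]; case: (ltP r t) => _; [left|right].
  by move=> [] /andP[h1 h2]; apply/andP; split; lra.
have iG := integrable_on_itv mG GN.
have iA : leb.-integrable `[s, t[ (EFin \o G).
  by apply: integrableS iG => //; rewrite E.
have -> : \int[leb]_(r in `[s, T]) G r - \int[leb]_(r in `[t, T]) G r =
    \int[leb]_(r in `[s, t[) G r.
  rewrite E Rintegral_setU//.
  - by rewrite addrK.
  - by rewrite -E.
  - apply/disj_setPS => r [/=]; rewrite !in_itv/= => /andP[_ h1] /andP[h2 _].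
    by move: h1; rewrite ltNge h2.
have lt : fine (leb `[s, t[%classic) = t - s.
  rewrite lebesgue_measure_itv/= lte_fin; case: ltP => //= ts.
  by apply/eqP; rewrite eq_sym subr_eq0 eq_le ts st.
have fin : (leb `[s, t[%classic < +oo)%E.
  by rewrite lebesgue_measure_itv/=; case: ifP => // _; rewrite -EFinB ltry.
have ic (k : R) : leb.-integrable `[s, t[ (EFin \o cst k).
  by apply: measurable_bounded_integrable => //; exact: bounded_cst.
apply/andP; split.
  rewrite -lt -(@Rintegral_cst _ _ _ leb `[s, t[)//; apply: le_Rintegral => //; first exact: ic.
  by move=> r /=; rewrite in_itv/= => /Gab /andP[].
rewrite -lt -(@Rintegral_cst _ _ _ leb `[s, t[)//; apply: le_Rintegral => //; first exact: ic.
by move=> r /=; rewrite in_itv/= => /Gab /andP[].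
Qed.

Lemma rderiv_tail_integral (G : R -> R) (T s N : R) :
  measurable_fun setT G -> s < T -> (forall r, s <= r <= T -> `|G r| <= N) ->
  G (s + h) @[h --> 0^'+] --> G s ->
  rderiv (fun u => \int[leb]_(r in `[u, T]) G r) s (- G s).
Proof.
move=> mG sT GN cG; apply/cvgrPdist_le => e e0.
move/cvgrPdist_le: cG => /(_ _ e0) [de /= de0 Hd].
near=> h; have h0 : 0 < h by [].
have hT : s + h <= T by rewrite -lerBrDl; near: h; apply: nbhs_right_le; rewrite subr_gt0.
have hde : h < de by near: h; exact: nbhs_right_lt.
have Gab r : s <= r < s + h -> G s - e <= G r <= G s + e.
  move=> /andP[sr rh]; have [->|rs] := eqVneq r s.
    by apply/andP; split; lra.
  have := Hd (r - s); rewrite /= sub0r normrN ger0_norm ?subr_ge0//.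
  have sr' : s < r by rewrite lt_neqAle eq_sym rs.
  have rsd : r - s < de by lra.
  have -> : s + (r - s) = r by lra.
  by rewrite subr_gt0 => /(_ rsd sr'); rewrite ler_norml => /andP[? ?]; apply/andP; split; lra.
have sh : s <= s + h by lra.
have /andP[] := tail_integral_bounds mG sh hT GN Gab.
set X := \int[_]_(r in _) _; set Y := \int[_]_(r in _) _ => H1 H2.
rewrite -(ler_pM2l h0) -{1}[h]gtr0_norm// -normrM.
have -> : h * (- G s - h^-1 * (Y - X)) = X - Y - h * G s.
  by field; exact: lt0r_neq0.
by rewrite ler_norml; apply/andP; split; lra.
Unshelve. all: by end_near. Qed.

End TailIntegral.

Section Picard.
Variables (R : realType) (d : nat) (K : ellipticity R) (T : R) (B : set (lattice d)).
Implicit Types (omega : env_path d K) (x : lattice d) (s t r : R).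
Local Notation leb := (@lebesgue_measure R).
Local Notation c := (max_rate d K).

(* The iterates converge to [expR (c * (T - s)) * p s T x B], whose Duhamel formula
   has only nonnegative terms. *)
Fixpoint picard n s omega x : R :=
  if n is m.+1 then
    \1_B x + \int[leb]_(r in `[s, T]) uniformized (omega r) (picard m r omega) x
  else 0.

Lemma uniformized_ge0 (eta : environment d K) f x :
  (forall y, 0 <= f y) -> 0 <= uniformized eta f x.
Proof.
move=> f0; rewrite uniformizedE addr_ge0//.
  by apply: sumr_ge0 => e _; rewrite mulr_ge0// jump_rate_ge0.
by rewrite mulr_ge0// subr_ge0 total_rate_le.
Qed.

Lemma picard_ge0 n s omega x : 0 <= picard n s omega x.
Proof.
elim: n s x => [//|n IH] s x /=; rewrite addr_ge0 ?indicE//.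
by apply: Rintegral_ge0 => r _; exact: uniformized_ge0.
Qed.

Lemma measurable_uniformized_picard n x :
  (forall y, measurable_fun setT
    (fun z : R * Borel (env_path d K) => picard n z.1 z.2 y)) ->
  measurable_fun setT (fun z : R * Borel (env_path d K) =>
    uniformized (z.2 z.1) (picard n z.1 z.2) x).
Proof.
move=> mn; rewrite /uniformized /generator; apply: measurable_funD.
  apply: measurable_sum => e; apply: measurable_funM.
    exact: measurable_jump_rate.
  by apply: measurable_funB.
by apply: measurable_funM.
Qed.

Lemma measurable_uniformized_path n omega x :
  (forall y, measurable_fun setT
    (fun z : R * Borel (env_path d K) => picard n z.1 z.2 y)) ->
  measurable_fun setT (fun r => uniformized (omega r) (picard n r omega) x).
Proof.
move=> mn; exact: (measurableT_comp (measurable_uniformized_picard x mn)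
  (measurable_fun_pair (@measurable_id _ R setT)
    (measurable_cst (omega : Borel (env_path d K))))).
Qed.

Lemma measurable_picard n x : measurable_fun setT
  (fun z : R * Borel (env_path d K) => picard n z.1 z.2 x).
Proof.
elim: n x => [|n IH] x /=; first exact: measurable_cst.
apply: measurable_funD; first exact: measurable_cst.
(* The domain [[s, T]] depends on the parameter [s]. Extending the integrand by 0 makes the domain
   fixed, and nonnegativity makes Tonelli's theorem available. *)
pose H (w : (R * Borel (env_path d K)) * R) : \bar R :=
  if (w.1.1 <= w.2) && (w.2 <= T) then
    (uniformized (w.1.2 w.2) (picard n w.2 w.1.2) x)%:E else 0%E.
have mH : measurable_fun setT H.
  apply: measurable_fun_ifT.
  - apply: measurable_and; apply: measurable_fun_ler.
    + by apply: measurableT_comp; [exact: measurable_fst|exact: measurable_fst].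
    + exact: measurable_snd.
    + exact: measurable_snd.
    + exact: measurable_cst.
  - apply/measurable_EFinP.
    have mg : measurable_fun setT
        (fun w : (R * Borel (env_path d K)) * R => (w.2, w.1.2)).
      apply: measurable_fun_pair; first exact: measurable_snd.
      by apply: measurableT_comp; [exact: measurable_snd|exact: measurable_fst].
    exact: (measurableT_comp (measurable_uniformized_picard x IH) mg).
  - exact: measurable_cst.
have H0 w : (0 <= H w)%E.
  rewrite /H; case: ifP => // _; rewrite lee_fin.
  by apply: uniformized_ge0 => y; exact: picard_ge0.
have := measurable_fun_fubini_tonelli_F (m2 := leb) H mH H0.
move=> /(measurableT_comp (fine_measurable measurableT)).
apply: eq_measurable_fun => -[s omega] _ /=.
rewrite /Rintegral; congr fine; rewrite [RHS]integral_mkcond /fubini_F.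
apply: eq_integral => r _; rewrite /H patchE /= mem_setE in_itv/=.
by case: ifP.
Qed.

(** The bound may depend on [n]: it serves to integrate one iterate at a time and to make it
    Lipschitz in time. *)
Lemma picard_le n : exists2 N : R, 0 <= N &
  forall omega s x, 0 <= s <= T -> picard n s omega x <= N.
Proof.
elim: n => [|n [N N0 IH]]; first by exists 0.
have cN0 : 0 <= c * N by rewrite mulr_ge0// max_rate_ge0.
exists (1 + c * N * Num.max T 0).
  by rewrite addr_ge0// mulr_ge0// le_max lexx orbT.
move=> omega s x /andP[s0 sT] /=.
apply: lerD; first by rewrite indicE; case: (_ \in _); rewrite ?ler01.
have G1 r : s <= r <= T -> 0 <= uniformized (omega r) (picard n r omega) x <= c * N.
  move=> /andP[sr rT]; rewrite uniformized_ge0 /=; last by move=> y; exact: picard_ge0.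
  by apply: uniformized_le => y; apply: IH; rewrite rT (le_trans s0).
have mG := measurable_uniformized_path omega x (measurable_picard n).
have GN r : s <= r <= T -> `|uniformized (omega r) (picard n r omega) x| <= c * N.
  by move=> /G1 /andP[h0 h1]; rewrite ger0_norm.
have GN' r : s <= r < T -> 0 <= uniformized (omega r) (picard n r omega) x <= c * N.
  by move=> /andP[h0 h1]; apply: G1; rewrite h0 ltW.
have /andP[_] := tail_integral_bounds mG sT (lexx _) GN GN'.
have -> : `[T, T]%classic = [set T] by rewrite set_itv1.
rewrite Rintegral_set1 subr0 => H; apply: le_trans H _.
by rewrite ler_wpM2l// le_max; apply/orP; left; lra.
Qed.

End Picard.

Section PicardConvergence.
Variables (R : realType) (d : nat) (K : ellipticity R) (T : R) (B : set (lattice d)).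
Implicit Types (x : lattice d) (s t r : R).
Variable omega : env_path d K.
Local Notation leb := (@lebesgue_measure R).
Local Notation c := (max_rate d K).
Local Notation w n s x := (picard T B n s omega x).
Local Notation G n x := (fun r => uniformized (omega r) (picard T B n r omega) x).

Lemma uniformized_path_le n : exists2 N : R, 0 <= N &
  forall r x, 0 <= r <= T -> `|G n x r| <= N.
Proof.
have [N N0 HN] := picard_le K T B n; exists (c * N).
  by rewrite mulr_ge0// max_rate_ge0.
move=> r x rT; rewrite ger0_norm; last first.
  by apply: uniformized_ge0 => y; exact: picard_ge0.
by apply: uniformized_le => y; exact: HN.
Qed.

Lemma picard_lipschitz n x : exists2 N : R, 0 <= N &
  forall s t, 0 <= s -> s <= t -> t <= T -> `|w n s x - w n t x| <= N * (t - s).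
Proof.
case: n => [|n]; first by exists 0 => // s t _ _ _ /=; rewrite subrr normr0 mul0r.
have [N N0 HN] := uniformized_path_le n; exists N => // s t s0 st tT /=.
have mG := measurable_uniformized_path omega x (measurable_picard T B n).
have GN r : s <= r <= T -> `|G n x r| <= N.
  by move=> /andP[sr rT]; apply: HN; rewrite rT (le_trans s0).
have Gab r : s <= r < t -> - N <= G n x r <= N.
  by move=> /andP[sr rt]; rewrite -ler_norml; apply: GN; rewrite sr/=; lra.
have := tail_integral_bounds mG st tT GN Gab.
by rewrite opprD addrACA subrr add0r ler_norml mulNr.
Qed.

Lemma picard_continuous n x : {within `[0, T], continuous (fun s => w n s x)}.
Proof. by have [N N0 HN] := picard_lipschitz n x; exact: within_lipschitz HN. Qed.

Lemma picard_right_continuous n x s : 0 <= s < T ->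
  w n (s + h) x @[h --> 0^'+] --> w n s x.
Proof.
move=> /andP[s0 sT]; have [N N0 HN] := picard_lipschitz n x.
apply/cvgrPdist_le => e e0; have N1 : 0 < N + 1 by lra.
near=> h; have h0 : 0 < h by [].
have hT : s + h <= T by rewrite -lerBrDl; near: h; apply: nbhs_right_le; rewrite subr_gt0.
have sh : s <= s + h by lra.
apply: le_trans (HN _ _ s0 sh hT) _.
have : h <= e / (N + 1) by near: h; apply: nbhs_right_le; rewrite divr_gt0.
by rewrite ler_pdivlMr//; lra.
Unshelve. all: by end_near. Qed.

Lemma jump_rate_right_continuous s x (e : unit_vector d) :
  jump_rate (omega (s + h)) x e @[h --> 0^'+] --> jump_rate (omega s) x e.
Proof.
have : jump_rate (omega u) x e @[u --> s^'+] --> jump_rate (omega s) x e.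
  apply: (@cvg_comp _ _ _ omega (fun eta : environment d K => jump_rate eta x e)).
    by have [_ rx _] := path_cadlag omega; exact: rx.
  exact: jump_rate_continuous.
move=> /cvgrPdist_lt H; apply/cvgrPdist_lt => eps eps0.
have [de /= de0 Hd] := H _ eps0; exists de => // h.
rewrite /ball_ /= sub0r normrN => hde h0.
by apply: Hd => /=; [rewrite opprD addrA subrr sub0r normrN|rewrite ltrDl].
Qed.

Lemma uniformized_right_continuous n x s : 0 <= s < T ->
  G n x (s + h) @[h --> 0^'+] --> G n x s.
Proof.
move=> sT; rewrite /uniformized /generator; apply: cvgD.
  apply: cvg_sum => e; apply: cvgM; first exact: jump_rate_right_continuous.
  by apply: cvgB; exact: picard_right_continuous.
by apply: cvgM; [exact: cvg_cst|exact: picard_right_continuous].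
Qed.

Lemma picard_rderiv n x s : 0 <= s < T -> rderiv (fun s => w n.+1 s x) s (- G n x s).
Proof.
move=> s0T; have /andP[s0 sT] := s0T; have [N N0 HN] := uniformized_path_le n.
rewrite -[- _]add0r; apply: rderivD.
  by rewrite /rderiv; under eq_fun do rewrite subrr mulr0; exact: cvg_cst.
apply: (@rderiv_tail_integral _ _ T s N) => //.
- exact: measurable_uniformized_path (measurable_picard T B n).
- by move=> r /andP[sr rT]; apply: HN; rewrite rT (le_trans s0).
- exact: uniformized_right_continuous.
Qed.

Variable p : R -> R -> lattice d -> probability (Borel (lattice d)) R.
Hypothesis tf : transition_function p.
Hypothesis hg : has_generator p (fun s => generator (omega s)).

Lemma uniformizedB (eta : environment d K) (a b : R) (f g : lattice d -> R) x :
  uniformized eta (fun y => a * f y - b * g y) x =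
  a * uniformized eta f x - b * uniformized eta g x.
Proof.
rewrite /uniformized /generator.
have -> : \sum_e jump_rate eta x e * (a * f (x + unit_vector_val e)
      - b * g (x + unit_vector_val e) - (a * f x - b * g x)) =
    a * \sum_e jump_rate eta x e * (f (x + unit_vector_val e) - f x) -
    b * \sum_e jump_rate eta x e * (g (x + unit_vector_val e) - g x).
  by rewrite !mulr_sumr -sumrB; apply: eq_bigr => e _; ring.
ring.
Qed.

(** The halving argument of [backward_comparison], applied to the error: its derivative in [s] at
    level [n + 1] is minus [uniformized] of the error at level [n]. The sign [sg] yields both
    inequalities from one induction. *)
Lemma picard_error n s x (sg : R) : sg = 1 \/ sg = -1 -> 0 <= s <= T ->
  sg * (expR (c * (T - s)) * mass (p s T x) B - w n s x) <=
  (2 ^+ n)^-1 * expR (2 * c * (T - s)).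
Proof.
move=> sgE; have c0 := max_rate_ge0 d K.
elim: n s x => [|n IH] s x /andP[s0 sT].
  rewrite expr0 invr1 mul1r subr0.
  apply: (@le_trans _ _ (expR (c * (T - s)))).
    have := mass01 (p s T x) B; have := expR_ge0 (c * (T - s)).
    by case: sgE => -> ? /andP[? ?]; nra.
  rewrite ler_expR -mulrA ler_peMl ?ler1n//.
  by rewrite mulr_ge0// subr_ge0.
set q := (2 ^+ n.+1)^-1; have q0 : 0 <= q by rewrite invr_ge0 exprn_ge0.
suff : sg * (expR (c * (T - s)) * mass (p s T x) B - w n.+1 s x)
     - q * expR (2 * c * (T - s)) <=
     sg * (expR (c * (T - T)) * mass (p T T x) B - w n.+1 T x)
     - q * expR (2 * c * (T - T)).
  rewrite subrr !mulr0 expR0 mul1r mulr1 (trans_diag tf) ?(le_trans s0)//=.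
  rewrite set_itv1 Rintegral_set1 addr0 subrr mulr0; lra.
apply: (@rderiv_nondecreasing _ (fun s =>
    sg * (expR (c * (T - s)) * mass (p s T x) B - w n.+1 s x)
     - q * expR (2 * c * (T - s)))) => //.
  have sub (f : R -> R) : {within `[0, T], continuous f} -> {within `[s, T], continuous f}.
    by apply: continuous_subspaceW; apply: subset_itvr; rewrite bnd_simp.
  have cw : {within `[s, T], continuous (fun s => w n.+1 s x)}.
    by apply: sub; exact: picard_continuous.
  have cv : {within `[s, T], continuous (fun s => mass (p s T x) B)}.
    by apply: sub; exact: (backward_continuous tf hg).
  move=> t; apply: cvgB; last first.
    by apply: cvgM; [exact: cvg_cst|exact: rderiv_exp_within].
  apply: cvgM; first exact: cvg_cst.
  apply: cvgB; last exact: cw.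
  apply: cvgM; first exact: rderiv_exp_within.
  exact: cv.
move=> t /andP[st tT]; have t0T : 0 <= t < T by rewrite tT (le_trans s0).
have D := rderivB (@rderivZ R sg _ _ _ (rderivB
   (rderivM (@rderiv_expR R c T t) (@backward_equation _ _ _ _ _ tf hg T x B t t0T))
   (@picard_rderiv n x t t0T)))
  (@rderivZ R q _ _ _ (@rderiv_expR R (2 * c) T t)).
eexists; last exact: D.
set E := expR (c * (T - t)); set E2 := expR (2 * c * (T - t)).
have t0T' : 0 <= t <= T by case/andP: t0T => -> /ltW ->.
have := @uniformized_le _ _ _ (omega t)
  (fun y => (sg * E) * mass (p t T y) B - sg * w n t y) x ((2 ^+ n)^-1 * E2).
have H y : sg * E * mass (p t T y) B - sg * w n t y <= (2 ^+ n)^-1 * E2.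
  by have := IH t y t0T'; rewrite mulrBr mulrA.
move=> /(_ H); rewrite uniformizedB {1}/uniformized.
have -> : q = (2 ^+ n)^-1 / 2 by rewrite /q exprS invfM; ring.
lra.
Qed.

Lemma picard_cvg x : 0 <= T ->
  expR (- (c * T)) * w n 0 x @[n --> \oo] --> mass (p 0 T x) B.
Proof.
move=> T0; have -> : mass (p 0 T x) B =
    expR (- (c * T)) * (expR (c * (T - 0)) * mass (p 0 T x) B).
  by rewrite mulrA -expRD subr0 addNr expR0 mul1r.
apply: cvgM; first exact: cvg_cst.
apply/cvgrPdist_le => e e0; have T00 : 0 <= (0 : R) <= T by rewrite lexx.
pose A := expR (2 * c * (T - 0)); have A0 : 0 < A by exact: expR_gt0.
near=> n.
have nA : A / e <= n%:R by near: n; exact: nbhs_infty_ger.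
have H : (2 ^+ n)^-1 * A <= e.
  rewrite mulrC ler_pdivrMr ?exprn_gt0// -ler_pdivrMl// mulrC.
  by apply: le_trans nA _; rewrite -natrX ler_nat ltnW// ltn_expl.
have h1 := picard_error n x (or_introl erefl) T00.
have h2 := picard_error n x (or_intror erefl) T00.
by rewrite ler_norml -/A in h1 h2 *; apply/andP; split; lra.
Unshelve. all: by end_near. Qed.

End PicardConvergence.

Lemma trans_measurable (R : realType) (d : nat) (K : ellipticity R)
  (p : env_path d K -> R -> R -> lattice d -> probability (Borel (lattice d)) R)
  (T : R) (x : lattice d) (B : set (lattice d)) :
  (forall omega, transition_function (p omega)) ->
  (forall omega, has_generator (p omega) (fun s => generator (omega s))) ->
  0 <= T ->
  measurable_fun setT (fun omega : Borel (env_path d K) => mass (p omega 0 T x) B).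
Proof.
move=> tf hg T0.
apply: (@measurable_fun_cvg _ _ _ _ (fun n (omega : Borel (env_path d K)) =>
    expR (- (max_rate d K * T)) * picard T B n 0 omega x)).
  move=> n; apply: measurable_funM; first exact: measurable_cst.
  have m0 : measurable_fun setT (fun omega : Borel (env_path d K) => (0 : R, omega)).
    by apply: measurable_fun_pair; [exact: measurable_cst|exact: measurable_id].
  exact: (measurableT_comp (measurable_picard T B n x) m0).
by move=> omega _; exact: picard_cvg.
Qed.

(** * Uniqueness, covariance under shifts, and marginals of the walk *)

Section Uniqueness.
Variables (R : realType) (d : nat) (K : ellipticity R).
Implicit Types (omega : env_path d K) (x : lattice d) (s t T : R).

Lemma generatorB (eta : environment d K) (f g : lattice d -> R) x :
  generator eta (fun y => f y - g y) x = generator eta f x - generator eta g x.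
Proof. by rewrite /generator -sumrB; apply: eq_bigr => e _; ring. Qed.

Lemma backward_unique omega (v w : R -> lattice d -> R) T :
  (forall x, {within `[0, T], continuous (v ^~ x)}) ->
  (forall x, {within `[0, T], continuous (w ^~ x)}) ->
  (forall s x, 0 <= s < T -> rderiv (v ^~ x) s (- generator (omega s) (v s) x)) ->
  (forall s x, 0 <= s < T -> rderiv (w ^~ x) s (- generator (omega s) (w s) x)) ->
  (forall s x, 0 <= s <= T -> 0 <= v s x <= 1) ->
  (forall s x, 0 <= s <= T -> 0 <= w s x <= 1) ->
  (forall x, v T x = w T x) ->
  forall s x, 0 <= s <= T -> v s x = w s x.
Proof.
have H (f g : R -> lattice d -> R) :
  (forall x, {within `[0, T], continuous (f ^~ x)}) ->
  (forall x, {within `[0, T], continuous (g ^~ x)}) ->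
  (forall s x, 0 <= s < T -> rderiv (f ^~ x) s (- generator (omega s) (f s) x)) ->
  (forall s x, 0 <= s < T -> rderiv (g ^~ x) s (- generator (omega s) (g s) x)) ->
  (forall s x, 0 <= s <= T -> 0 <= f s x <= 1) ->
  (forall s x, 0 <= s <= T -> 0 <= g s x <= 1) ->
  (forall x, f T x = g T x) ->
  forall s x, 0 <= s <= T -> f s x - g s x <= 0.
  move=> cf cg df dg bf bg fgT s x sT.
  apply: (@backward_comparison _ _ _ omega (fun s x => f s x - g s x) T 1) => //.
  - by move=> y u; apply: cvgB; [exact: cf|exact: cg].
  - move=> u y uT; eexists; last exact: rderivB (df u y uT) (dg u y uT).
    by rewrite generatorB; lra.
  - by move=> u y uT; have := bf u y uT; have := bg u y uT; lra.
  - by move=> y; rewrite fgT subrr.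
move=> cv cw dv dw bv bw vwT s x sT.
have h1 := H v w cv cw dv dw bv bw vwT s x sT.
have h2 := H w v cw cv dw dv bw bv (fun x => esym (vwT x)) s x sT.
by apply/eqP; rewrite eq_le; apply/andP; split; lra.
Qed.

Lemma trans_shift omega (r : R) (z : lattice d)
    (p p' : R -> R -> lattice d -> probability (Borel (lattice d)) R) :
  transition_function p -> has_generator p (fun s => generator (omega s)) ->
  transition_function p' ->
  has_generator p' (fun s => generator (space_time_shift r z omega s)) ->
  0 <= r -> forall (B : set (lattice d)) T s x, 0 <= s -> s <= T ->
  mass (p' s T x) B = mass (p (s + r) (T + r) (x + z)) [set y | B (y - z)].
Proof.
move=> tf hg tf' hg' r0 B T s x s0 sT; set B' := [set y | _].
apply: (@backward_unique (space_time_shift r z omega)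
  (fun s x => mass (p' s T x) B) (fun s x => mass (p (s + r) (T + r) (x + z)) B') T);
  last by rewrite s0.
- by move=> y; exact: (backward_continuous tf' hg').
- move=> y; apply: (within_lipschitz (max_rate_ge0 d K)) => u t u0 ut tT.
  have -> : t - u = (t + r) - (u + r) by ring.
  by apply: (backward_lipschitz tf hg); lra.
- by move=> u y uT; exact: (backward_equation tf' hg').
- move=> u y /andP[u0 uT].
  have urT : 0 <= u + r < T + r by apply/andP; split; lra.
  have := @backward_equation _ _ _ _ _ tf hg (T + r) (y + z) B' (u + r) urT.
  rewrite /rderiv; under eq_fun do rewrite addrAC.
  congr (_ --> _); congr (- _); rewrite /generator; apply: eq_bigr => e _.
  rewrite /jump_rate /space_time_shift /= max_l// /translate.
  by rewrite -[y + z + _]addrA [z + _]addrC addrA.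
- by move=> u y _; exact: mass01.
- by move=> u y _; exact: mass01.
- move=> y; have T0 : 0 <= T by lra.
  rewrite (trans_diag tf')// (trans_diag tf) ?addr_ge0// !indicE /B'.
  congr (_%:R); congr nat_of_bool.
  by apply/idP/idP; rewrite !inE /= addrK.
Qed.

End Uniqueness.

Section Marginal.
Variables (R : realType) (d : nat).

(** The Markov property is applied from time 0 on the whole space; the integrand is almost surely
    constant because [X 0 = x] almost surely. *)
Lemma walk_marginal (P : probability (Borel (walk_path R d)) R)
    (p : R -> R -> lattice d -> probability (Borel (lattice d)) R) (x : lattice d) :
  P [set X : walk_path R d | X 0 = x] = 1%E ->
  markov_law P (fun s t y B => p s t y B) ->
  forall (B : set (lattice d)) (t : R), 0 <= t ->
  P [set X : walk_path R d | B (X t)] = p 0 t x B.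
Proof.
move=> P1 mP B t t0.
have pT : past 0 [set: walk_path R d].
  have [p0 pC _] : sigma_algebra setT (past 0 : set (set (walk_path R d))).
    exact: smallest_sigma_algebra.
  by rewrite -[setT]setD0; exact: pC.
have := mP 0 t (lexx _) t0 setT B pT (lattice_measurable _).
rewrite setTI => ->.
have mA : measurable ([set X | X 0 = x] : set (Borel (walk_path R d))).
  exact: (@measurable_walk_coord R d 0 [set x]).
rewrite (@ae_eq_integral _ _ _ P setT (cst (p 0 t x B)))//.
- by rewrite integral_cst// [X in (_ * X)%E]probability_setT mule1.
- move=> _ /= Y mY; rewrite setTI.
  exact: (@measurable_walk_coord R d 0 ((fun y => p 0 t y B) @^-1` Y)).
- exists (~` [set X : Borel (walk_path R d) | X 0 = x]); split.
  + exact: measurableC.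
  + have := probability_setC P mA; rewrite [X in (1 - X)%E]P1 subee//; exact.
  + by move=> X /= H /= X0; apply: H => _; rewrite X0.
Qed.

End Marginal.

(** * The subadditive ergodic theorem *)

Section BoundedExpectation.
Variables (R : realType) (dd : measure_display) (W : measurableType dd).
Variable M : probability W R.
Implicit Types (f g : W -> R) (A : set W).

Lemma bounded_mean_integrable f (k : R) : measurable_fun setT f ->
  (forall w, `|f w| <= k) -> M.-integrable setT (EFin \o f).
Proof.
move=> mf fk; apply: measurable_bounded_integrable => //.
  by rewrite (le_lt_trans (probability_le1 M measurableT))// ltry.
by exists k; split; [exact: num_real|move=> N kN w _; exact: le_trans (fk w) (ltW kN)].
Qed.

Lemma mean_indic A : measurable A -> \int[M]_w \1_A w = fine (M A).
Proof. by move=> mA; rewrite /Rintegral integral_indic// setIT. Qed.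

Lemma mean_cst (k : R) : \int[M]_w k = k.
Proof.
rewrite Rintegral_cst//; have -> : fine (M setT) = 1 by rewrite probability_setT.
by rewrite mulr1.
Qed.

Lemma mean_preserving f (T : W -> W) : measurable_fun setT T ->
  (forall A, measurable A -> M (T @^-1` A) = M A) ->
  measurable_fun setT f -> (forall w, 0 <= f w) ->
  \int[M]_w f (T w) = \int[M]_w f w.
Proof.
move=> mT MT mf f0; rewrite /Rintegral; congr fine.
have mf' : measurable_fun setT (EFin \o f) by exact/measurable_EFinP.
rewrite -(@ge0_integral_pushforward _ _ _ _ R T mT M setT (EFin \o f))//; last first.
  by move=> w _; rewrite lee_fin.
by apply: eq_measure_integral => A mA _; exact: MT.
Qed.

End BoundedExpectation.

Section Kingman.
Variables (R : realType) (dd : measure_display) (W : measurableType dd).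
Variable M : probability W R.
Implicit Types (f g : W -> R) (A B : set W) (T : W -> W).
Local Notation EE f := (\int[M]_w f w).

Lemma iter_preserving T : measurable_fun setT T ->
  (forall A, measurable A -> M (T @^-1` A) = M A) ->
  forall n, measurable_fun setT (iter n T) /\
    forall A, measurable A -> M (iter n T @^-1` A) = M A.
Proof.
move=> mT MT; elim=> [|n [mn Mn]]; first by split => //; exact: measurable_id.
split; first exact: measurableT_comp.
move=> A mA.
rewrite (_ : iter n.+1 T @^-1` A = iter n T @^-1` (T @^-1` A))// Mn ?MT//.
by rewrite -[_ @^-1` _]setTI; exact: mT.
Qed.

(* The Katznelson-Weiss stopping argument: from a point outside the exceptional
   set, [F] is at most [n b] over some block of length [n <= N]; a point of the
   exceptional set is passed by a block of length 1. *)
Lemma good_blocks (F : nat -> W -> R) (C b : R) T :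
  measurable_fun setT T -> (forall A, measurable A -> M (T @^-1` A) = M A) ->
  (forall n, measurable_fun setT (F n)) -> 0 <= C ->
  (forall n w, `|F n w| <= C * n%:R) ->
  (forall m n w, F (m + n)%N w <= F m w + F n (iter m T w)) ->
  {ae M, forall w, exists2 n, (0 < n)%N & F n w <= b * n%:R} ->
  forall e : R, 0 < e -> exists2 L, (0 < L)%N & EE (F L) <= (b + e) * L%:R.
Proof.
move=> mT MT mF C0 FC Fsub good e e0.
have iT := iter_preserving mT MT.
pose Bad N := \bigcap_(n in [set n | (0 < n <= N)%N]) [set w | b * n%:R < F n w].
have mS n : measurable [set w | b * n%:R < F n w].
  have := mF n measurableT _ (measurable_itv `]b * n%:R, +oo[).
  rewrite setTI; congr measurable; apply/seteqP; split => w /=;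
    by rewrite in_itv/= andbT.
have mBad N : measurable (Bad N) by apply: bigcap_measurableType => n _; exact: mS.
have cBad : M (Bad N) @[N --> \oo] --> M (\bigcap_N Bad N).
  apply: nonincreasing_cvg_mu => //.
  - by rewrite (le_lt_trans (probability_le1 M (mBad 0%N)))// ltry.
  - exact: bigcapT_measurable.
  - move=> m n mn; apply/subsetPset => w H k /= /andP[k0 km].
    by apply: H; rewrite /= k0 (leq_trans km).
have Bad0 : M (\bigcap_N Bad N) = 0%E.
  apply: measure_negligible; first exact: bigcapT_measurable.
  apply: negligibleS good => w /= H [n n0]; apply/negP; rewrite -ltNge.
  by apply: (H n I); rewrite /= n0 leqnn.
(* [D] is the surcharge for a bad point: a block of length 1 costs at most [C <= b + D], also when
   [b] is negative. *)
pose D := C + `|b|; have D0 : 0 <= D by rewrite addr_ge0.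
have Db : C <= b + D by rewrite /D; have := ler_norm (- b); rewrite normrN; lra.
pose m N := fine (M (Bad N)).
have mE N : (m N)%:E = M (Bad N) by rewrite /m fineK// fin_num_measure.
have [N mN] : exists N, D * m N <= e / 2.
  have de : 0 < e / 2 / (D + 1) by rewrite !divr_gt0// ltr_wpDl.
  have /fine_cvgP [_ /cvgrPdist_le /(_ _ de)] :
      M (Bad N) @[N --> \oo] --> (0%R)%:E.
    by move: cBad; rewrite Bad0.
  move=> -[N _ /(_ N (leqnn N))] /=; rewrite sub0r normrN -/(m N) => H.
  exists N; have m0 : 0 <= m N by rewrite /m fine_ge0.
  move: H; rewrite ger0_norm// ler_pdivlMr ?ltr_wpDl//; lra.
pose S L w : R := \sum_(j < L) \1_(Bad N) (iter j T w).
have S0 L w : 0 <= S L w by apply: sumr_ge0 => j _; rewrite indicE.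
have SD i L w : S (i + L)%N w = S i w + S L (iter i T w).
  rewrite /S big_split_ord /=; congr (_ + _); apply: eq_bigr => j _.
  by rewrite -iterD addnC.
(* [S L w] counts the bad points among the first [L]. The term [D * N%:R] pays for a last good block
   that would overrun the end: fewer than [N] points remain at that moment. *)
have key L : forall w, F L w <= b * L%:R + D * S L w + D * N%:R.
  elim/ltn_ind: L => L IH w.
  have [->|L0] := posnP L.
    rewrite mulr0 add0r; apply: (@le_trans _ _ 0); last by rewrite addr_ge0// mulr_ge0.
    by have := FC 0%N w; rewrite mulr0 => /(le_trans (ler_norm _)).
  have [Bw|Bw] := pselect (Bad N w).
    have L1 : (1 + L.-1)%N = L by rewrite add1n prednK.
    have := Fsub 1%N L.-1 w; rewrite L1.
    have := IH L.-1; rewrite prednK// => /(_ (leqnn _) (T w)) /=.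
    have : F 1%N w <= C by have := FC 1%N w; rewrite mulr1 => /(le_trans (ler_norm _)).
    have -> : S L w = 1 + S L.-1 (T w).
      rewrite -[in LHS]L1 SD /=; congr (_ + _).
      by rewrite /S big_ord1 /= indicE mem_set.
    have -> : L%:R = 1 + L.-1%:R :> R by rewrite -[in LHS]L1 natrD.
    lra.
  have [n [n0 nN Fn]] : exists n, [/\ (0 < n)%N, (n <= N)%N & F n w <= b * n%:R].
    apply: contrapT => H; apply: Bw => n /= /andP[n0 nN].
    by rewrite ltNge; apply/negP => Fn; apply: H; exists n.
  have [nL|Ln] := leqP n L.
    have L1 : (n + (L - n))%N = L by rewrite subnKC.
    have := Fsub n (L - n)%N w; rewrite L1.
    have Ln : (L - n < L)%N by rewrite ltn_subrL n0 L0.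
    have := IH _ Ln (iter n T w).
    have -> : S L w = S n w + S (L - n)%N (iter n T w) by rewrite -SD L1.
    have -> : L%:R = n%:R + (L - n)%:R :> R by rewrite -natrD L1.
    have := mulr_ge0 D0 (S0 n w); lra.
  have LN : L%:R <= N%:R :> R by rewrite ler_nat (leq_trans (ltnW Ln)).
  have L0' : 0 <= L%:R :> R by [].
  have := FC L w => /(le_trans (ler_norm _)) FL.
  have h1 : C * L%:R <= (b + D) * L%:R by rewrite ler_wpM2r.
  have h2 : D * L%:R <= D * N%:R by rewrite ler_wpM2l.
  have := mulr_ge0 D0 (S0 L w); lra.
have mind j : measurable_fun setT (fun w => \1_(Bad N) (iter j T w) : R).
  by apply: measurableT_comp; [exact: measurable_indic|exact: (iT j).1].
have bind j w : `|\1_(Bad N) (iter j T w) : R| <= 1.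
  by rewrite indicE; case: (_ \in _); rewrite ?normr1 ?normr0.
have mSL L : measurable_fun setT (S L) by apply: measurable_sum => j; exact: mind.
have bS L w : `|S L w| <= L%:R.
  rewrite ger0_norm// /S -[leRHS]mulr1 mulr_natl -[X in _ *+ X]card_ord -sumr_const.
  by apply: ler_sum => j _; exact: le_trans (ler_norm _) (bind j w).
have ES L : EE (S L) = m N * L%:R.
  elim: L => [|L IH].
    rewrite mulr0 (_ : S 0%N = cst 0) ?mean_cst//.
    by apply/funext => w; rewrite /S big_ord0.
  rewrite (_ : S L.+1 = (fun w => S L w + \1_(Bad N) (iter L T w))); last first.
    by apply/funext => w; rewrite /S big_ord_recr.
  rewrite RintegralD//; [|exact: bounded_mean_integrable (bS L)|
    exact: bounded_mean_integrable (bind L)].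
  rewrite IH -natr1 mulrDr mulr1; congr (_ + _).
  rewrite (@mean_preserving _ _ _ M (\1_(Bad N)) (iter L T)).
  - exact: mean_indic.
  - exact: (iT L).1.
  - exact: (iT L).2.
  - exact: measurable_indic.
  - by move=> w; rewrite indicE.
(* This length makes the surcharge for the last block at most [e / 2] per step; the other [e / 2] is
   the mean surcharge for bad points. *)
pose L := (Num.truncn (2 * D * N%:R / e)).+1.
exists L => //.
have LL : D * N%:R <= e / 2 * L%:R.
  have : 2 * D * N%:R / e < L%:R by exact: truncnS_gt.
  by rewrite ltr_pdivrMr//; lra.
have iS : M.-integrable setT (EFin \o S L) by exact: bounded_mean_integrable (bS L).
have bG w : `|b * L%:R + D * S L w + D * N%:R| <= `|b * L%:R| + D * L%:R + D * N%:R.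
  rewrite (le_trans (ler_normD _ _))// lerD//; last by rewrite ger0_norm// mulr_ge0.
  rewrite (le_trans (ler_normD _ _))// lerD// normrM ger0_norm// ler_wpM2l//.
have mG : measurable_fun setT (fun w => b * L%:R + D * S L w + D * N%:R).
  apply: measurable_funD => //; apply: measurable_funD => //.
  exact: measurable_funM.
have EG : EE (fun w => b * L%:R + D * S L w + D * N%:R) =
    b * L%:R + D * (m N * L%:R) + D * N%:R.
  have ic (k : R) : M.-integrable setT (EFin \o cst k).
    by apply: (@bounded_mean_integrable _ _ _ _ _ `|k|) => //.
  have iDS : M.-integrable setT (EFin \o (fun w => D * S L w)).
    apply: (@bounded_mean_integrable _ _ _ _ _ (D * L%:R)); first exact: measurable_funM.
    by move=> w; rewrite normrM ger0_norm// ler_wpM2l.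
  have ibDS : M.-integrable setT (EFin \o (fun w => b * L%:R + D * S L w)).
    apply: (@bounded_mean_integrable _ _ _ _ _ (`|b * L%:R| + D * L%:R)).
      by apply: measurable_funD => //; exact: measurable_funM.
    move=> w; rewrite (le_trans (ler_normD _ _))// lerD// normrM ger0_norm// ler_wpM2l//.
  rewrite RintegralD//; last exact: ic.
  rewrite RintegralD//; last exact: ic.
  by rewrite !mean_cst (RintegralZl D measurableT iS) ES.
apply: (@le_trans _ _ (b * L%:R + D * (m N * L%:R) + D * N%:R)); last first.
  have : D * m N * L%:R <= e / 2 * L%:R by rewrite ler_wpM2r.
  lra.
rewrite -EG; apply: le_Rintegral => //.
- exact: bounded_mean_integrable (FC L).
- exact: bounded_mean_integrable bG.
Qed.

(** The event [limsup A n / n > c]. The strict margin [1 / (j + 1)] makes it a countable combination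
    of events, and the product form avoids a division at [n = 0]. The same applies to the lower
    limit below. *)
Definition limsup_gt (A : nat -> W -> R) (c : R) : set W :=
  \bigcup_j \bigcap_N \bigcup_(n in [set n | (N <= n)%N])
    [set w | (c + j.+1%:R^-1) * n%:R < A n w].

Definition liminf_gt (A : nat -> W -> R) (c : R) : set W :=
  \bigcup_j \bigcup_N \bigcap_(n in [set n | (N <= n)%N])
    [set w | (c + j.+1%:R^-1) * n%:R < A n w].

Lemma measurable_gt (f : W -> R) (k : R) : measurable_fun setT f ->
  measurable [set w | k < f w].
Proof.
move=> mf; have := mf measurableT _ (measurable_itv `]k, +oo[).
by rewrite setTI; congr measurable; apply/seteqP; split => w /=;
  rewrite in_itv/= andbT.
Qed.

Lemma measurable_limsup_gt (A : nat -> W -> R) (c : R) :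
  (forall n, measurable_fun setT (A n)) -> measurable (limsup_gt A c).
Proof.
move=> mA; apply: bigcupT_measurable => j; apply: bigcapT_measurable => N.
by apply: bigcup_measurable => n _; exact: measurable_gt.
Qed.

Lemma measurable_liminf_gt (A : nat -> W -> R) (c : R) :
  (forall n, measurable_fun setT (A n)) -> measurable (liminf_gt A c).
Proof.
move=> mA; apply: bigcupT_measurable => j; apply: bigcupT_measurable => N.
by apply: bigcap_measurableType => n _; exact: measurable_gt.
Qed.

(** Half of the margin absorbs a bounded perturbation and a shift of the index: [1 / (2 j + 2)] is
    half of [1 / (j + 1)]. This is why [limsup_gt] and [liminf_gt] are insensitive to both. *)
Lemma gt_linear_shift (c C : R) (j k : nat) : exists N, forall n, (N <= n)%N ->
  (c + j.*2.+2%:R^-1) * n%:R <= (c + j.+1%:R^-1) * (n + k)%:R - C.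
Proof.
pose a : R := j.+1%:R^-1; have a0 : 0 < a by rewrite invr_gt0 ltr0n.
have -> : j.*2.+2%:R^-1 = a / 2 :> R by rewrite -doubleS -muln2 natrM invfM.
pose B := C - (c + a) * k%:R.
exists (Num.truncn (2 * B / a)).+1 => n Nn.
have : 2 * B / a < n%:R.
  by apply: lt_le_trans (truncnS_gt _) _; rewrite ler_nat.
rewrite ltr_pdivrMr// natrD /B -/a; lra.
Qed.

Lemma limsup_gt_shift (A : nat -> W -> R) (c C : R) k (w w' : W) :
  (forall n, A (n + k)%N w <= C + A n w') -> limsup_gt A c w -> limsup_gt A c w'.
Proof.
move=> Aww [j _ H]; exists j.*2.+1 => // N _.
have [N0 HN0] := gt_linear_shift c C j k.
have [n /= Nn An] := H (maxn N N0 + k)%N I.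
have kn : (k <= n)%N by rewrite (leq_trans _ Nn)// leq_addl.
exists (n - k)%N => /=.
  by rewrite leq_subRL// addnC (leq_trans _ Nn)// leq_add2r leq_maxl.
have N0n : (N0 <= n - k)%N.
  by rewrite leq_subRL// addnC (leq_trans _ Nn)// leq_add2r leq_maxr.
apply: le_lt_trans (HN0 _ N0n) _; rewrite ltrBlDl subnK//.
by apply: lt_le_trans An _; have := Aww (n - k)%N; rewrite subnK.
Qed.

Lemma liminf_gt_shift (A : nat -> W -> R) (c C : R) k (w w' : W) :
  (forall n, A (n + k)%N w <= C + A n w') -> liminf_gt A c w -> liminf_gt A c w'.
Proof.
move=> Aww [j _ [N1 _ H]]; exists j.*2.+1 => //.
have [N0 HN0] := gt_linear_shift c C j k.
exists (maxn N0 N1) => // n /=; rewrite geq_max => /andP[N0n N1n].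
have := H (n + k)%N (leq_trans N1n (leq_addr _ _)) => /= An.
apply: le_lt_trans (HN0 _ N0n) _; rewrite ltrBlDl.
exact: lt_le_trans An (Aww n).
Qed.

(* [T] itself need not be ergodic: only the events stable under the whole family
   [tau] are assumed trivial, and [A] is almost invariant under [tau]. *)
Theorem kingman (J : Type) (tau : J -> W -> W) (A : nat -> W -> R) (C g : R) T :
  (forall B, measurable B -> (forall j w, B w -> B (tau j w)) ->
     M B = 0%E \/ M B = 1%E) ->
  (forall j, exists k C', forall n w, A (n + k)%N w <= C' + A n (tau j w)) ->
  measurable_fun setT T -> (forall B, measurable B -> M (T @^-1` B) = M B) ->
  (forall n, measurable_fun setT (A n)) ->
  (forall n w, 0 <= A n w <= C * n%:R) ->
  (forall m n w, A (m + n)%N w <= A m w + A n (iter m T w)) ->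
  (forall n, (0 < n)%N -> g * n%:R <= EE (A n)) ->
  (forall e, 0 < e -> exists2 n, (0 < n)%N & EE (A n) <= (g + e) * n%:R) ->
  {ae M, forall w, forall e : R, 0 < e -> exists N, forall n, (N <= n)%N ->
     (g - e) * n%:R <= A n w <= (g + e) * n%:R}.
Proof.
move=> zero_one tauA mT MT mA AC Asub gle geps.
have C0 : 0 <= C by have := AC 1%N point; rewrite mulr1 => /andP[/le_trans]; apply.
have A0 n w : 0 <= A n w by case/andP: (AC n w).
have nA n w : `|A n w| <= C * n%:R by rewrite ger0_norm//; case/andP: (AC n w).
have g0 : 0 <= g.
  apply/ler_addgt0Pl => e e0; have [n n0 H] := geps e e0.
  have : 0 <= (g + e) * n%:R by apply: le_trans H; exact: Rintegral_ge0.
  by rewrite pmulr_lge0 ?ltr0n// addrC.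
(* If this event were null, almost every point would start a block of cost at most [g - e + e / 4]
   per step, and [good_blocks] would produce a mean below [g]. *)
have lower (e : R) : 0 < e -> M (liminf_gt A (g - e)) = 1%E.
  move=> e0; have mV := measurable_liminf_gt (g - e) mA.
  have [||//] := zero_one _ mV.
    move=> j w; have [k [C' H]] := tauA j.
    exact: liminf_gt_shift (H ^~ w).
  move=> V0; exfalso.
  pose j := Num.truncn (4 / e).
  have je : j.+1%:R^-1 < e / 4.
    rewrite -[ltRHS]invrK ltf_pV2 ?posrE ?invr_gt0 ?divr_gt0//.
    by rewrite invf_div; exact: truncnS_gt.
  have good : {ae M, forall w, exists2 n, (0 < n)%N & A n w <= (g - e + j.+1%:R^-1) * n%:R}.
    exists (liminf_gt A (g - e)); split => // w /= H.
    exists j => //; exists 1%N => // n /= n1; rewrite ltNge; apply/negP => An.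
    by apply: H; exists n.
  have e4 : 0 < e / 4 by rewrite divr_gt0.
  have [L L0] := good_blocks mT MT mA C0 nA Asub good e4.
  have L0' : 0 < L%:R :> R by rewrite ltr0n.
  have := gle L L0; move=> h1 h2.
  have : g * L%:R <= (g - e + j.+1%:R^-1 + e / 4) * L%:R by apply: le_trans h2.
  rewrite ler_pM2r//; move: je; move: (j.+1%:R^-1) => a; lra.
have upper (e : R) : 0 < e -> M (limsup_gt A (g + e)) = 0%E.
  move=> e0; have mU := measurable_limsup_gt (g + e) mA.
  have [|//|U1] := zero_one _ mU.
    move=> j w; have [k [C' H]] := tauA j.
    exact: limsup_gt_shift (H ^~ w).
  exfalso; have e2 : 0 < e / 2 by rewrite divr_gt0.
  have [m m0 Em] := geps _ e2.
  have m0' : 0 < m%:R :> R by rewrite ltr0n.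
  have iT := iter_preserving mT MT.
  (* Along multiples of [m], [A] is dominated by the Birkhoff sums of [A m] under the [m]-th iterate
     of [T]. As these are additive, their negative [F] also satisfies the hypotheses of
     [good_blocks]; if the event had probability 1, this would force the mean of [A m] above
     [(g + e / 2) m]. *)
  pose F k w : R := - \sum_(i < k) A m (iter i (iter m T) w).
  have FS i k w : F (i + k)%N w = F i w + F k (iter i (iter m T) w).
    rewrite /F big_split_ord /= opprD; congr (_ + - _); apply: eq_bigr => l _.
    by rewrite -iterD addnC.
  have iS := iter_preserving (iT m).1 (iT m).2.
  have mAi i : measurable_fun setT (fun w => A m (iter i (iter m T) w)).
    by apply: measurableT_comp; [exact: mA|exact: (iS i).1].
  have mF k : measurable_fun setT (F k).
    by apply: measurableT_comp => //; apply: measurable_sum => i; exact: mAi.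
  have FC k w : `|F k w| <= C * m%:R * k%:R.
    rewrite /F normrN ger0_norm ?sumr_ge0// mulr_natr -[X in _ *+ X]card_ord -sumr_const.
    by apply: ler_sum => i _; case/andP: (AC m (iter i (iter m T) w)).
  have AF k w : A (k * m)%N w <= - F k w.
    elim: k w => [|k IH] w.
      by rewrite mul0n /F big_ord0 oppr0 oppr0; have := AC 0%N w; rewrite mulr0 => /andP[].
    have F1 : F 1%N w = - A m w by rewrite /F big_ord1.
    rewrite mulSn -[k.+1]add1n FS opprD F1 opprK.
    by apply: le_trans (Asub m _ w) _; rewrite lerD2l.
  have good : {ae M, forall w, exists2 k, (0 < k)%N & F k w <= - ((g + e) * m%:R) * k%:R}.
    exists (~` limsup_gt A (g + e)); split.
    - exact: measurableC.
    - by have := probability_setC M mU; rewrite U1 subee//; exact.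
    - move=> w /= H [j _ Hj]; apply: H.
      (* [n >= m] gives at least one full block; [n > C m (j + 1)] makes the incomplete last block,
         of cost at most [C m], smaller than the margin [n / (j + 1)]. *)
      pose N := maxn m (Num.truncn (C * m%:R * j.+1%:R)).+1.
      have [n /= Nn An] := Hj N I.
      have mn : (m <= n)%N by rewrite (leq_trans _ Nn)// leq_maxl.
      have Cn : C * m%:R * j.+1%:R < n%:R.
        apply: lt_le_trans (truncnS_gt _) _; rewrite ler_nat (leq_trans _ Nn)//.
        exact: leq_maxr.
      exists (n %/ m)%N; first by rewrite divn_gt0.
      have := AF (n %/ m)%N w; have := Asub (n %/ m * m)%N (n %% m)%N w.
      rewrite -divn_eq.
      have : A (n %% m)%N (iter (n %/ m * m) T w) <= C * m%:R.
        have /andP[_ h] := AC (n %% m)%N (iter (n %/ m * m) T w).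
        by rewrite (le_trans h)// ler_wpM2l// ler_nat ltnW// ltn_mod.
      have jn : C * m%:R < j.+1%:R^-1 * n%:R by rewrite ltr_pdivlMl// mulrC.
      have : (g + e) * ((n %/ m)%:R * m%:R) <= (g + e) * n%:R.
        apply: ler_wpM2l; first by rewrite addr_ge0// ltW.
        by rewrite -natrM ler_nat leq_trunc_div.
      move: An; rewrite mulrDl.
      set a := _ * n%:R; set q := _ * n%:R in jn *; set b := A (n %% m)%N _.
      rewrite mulNr mulrAC -mulrA; lra.
  have em : 0 < e * m%:R / 4 by rewrite !divr_gt0// mulr_gt0.
  have Fsub i k w : F (i + k)%N w <= F i w + F k (iter i (iter m T) w) by rewrite FS.
  have [L L0 EL] := good_blocks (iT m).1 (iT m).2 mF
    (mulr_ge0 C0 (ltW m0')) FC Fsub good em.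
  have L0' : 0 < L%:R :> R by rewrite ltr0n.
  have EF k : EE (F k) = - EE (A m) * k%:R.
    elim: k => [|k IH].
      rewrite mulr0 (_ : F 0%N = cst 0) ?mean_cst//.
      by apply/funext => w; rewrite /F big_ord0 oppr0.
    rewrite (_ : F k.+1 = (fun w => F k w - A m (iter k (iter m T) w))); last first.
      by apply/funext => w; rewrite /F big_ord_recr opprD.
    rewrite RintegralB//.
    - rewrite IH -natr1 mulrDr mulr1; congr (_ + _).
      by rewrite (mean_preserving (iS k).1 (iS k).2 (mA m) (A0 m)).
    - exact: bounded_mean_integrable (FC k).
    - by apply: (@bounded_mean_integrable _ _ _ _ _ (C * m%:R)) => // w; exact: nA.
  move: EL; rewrite EF ler_pM2r//.
  have := Em; nra.
have : M.-negligible (\bigcup_i (~` liminf_gt A (g - i.+1%:R^-1) `|` limsup_gt A (g + i.+1%:R^-1))).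
  apply: negligible_bigcup => i.
  have i0 : 0 < i.+1%:R^-1 :> R by rewrite invr_gt0 ltr0n.
  apply: negligibleU.
    exists (~` liminf_gt A (g - i.+1%:R^-1)); split => //.
      by apply: measurableC; exact: measurable_liminf_gt.
    have := probability_setC M (measurable_liminf_gt (g - i.+1%:R^-1) mA).
    by rewrite lower// subee//; exact.
  exists (limsup_gt A (g + i.+1%:R^-1)); split => //; last exact: upper.
  exact: measurable_limsup_gt.
apply: negligibleS => w /= H; apply: contrapT => Hn; apply: H => e e0.
pose i := Num.truncn (2 / e).
have ie : i.+1%:R^-1 < e / 2.
  rewrite -[ltRHS]invrK ltf_pV2 ?posrE ?invr_gt0 ?divr_gt0//.
  by rewrite invf_div; exact: truncnS_gt.
have [j _ [N1 _ H1]] : liminf_gt A (g - i.+1%:R^-1) w.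
  by apply: contrapT => h; apply: Hn; exists i => //; left.
have H2 : exists N, forall n, (N <= n)%N -> A n w <= (g + i.+1%:R^-1 + i.+1%:R^-1) * n%:R.
  apply: contrapT => h; apply: Hn; exists i => //; right.
  exists i => // N _; apply: contrapT => h'; apply: h; exists N => n Nn.
  by rewrite leNgt; apply/negP => An; apply: h'; exists n.
have [N2 {}H2] := H2.
exists (maxn N1 N2) => n; rewrite geq_max => /andP[N1n N2n].
have := H1 n N1n; have := H2 n N2n => /=.
have n0 : 0 <= n%:R :> R by [].
have j0 : 0 < j.+1%:R^-1 :> R by rewrite invr_gt0 ltr0n.
move: j0 ie; move: (j.+1%:R^-1) (i.+1%:R^-1) => a b a0 be h2 h1.
by apply/andP; split; nra.
Qed.

End Kingman.

(** * Point-to-point costs *)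

Section MixtureMeasure.
Variables (R : realType) (d : nat) (K : ellipticity R).
Variable Q : R.-pker Borel (environment d K) ~> Borel (env_path d K).
Variable mu : probability (Borel (environment d K)) R.

Let mix0 : env_mixture Q mu set0 = 0%E.
Proof.
by rewrite /env_mixture (eq_integral (cst 0%E)) ?integral0// => y _; rewrite measure0.
Qed.

Let mix_ge0 A : (0 <= env_mixture Q mu A)%E.
Proof. exact: integral_ge0. Qed.

Let mix_sigma_additive : semi_sigma_additive (env_mixture Q mu).
Proof.
move=> U mU tU mUU; rewrite [X in _ --> X](_ : _ =
  (\int[mu]_y (\sum_(n <oo) Q y (U n)))%E); last first.
  apply: eq_integral => V _.
  by apply/esym/cvg_lim => //; exact/measure_semi_sigma_additive.
apply/cvg_closeP; split.
  by apply: is_cvg_nneseries => n _ _; exact: integral_ge0.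
rewrite closeE// integral_nneseries// => n.
exact: measurable_kernel Q _ (mU n).
Qed.

HB.instance Definition _ := isMeasure.Build _ _ R (env_mixture Q mu)
  mix0 mix_ge0 mix_sigma_additive.

Let mixT : env_mixture Q mu setT = 1%E.
Proof.
rewrite /env_mixture (eq_integral (cst 1%E)); last by move=> y _; rewrite prob_kernel.
rewrite integral_cst// mul1e; exact: probability_setT.
Qed.

HB.instance Definition _ := Measure_isProbability.Build _ _ R (env_mixture Q mu) mixT.

Definition env_law : probability (Borel (env_path d K)) R := env_mixture Q mu.

End MixtureMeasure.

(** * Space-time shifts and the zero-one law *)

Section Shifts.
Variables (R : realType) (d : nat) (K : ellipticity R).
Implicit Types (omega : env_path d K) (s t : R) (y z : lattice d).

Lemma space_time_shiftD s t y z omega : 0 <= s -> 0 <= t ->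
  space_time_shift s y (space_time_shift t z omega) =
  space_time_shift (s + t) (y + z) omega.
Proof.
move=> s0 t0; apply: cadlag_pathP => u u0; apply/funext => x.
rewrite /space_time_shift /= /translate (max_l u0) max_l ?addr_ge0//.
by rewrite !addrA.
Qed.

Lemma space_time_shift0 omega : space_time_shift 0 0 omega = omega.
Proof.
apply: cadlag_pathP => u u0; apply/funext => x.
by rewrite /space_time_shift /= /translate (max_l u0) !addr0.
Qed.

Lemma iter_space_time_shift n t z omega : 0 <= t ->
  iter n (space_time_shift t z) omega = space_time_shift (n%:R * t) (z *+ n) omega.
Proof.
move=> t0; elim: n => [|n IH]; first by rewrite mul0r mulr0n space_time_shift0.
rewrite iterS IH space_time_shiftD ?mulr_ge0//.
by rewrite -natr1 mulrDl mul1r addrC mulrS.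
Qed.

Variable M : probability (Borel (env_path d K)) R.
Hypothesis erg : ergodic_environment M.

Lemma shift_measurable s z : 0 < s ->
  measurable_fun setT (space_time_shift s z : Borel (env_path d K) -> Borel (env_path d K)).
Proof. by move=> s0 _ A mA; rewrite setTI; exact: (erg.1 s z A s0 mA).1. Qed.

Lemma shift_preserving s z (A : set (Borel (env_path d K))) : 0 < s -> measurable A ->
  M (space_time_shift s z @^-1` A) = M A.
Proof. by move=> s0 mA; exact: (erg.1 s z A s0 mA).2. Qed.

(* A shift-stable set [B] and the invariant set of the paths whose orbit enters
   [B] have the same probability. *)
Lemma shift_stable_zero_one (B : set (Borel (env_path d K))) : measurable B ->
  (forall (j : {s : R | 1 <= s} * lattice d) omega, B omega ->
     B (space_time_shift (sval j.1) j.2 omega)) ->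
  M B = 0%E \/ M B = 1%E.
Proof.
move=> mB stB.
have st s z omega : 1 <= s -> B omega -> B (space_time_shift s z omega).
  by move=> s1 Bw; exact: (stB (exist _ s s1, z)).
pose F n : set (Borel (env_path d K)) := space_time_shift n.+1%:R 0 @^-1` B.
have mF n : measurable (F n) by exact: (erg.1 n.+1%:R 0 B (ltr0Sn _ _) mB).1.
have MF n : M (F n) = M B by exact: shift_preserving.
have ndF : nondecreasing_seq F.
  apply/nondecreasing_seqP => n; apply/subsetPset => w /= Bw.
  have := st 1 0 _ (lexx _) Bw; rewrite space_time_shiftD//.
  by rewrite addr0 [1 + _]addrC natr1.
have mUF : measurable (\bigcup_n F n) by exact: bigcupT_measurable.
have MUF : M (\bigcup_n F n) = M B.
  have := nondecreasing_cvg_mu (mu := M) mF mUF ndF.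
  have -> : (M \o F) = cst (M B) by apply/funext => n; exact: MF.
  by move=> /cvg_lim <- //; rewrite lim_cst.
rewrite -MUF; apply: erg.2 => // s z s0.
apply/seteqP; split=> w [n _] /=; rewrite /F /= ?space_time_shiftD ?(ltW s0)// => Bw.
  (* Stability of [B] covers only shifts of duration at least 1, so the orbit is followed up to an
     integer time [m + 2] at least 1 after [n + 1 + s]; the translation by [- z] undoes the one by
     [z]. *)
  pose m := (n + (Num.truncn s).+1)%N.
  have ms : 1 <= m.+2%:R - (n.+1%:R + s).
    have : s < (Num.truncn s).+1%:R by exact: truncnS_gt.
    by rewrite -!natr1 /m natrD -!natr1; lra.
  exists m.+1 => //; have := st _ (0 - (0 + z)) _ ms Bw.
  have ns0 : 0 <= n.+1%:R + s by rewrite addr_ge0// ltW.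
  rewrite space_time_shiftD ?(le_trans ler01 ms)//.
  by rewrite !subrK.
exists n.+1 => //; rewrite /F /= space_time_shiftD ?ltW//.
have s1 : 1 <= 1 + s by lra.
have := st (1 + s) z _ s1 Bw; rewrite space_time_shiftD//; last by lra.
rewrite addr0 add0r; congr (B (space_time_shift _ _ _)).
by rewrite -[n.+2%:R]natr1; lra.
Qed.

End Shifts.

Section Costs.
Variables (R : realType) (d : nat) (K : ellipticity R).
Variable p : env_path d K -> R -> R -> lattice d -> probability (Borel (lattice d)) R.
Hypothesis tf : forall omega, transition_function (p omega).
Hypothesis hg : forall omega, has_generator (p omega) (fun s => generator (omega s)).
Implicit Types (omega : env_path d K) (s t : R) (x y z : lattice d).

Lemma point_mass_gt0 omega s t x y : 0 <= s -> 1 <= t - s ->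
  0 < mass (p omega s t x) [set y].
Proof.
move=> s0 st; have [C C0 HC] := elliptic_lower_bound d K (norm1 (y - x))%:~R.
apply: lt_le_trans (HC omega _ (tf omega) (hg omega) s t x y s0 st _); first exact: expR_gt0.
by rewrite ler_peMr// ler0z norm1_ge0.
Qed.

(** As [ln 0 = 0], a vanishing probability would get cost 0. Upper bounds and comparisons are
    therefore stated for durations at least 1, where ellipticity makes the probability positive. *)
Definition cost omega s t x y : R := - ln (mass (p omega s t x) [set y]).

Lemma massE_cost omega s t x y : 0 <= s -> 1 <= t - s ->
  mass (p omega s t x) [set y] = expR (- cost omega s t x y).
Proof. by move=> s0 st; rewrite /cost opprK lnK// posrE point_mass_gt0. Qed.

Lemma cost_diag omega s x : 0 <= s -> cost omega s s x x = 0.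
Proof.
by move=> s0; rewrite /cost (trans_diag (tf omega))// indicE mem_set// ln1 oppr0.
Qed.

Lemma cost_ge0 omega s t x y : 0 <= cost omega s t x y.
Proof. by rewrite oppr_ge0 ln_le0// mass_le1. Qed.

Lemma cost_le (k : R) : exists2 C : R, 0 <= C & forall omega s t x y,
  0 <= s -> 1 <= t - s -> (norm1 (y - x))%:~R <= k * (t - s) ->
  cost omega s t x y <= C * (t - s).
Proof.
have [C C0 HC] := elliptic_lower_bound d K k; exists C => // omega s t x y s0 st yx.
have := HC omega _ (tf omega) (hg omega) s t x y s0 st yx.
by rewrite massE_cost// ler_expR; lra.
Qed.

Lemma cost_triangle omega s t u x y z : 0 <= s -> 1 <= t - s -> 1 <= u - t ->
  cost omega s u x z <= cost omega s t x y + cost omega t u y z.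
Proof.
move=> s0 st tu; have := chapman_ge1 (tf omega) x y [set z] s0.
move=> /(_ t u); rewrite !massE_cost//; try lra.
by rewrite -expRD ler_expR => H; have := H ltac:(lra) ltac:(lra); lra.
Qed.

Lemma cost_shift omega r z t y : 0 <= r -> 0 <= t ->
  cost (space_time_shift r z omega) 0 t 0 y = cost omega r (t + r) z (y + z).
Proof.
move=> r0 t0; rewrite /cost.
rewrite (trans_shift (tf omega) (hg omega) (tf _) (hg _) r0)//.
rewrite !add0r; congr (- ln (mass _ _)); apply/seteqP; split => w /=.
  by move=> <-; rewrite subrK.
by move=> ->; rewrite addrK.
Qed.

Lemma measurable_cost t y : 0 <= t ->
  measurable_fun setT (fun omega : Borel (env_path d K) => cost omega 0 t 0 y).
Proof.
move=> t0; apply: measurableT_comp => //.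
apply: (measurableT_comp (@measurable_ln R)).
exact: trans_measurable.
Qed.

End Costs.

(** * The lattice inside Euclidean space *)

Section LatticeEmbedding.
Variables (R : realType) (d : nat).
Implicit Types (x y z : lattice d) (v : 'rV[R]_d).

Definition vec z : 'rV[R]_d := map_mx intr (z : 'rV[int]_d).

Lemma vec0 : vec 0 = 0.
Proof. by apply/rowP => j; rewrite !mxE. Qed.

Lemma vecD y z : vec (y + z) = vec y + vec z.
Proof. by apply/rowP => j; rewrite !mxE intrD. Qed.

Lemma vecB y z : vec (y - z) = vec y - vec z.
Proof. by apply/rowP => j; rewrite !mxE intrB. Qed.

Lemma vecMn z n : vec (z *+ n) = n%:R *: vec z.
Proof.
elim: n => [|n IH]; first by rewrite mulr0n scale0r vec0.
by rewrite mulrSr vecD IH -natr1 scalerDl scale1r.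
Qed.

Lemma row_norm_le v (e : R) : 0 <= e -> (forall j, `|v 0 j| <= e) -> `|v| <= e.
Proof.
move=> e0 ve; have [v0|v0] := eqVneq (mx_norm v) 0.
  by rewrite [`|v|]v0.
have [[i j] /= vij] := mx_norm_neq0 v0.
by rewrite [`|v|]vij ord1.
Qed.

Lemma coord_norm_le v j : `|v 0 j| <= `|v|.
Proof.
rewrite [leRHS]mx_normrE.
exact: (@le_bigmax _ _ _ 0 (fun ij : 'I_1 * 'I_d => `|v ij.1 ij.2|) (0, j)).
Qed.

Lemma norm1_vec_le z : (norm1 z)%:~R <= d%:R * `|vec z|.
Proof.
rewrite /norm1 rmorph_sum /= -[X in X%:R * _]card_ord mulr_natl -sumr_const.
apply: ler_sum => j _; apply: le_trans (coord_norm_le (vec z) j).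
by rewrite !mxE intr_norm.
Qed.

Lemma vec_unit_le (e : unit_vector d) : `|vec e| <= 1.
Proof.
apply: row_norm_le => // j; rewrite !mxE -intr_norm -[leRHS]/(1%:~R) ler_int.
have := unit_vectorP e; rewrite /norm1 (bigD1 j)//= => /eqP <-.
by rewrite lerDl; exact: sumr_ge0.
Qed.

Lemma lattice_dense v (e : R) : 0 < e ->
  exists n z, (0 < n)%N /\ `|n%:R^-1 *: vec z - v| < e.
Proof.
move=> e0; pose n := (Num.truncn (e^-1)).+1.
have n0 : 0 < n%:R :> R by rewrite ltr0n.
have ne : n%:R^-1 < e.
  by rewrite -[ltRHS]invrK ltf_pV2 ?posrE ?invr_gt0//; exact: truncnS_gt.
exists n, (\row_j Num.floor (n%:R * v 0 j) : 'rV[int]_d); split => //.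
apply: le_lt_trans ne; apply: row_norm_le => [|j]; first by rewrite invr_ge0 ltW.
rewrite !mxE.
have -> : n%:R^-1 * (Num.floor (n%:R * v 0 j))%:~R - v 0 j =
    - (n%:R^-1 * (n%:R * v 0 j - (Num.floor (n%:R * v 0 j))%:~R)).
  by field; exact: lt0r_neq0.
have nV : 0 <= n%:R^-1 :> R by rewrite invr_ge0 ltW.
rewrite normrN normrM (ger0_norm nV) ler_piMr//.
have := floor_le_tmp (n%:R * v 0 j); have := floorD1_gt (n%:R * v 0 j).
by rewrite intrD ler_norml; lra.
Qed.

End LatticeEmbedding.

Section MeanCost.
Variables (R : realType) (d : nat) (K : ellipticity R).
Variable p : env_path d K -> R -> R -> lattice d -> probability (Borel (lattice d)) R.
Hypothesis tf : forall omega, transition_function (p omega).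
Hypothesis hg : forall omega, has_generator (p omega) (fun s => generator (omega s)).
Variable M : probability (Borel (env_path d K)) R.
Hypothesis erg : ergodic_environment M.
Implicit Types (n m q : nat) (x y z : lattice d).
Local Notation cost := (cost p).

Definition mean_cost n z : R := \int[M]_w cost w 0 n%:R 0 z.

Lemma cost_bounded n z : (0 < n)%N ->
  exists C : R, forall w, `|cost w 0 n%:R 0 z| <= C.
Proof.
move=> n0; have [C C0 HC] := cost_le tf hg (norm1 z)%:~R.
exists (C * (n%:R - 0)) => w; rewrite ger0_norm ?cost_ge0//; apply: HC => //.
  by rewrite subr0 ler1n.
by rewrite !subr0 ler_peMr ?ler1n// ler0z norm1_ge0.
Qed.

Lemma cost_integrable n z : (0 < n)%N ->
  M.-integrable setT (EFin \o (fun w : Borel (env_path d K) => cost w 0 n%:R 0 z)).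
Proof.
move=> n0; have [C HC] := cost_bounded z n0.
by apply: (@bounded_mean_integrable _ _ _ _ _ C) => //; exact: (measurable_cost tf hg).
Qed.

Lemma mean_cost_ge0 n z : 0 <= mean_cost n z.
Proof. by apply: Rintegral_ge0 => w _; exact: cost_ge0. Qed.

Lemma mean_cost_le (k : R) : exists2 C : R, 0 <= C & forall n z, (0 < n)%N ->
  (norm1 z)%:~R <= k * n%:R -> mean_cost n z <= C * n%:R.
Proof.
have [C C0 HC] := cost_le tf hg k; exists C => // n z n0 zn.
rewrite -(mean_cst M (C * n%:R)); apply: le_Rintegral => //.
- exact: cost_integrable.
- by apply: (@bounded_mean_integrable _ _ _ _ _ `|C * n%:R|).
- move=> w _; rewrite -[X in C * X]subr0; apply: HC => //; rewrite ?subr0//.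
  by rewrite ler1n.
Qed.

(** The second leg starts from [y] at time [m]: its cost is that of a leg from the origin in the
    shifted environment, which has the same law. *)
Lemma mean_costD m n y z : (0 < m)%N -> (0 < n)%N ->
  mean_cost (m + n) (y + z) <= mean_cost m y + mean_cost n z.
Proof.
move=> m0 n0; have m0' : 0 < m%:R :> R by rewrite ltr0n.
have mS := shift_measurable erg y m0'.
have MS := shift_preserving erg y m0'.
have mc : measurable_fun setT (fun w : Borel (env_path d K) => cost w 0 n%:R 0 z).
  exact: (measurable_cost tf hg).
have c0 w : 0 <= cost w 0 n%:R 0 z by exact: cost_ge0.
have E := mean_preserving mS (fun A => MS A) mc c0.
have [C HC] := cost_bounded z n0.
have ic : M.-integrable setT (EFin \o
    (fun w : Borel (env_path d K) => cost (space_time_shift m%:R y w) 0 n%:R 0 z)).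
  apply: (@bounded_mean_integrable _ _ _ _ _ C) => //.
  exact: (measurableT_comp mc mS).
have -> : mean_cost n z =
    \int[M]_w cost (space_time_shift m%:R y w) 0 n%:R 0 z := esym E.
rewrite [mean_cost m y]/mean_cost -RintegralD//; last exact: cost_integrable.
apply: le_Rintegral => //.
- by apply: cost_integrable; rewrite addn_gt0 m0.
- have [C' HC'] := cost_bounded y m0.
  apply: (@bounded_mean_integrable _ _ _ _ _ (C' + C)).
    apply: measurable_funD; first exact: (measurable_cost tf hg).
    exact: (measurableT_comp mc mS).
  by move=> w; apply: le_trans (ler_normD _ _) _; rewrite lerD.
- move=> w _; rewrite (cost_shift tf hg)//.
  rewrite -natrD addnC [z + y]addrC.
  apply: (cost_triangle tf hg) => //; rewrite ?subr0 ?ler1n//.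
  by rewrite natrD addrK ler1n.
Qed.

(* The constant of Kingman's theorem for the costs from [(0, 0)] to [(n q, n z)]. *)
Definition mean_rate q z : R :=
  inf [set mean_cost (n * q) (z *+ n) / n%:R | n in [set n | (0 < n)%N]].

Lemma mean_rate_has_inf q z :
  has_inf [set mean_cost (n * q) (z *+ n) / n%:R | n in [set n | (0 < n)%N]].
Proof.
split; first by exists (mean_cost (1 * q) (z *+ 1) / 1%:R), 1%N.
by exists 0 => _ [n _ <-]; rewrite divr_ge0// mean_cost_ge0.
Qed.

Lemma mean_rate_le q z : mean_rate q z <= mean_cost q z.
Proof.
apply: inf_lbound; first by case: (mean_rate_has_inf q z).
by exists 1%N => //; rewrite mul1n mulr1n divr1.
Qed.

Lemma mean_rate_ge q z (b : R) :
  (forall n, (0 < n)%N -> b * n%:R <= mean_cost (n * q) (z *+ n)) ->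
  b <= mean_rate q z.
Proof.
move=> H; apply: lb_le_inf; first by case: (mean_rate_has_inf q z).
by move=> _ [n n0 <-]; rewrite ler_pdivlMr ?ltr0n//; exact: H.
Qed.

Lemma cost_limit q z : (0 < q)%N ->
  {ae M, forall w, forall e : R, 0 < e -> exists N, forall n, (N <= n)%N ->
    (mean_rate q z - e) * n%:R <= cost w 0 (n * q)%:R 0 (z *+ n)
       <= (mean_rate q z + e) * n%:R}.
Proof.
move=> q0; have q0' : 0 < q%:R :> R by rewrite ltr0n.
have q1 : 1 <= q%:R :> R by rewrite ler1n.
have [C C0 HC] := cost_le tf hg (norm1 z)%:~R.
have n1z n : norm1 (z *+ n) = norm1 z * n%:Z.
  rewrite /norm1 mulr_suml; apply: eq_bigr => j _.
  by rewrite mulmxnE normrMn -mulr_natr natz.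
pose A n (w : Borel (env_path d K)) := cost w 0 (n * q)%:R 0 (z *+ n).
pose T : Borel (env_path d K) -> Borel (env_path d K) := space_time_shift q%:R z.
pose tau (j : {s : R | 1 <= s} * lattice d) : Borel (env_path d K) -> Borel (env_path d K) :=
  space_time_shift (sval j.1) j.2.
have A00 w : A 0%N w = 0.
  by rewrite /A mul0n mulr0n (cost_diag tf).
apply: (@kingman R _ (Borel (env_path d K)) M _ tau A (C * q%:R) (mean_rate q z) T).
- move=> B mB stB; exact: (shift_stable_zero_one erg mB stB).
- move=> [[s /= s1] y].
  (* The path for the shifted environment is completed by two links, from [(0, 0)] to [(s, y)] and
     from [(n q + s, n z + y)] to [((n + k) q, (n + k) z)]. As [k > s + 1], both last at least 1,
     and their costs are bounded uniformly in [n] and [w]. *)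
  pose k := (Num.truncn (s + 1)).+1.
  have ks : s + 1 < k%:R by exact: truncnS_gt.
  have kq : k%:R <= k%:R * q%:R :> R by rewrite ler_peMr.
  have [C1 C10 HC1] := cost_le tf hg (norm1 (y - 0))%:~R.
  have [C2 C20 HC2] := cost_le tf hg (norm1 (z *+ k - y))%:~R.
  exists k, (C1 * (s - 0) + C2 * (k%:R * q%:R - s)) => n w.
  rewrite /A /tau (cost_shift tf hg) ?(le_trans ler01 s1)//.
  have nq0 : 0 <= (n * q)%:R :> R by [].
  have h1 : cost w 0 s 0 y <= C1 * (s - 0).
    by apply: HC1; rewrite ?subr0// ler_peMr// ler0z norm1_ge0.
  have e1 : ((n + k) * q)%:R = (n * q)%:R + k%:R * q%:R :> R.
    by rewrite mulnDl natrD [(k * q)%:R]natrM.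
  have s0 : 0 <= s by lra.
  (* For [n = 0] the middle leg has duration 0, and the two links are joined directly. *)
  have [->|n0] := posnP n.
    have h3 : cost w s (k * q)%:R y (z *+ k) <= C2 * (k%:R * q%:R - s).
      rewrite -natrM; apply: HC2 => //; rewrite natrM; first lra.
      by rewrite ler_peMr ?ler0z ?norm1_ge0//; lra.
    have h4 : cost w 0 (k * q)%:R 0 (z *+ k) <= cost w 0 s 0 y + cost w s (k * q)%:R y (z *+ k).
      by apply: (cost_triangle tf hg) => //; rewrite ?subr0// natrM; lra.
    by rewrite /= mul0n mulr0n !add0n !add0r (cost_diag tf)//; lra.
  have h2 : cost w ((n * q)%:R + s) ((n + k) * q)%:R (z *+ n + y) (z *+ (n + k))
      <= C2 * (k%:R * q%:R - s).
    have -> : k%:R * q%:R - s = ((n + k) * q)%:R - ((n * q)%:R + s) by rewrite e1; ring.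
    have t1 : 1 <= ((n + k) * q)%:R - ((n * q)%:R + s) by rewrite e1; lra.
    apply: HC2 => //; first lra.
    have -> : z *+ (n + k) - (z *+ n + y) = z *+ k - y.
      by rewrite mulrnDr opprD addrACA subrr add0r.
    by rewrite ler_peMr// ler0z norm1_ge0.
  have nq1 : 1 <= (n * q)%:R :> R by rewrite ler1n muln_gt0 n0.
  have t1 := @cost_triangle _ _ _ _ tf hg w 0 s ((n + k) * q)%:R 0 y (z *+ (n + k))
    (lexx _) ltac:(lra) ltac:(rewrite e1; lra).
  have t2 := @cost_triangle _ _ _ _ tf hg w s ((n * q)%:R + s) ((n + k) * q)%:R y
    (z *+ n + y) (z *+ (n + k)) s0 ltac:(lra) ltac:(rewrite e1; lra).
  lra.
- exact: (shift_measurable erg).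
- by move=> B mB; exact: (shift_preserving erg).
- by move=> n; exact: (measurable_cost tf hg).
- move=> n w; rewrite cost_ge0 /=.
  have [->|n0] := posnP n; first by rewrite A00 mulr0.
  have -> : C * q%:R * n%:R = C * ((n * q)%:R - 0) by rewrite natrM; ring.
  apply: HC => //; rewrite !subr0; first by rewrite ler1n muln_gt0 n0.
  rewrite n1z intrM natrM ler_wpM2l ?ler0z ?norm1_ge0//.
  by rewrite -pmulrn ler_peMr.
- move=> m n w; have [->|m0] := posnP m; first by rewrite A00 add0r.
  have [->|n0] := posnP n; first by rewrite A00 addn0 addr0.
  rewrite /T iter_space_time_shift// /A (cost_shift tf hg) ?mulr_ge0//.
  rewrite -natrM -natrD -mulrnDr -mulnDl [(n + m)%N]addnC.
  apply: (cost_triangle tf hg) => //; rewrite ?subr0 ?ler1n ?muln_gt0 ?m0//.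
  by rewrite mulnDl natrD addrC addKr ler1n muln_gt0 n0.
- move=> n n0; rewrite -ler_pdivlMr ?ltr0n//; apply: inf_lbound.
    by case: (mean_rate_has_inf q z).
  by exists n.
- move=> e e0; have [_ [n n0 <-] H] := inf_adherent e0 (mean_rate_has_inf q z).
  by exists n => //; rewrite -ler_pdivrMr ?ltr0n// ltW.
Qed.

End MeanCost.

(** * The rate function *)

(** Both [A] and [N - A] are positive because the subadditivity of [phi] concerns positive
    durations. *)
Lemma rational_weight (R : realType) (t eta : R) : 0 < t -> t < 1 -> 0 < eta ->
  exists A N : nat, [/\ (0 < A)%N, (A < N)%N & `|A%:R / N%:R - t| <= eta].
Proof.
move=> t0 t1 eta0; have t1' : 0 < 1 - t by lra.
have i1 : 0 < eta^-1 by rewrite invr_gt0.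
have i2 : 0 < t^-1 by rewrite invr_gt0.
have i3 : 0 < (1 - t)^-1 by rewrite invr_gt0.
pose N := (Num.truncn (eta^-1 + t^-1 + (1 - t)^-1)).+1.
have NR : 0 < N%:R :> R by rewrite ltr0n.
have Nbig : eta^-1 + t^-1 + (1 - t)^-1 < N%:R by exact: truncnS_gt.
have Nt : 1 <= t * N%:R by rewrite mulrC -ler_pdivrMr// mul1r; lra.
have Nt' : 1 < (1 - t) * N%:R by rewrite mulrC -ltr_pdivrMr// mul1r; lra.
have Neta : N%:R^-1 < eta.
  by rewrite -[ltRHS]invrK ltf_pV2 ?posrE//; lra.
pose A := Num.truncn (t * N%:R).
have tN0 : 0 <= t * N%:R by lra.
have /andP[A1 A2] := truncn_itv tN0; rewrite -/A in A1 A2.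
have AE : A%:R = A%:R / N%:R * N%:R :> R by rewrite divfK// gt_eqF.
exists A, N; split; first by rewrite truncn_gt0.
  by rewrite -(ltr_nat R); rewrite mulrBl mul1r in Nt'; lra.
rewrite ler0_norm; last by rewrite subr_le0 ler_pdivrMr.
rewrite opprB; apply: le_trans (ltW Neta).
rewrite -(ler_pM2r NR) mulrBl -AE mulVf ?gt_eqF//.
by rewrite -natr1 in A2; lra.
Qed.

Lemma exists_gt2 (R : realType) (a b : R) : 0 <= a -> 0 <= b ->
  exists S : R, [/\ 0 < S, a < S & b < S].
Proof. by move=> a0 b0; exists (a + b + 1); split; lra. Qed.

Section RateFunction.
Variables (R : realType) (d : nat).
(* A subadditive cost [phi n z] of reaching [z] in time [n], which is linearly
   bounded in every cone [|z| <= k n]. *)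
Variable phi : nat -> lattice d -> R.
Hypothesis phi_ge0 : forall n z, 0 <= phi n z.
Hypothesis phi_le : forall k : R, exists2 C : R, 0 <= C &
  forall n z, (0 < n)%N -> `|vec R z| <= k * n%:R -> phi n z <= C * n%:R.
Hypothesis phiD : forall m n y z, (0 < m)%N -> (0 < n)%N ->
  phi (m + n) (y + z) <= phi m y + phi n z.
Implicit Types (x y v : 'rV[R]_d) (z : lattice d) (e : R).

Definition close x e : set (nat * lattice d) :=
  [set nz | (0 < nz.1)%N /\ `|nz.1%:R^-1 *: vec R nz.2 - x| < e].

Definition slopes x e : set R := [set phi nz.1 nz.2 / nz.1%:R | nz in close x e].

(** The lower limit of [phi n z / n] as [z / n] tends to [x]. All [n > 0] compete: passing to
    [(k n, k z)] keeps [z / n] and, by [phi_muln], does not increase the slope. *)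
Definition rate_function x : R := sup [set inf (slopes x e) | e in [set e | 0 < e]].

Lemma slopes_has_inf x e : 0 < e -> has_inf (slopes x e).
Proof.
move=> e0; split.
  by have [n [z nz]] := lattice_dense x e0; exists (phi n z / n%:R), (n, z).
by exists 0 => _ [[n z] _ <-]; rewrite divr_ge0.
Qed.

Lemma slopes_inf_le x (k : R) : `|x| <= k -> exists C : R,
  forall y e, `|y| <= k -> 0 < e -> inf (slopes y e) <= C.
Proof.
move=> _; have [C C0 HC] := phi_le (k + 1); exists C => y e yk e0.
have e1 : 0 < Num.min e 1 by rewrite lt_min e0/=.
have [n [z [n0]]] := lattice_dense y e1; rewrite lt_min => /andP[nze nz1].
have n0' : 0 < n%:R :> R by rewrite ltr0n.
apply: (@le_trans _ _ (phi n z / n%:R)).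
  by apply: inf_lbound; [case: (slopes_has_inf y e0)|exists (n, z)].
rewrite ler_pdivrMr//; apply: HC => //.
have : `|n%:R^-1 *: vec R z| <= k + 1.
  rewrite -[_ *: _](subrK y) (le_trans (ler_normD _ _))//.
  by rewrite addrC lerD// ltW.
have nV : 0 <= n%:R^-1 :> R by rewrite invr_ge0 ltW.
by rewrite normrZ (ger0_norm nV) ler_pdivrMl// mulrC.
Qed.

Lemma rate_has_sup x : has_sup [set inf (slopes x e) | e in [set e | 0 < e]].
Proof.
split; first by exists (inf (slopes x 1)), 1 => /=.
by have [C HC] := slopes_inf_le (lexx `|x|); exists C => _ [e e0 <-]; exact: HC.
Qed.

(** One half of the lower limit, for all pairs near [x], which serves the upper bound on
    probabilities. The other half, [rate_upper], supplies a single cheap pair near [x] and serves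
    the lower bound. *)
Lemma rate_lower x e : 0 < e -> exists2 de : R, 0 < de &
  forall n z, (0 < n)%N -> `|n%:R^-1 *: vec R z - x| < de ->
    (rate_function x - e) * n%:R <= phi n z.
Proof.
move=> e0; have [_ [de de0 <-] H] := sup_adherent e0 (rate_has_sup x).
exists de => // n z n0 nz; rewrite -ler_pdivlMr ?ltr0n//.
apply: (le_trans (ltW H)); apply: inf_lbound.
  by case: (slopes_has_inf x de0).
by exists (n, z).
Qed.

Lemma rate_upper x e de : 0 < e -> 0 < de -> exists n z,
  [/\ (0 < n)%N, `|n%:R^-1 *: vec R z - x| < de & phi n z <= (rate_function x + e) * n%:R].
Proof.
move=> e0 de0.
have [_ [[n z] [/= n0 nz] <-] H] := inf_adherent e0 (slopes_has_inf x de0).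
exists n, z; split => //; rewrite -ler_pdivrMr ?ltr0n//.
apply: (le_trans (ltW H)); rewrite lerD2r; apply: ub_le_sup.
  by case: (rate_has_sup x).
by exists de.
Qed.

Lemma rate_function_ge0 x : 0 <= rate_function x.
Proof.
apply/ler_addgt0Pr => e e0; have [n [z [n0 _ H]]] := rate_upper x e0 ltr01.
by have := le_trans (phi_ge0 n z) H; rewrite pmulr_lge0// ltr0n.
Qed.

Lemma rate_function_le (k : R) : exists C : R,
  forall x, `|x| <= k -> rate_function x <= C.
Proof.
have [xk|xk] := pselect (exists x : 'rV[R]_d, `|x| <= k); last first.
  by exists 0 => x xk'; exfalso; apply: xk; exists x.
have [x0 x0k] := xk; have [C HC] := slopes_inf_le x0k; exists C => x {}xk.
apply: ge_sup; first by case: (rate_has_sup x).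
by move=> _ [e e0 <-]; exact: HC.
Qed.

Lemma phi_muln n z k : (0 < n)%N -> (0 < k)%N -> phi (k * n) (z *+ k) <= k%:R * phi n z.
Proof.
move=> n0; elim: k => // k IH _; have [->|k0] := posnP k.
  by rewrite mul1n mulr1n mul1r.
rewrite mulSn mulrS -natr1 mulrDl mul1r [leRHS]addrC.
have kn0 : (0 < k * n)%N by rewrite muln_gt0 k0.
apply: (le_trans (phiD z (z *+ k) n0 kn0)).
by rewrite lerD2l IH.
Qed.

Lemma rate_function_convex_aux x y t : 0 < t < 1 ->
  rate_function (t *: x + (1 - t) *: y) <= t * rate_function x + (1 - t) * rate_function y.
Proof.
move=> /andP[t0 t1]; set w := _ + _.
apply/ler_addgt0Pr => e e0.
have [a aE] : exists a : R, a = rate_function x by exists (rate_function x).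
have [b bE] : exists b : R, b = rate_function y by exists (rate_function y).
have a0 : 0 <= a by rewrite aE; exact: rate_function_ge0.
have b0 : 0 <= b by rewrite bE; exact: rate_function_ge0.
have e4 : 0 < e / 4 by rewrite divr_gt0.
have [de de0 Hde] := rate_lower w e4.
have de2 : 0 < de / 2 by rewrite divr_gt0.
have [n1 [z1 [n10 nz1 P1]]] := rate_upper x e4 de2.
rewrite -aE in P1.
have [n2 [z2 [n20 nz2 P2]]] := rate_upper y e4 de2.
rewrite -bE in P2.
have n1R : 0 < n1%:R :> R by rewrite ltr0n.
have n2R : 0 < n2%:R :> R by rewrite ltr0n.
(* The weight [t] will be replaced by a rational [th] within [eta]. This may move the end point by
   at most [de / 2] and the averaged rate by at most [e / 4], hence a common bound [S] for both
   differences. *)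
have [S [S0 Sxy Sab]] : exists S : R, [/\ 0 < S, `|x| + `|y| < S & a + b < S].
  by apply: exists_gt2; exact: addr_ge0.
have [eta [eta0 eta1 eta2]] : exists eta : R,
    [/\ 0 < eta, eta * S <= de / 2 & eta * S <= e / 4].
  exists (Num.min (de / 2) (e / 4) / S).
  by rewrite divr_gt0 ?lt_min ?de2// divfK ?gt_eqF// !ge_min !lexx orbT.
have [A [N [A0 AN tht]]] := rational_weight t0 t1 eta0.
have NR : 0 < N%:R :> R by rewrite ltr0n (leq_trans _ AN).
have B0 : (0 < N - A)%N by rewrite subn_gt0.
have BE : (N - A)%:R = N%:R - A%:R :> R by rewrite natrB// ltnW.
have [th thE] : exists th : R, th = A%:R / N%:R by exists (A%:R / N%:R).
have AE : A%:R = th * N%:R by rewrite thE divfK// gt_eqF.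
have th0 : 0 <= th by rewrite thE divr_ge0.
have th1 : th <= 1 by rewrite thE ler_pdivrMr// mul1r ler_nat ltnW.
rewrite -thE in tht; clear thE.
(* [k1] copies of the first pair and [k2] of the second last [A n1 n2] and [(N - A) n1 n2]:
   fractions [th] and [1 - th] of the total time [N n1 n2]. *)
pose k1 := (A * n2)%N; pose k2 := ((N - A) * n1)%N.
have k10 : (0 < k1)%N by rewrite muln_gt0 A0.
have k20 : (0 < k2)%N by rewrite muln_gt0 B0.
have tot : (k1 * n1 + k2 * n2)%:R = N%:R * (n1%:R * n2%:R) :> R.
  by rewrite natrD !natrM BE; ring.
have tot0 : (0 < k1 * n1 + k2 * n2)%N by rewrite addn_gt0 muln_gt0 k10 n10.
pose Z := z1 *+ k1 + z2 *+ k2.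
have dist : `|(k1 * n1 + k2 * n2)%:R^-1 *: vec R Z - w| < de.
  have -> : (k1 * n1 + k2 * n2)%:R^-1 *: vec R Z - w =
      th *: (n1%:R^-1 *: vec R z1 - x) + (1 - th) *: (n2%:R^-1 *: vec R z2 - y)
      + (th - t) *: (x - y).
    rewrite tot /Z vecD !vecMn /w !natrM BE AE.
    apply/rowP => j; rewrite !mxE; field.
    by rewrite !lt0r_neq0.
  have h1 : `|th *: (n1%:R^-1 *: vec R z1 - x)| <= th * (de / 2).
    by rewrite normrZ ger0_norm// ler_wpM2l// ltW.
  have h2 : `|(1 - th) *: (n2%:R^-1 *: vec R z2 - y)| <= (1 - th) * (de / 2).
    by rewrite normrZ ger0_norm ?subr_ge0// ler_wpM2l ?subr_ge0// ltW.
  have h3 : `|(th - t) *: (x - y)| < de / 2.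
    rewrite normrZ; apply: (@le_lt_trans _ _ (eta * (`|x| + `|y|))).
      by rewrite ler_pM// ler_normB.
    by apply: lt_le_trans eta1; rewrite ltr_pM2l.
  have deE : th * (de / 2) + (1 - th) * (de / 2) + de / 2 = de by field.
  apply: (le_lt_trans (ler_normD _ _)); rewrite -[ltRHS]deE.
  by apply: ler_ltD h3; apply: (le_trans (ler_normD _ _)); exact: lerD.
have low := Hde _ Z tot0 dist.
have up : phi (k1 * n1 + k2 * n2) Z <= k1%:R * ((a + e / 4) * n1%:R) + k2%:R * ((b + e / 4) * n2%:R).
  have m1 : (0 < k1 * n1)%N by rewrite muln_gt0 k10.
  have m2 : (0 < k2 * n2)%N by rewrite muln_gt0 k20.
  apply: (le_trans (phiD _ _ m1 m2)); apply: lerD.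
    by apply: (le_trans (phi_muln z1 n10 k10)); rewrite ler_wpM2l.
  by apply: (le_trans (phi_muln z2 n20 k20)); rewrite ler_wpM2l.
have := le_trans low up; rewrite tot.
have -> : k1%:R * ((a + e / 4) * n1%:R) + k2%:R * ((b + e / 4) * n2%:R) =
    (th * (a + e / 4) + (1 - th) * (b + e / 4)) * (N%:R * (n1%:R * n2%:R)).
  by rewrite /k1 /k2 !natrM BE AE; ring.
rewrite ler_pM2r ?mulr_gt0// => F1.
have F2 : (th - t) * (a - b) <= e / 4.
  apply: le_trans eta2; apply: (le_trans (ler_norm _)); rewrite normrM ler_pM//.
  by apply: (le_trans (ler_normB _ _)); rewrite !ger0_norm// ltW.
rewrite -aE -bE; move: (rate_function w) F1 F2 => W F1 F2.
clear - F1 F2 e0; lra.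
Qed.

Lemma rate_function_convex (t : R) x y : 0 <= t <= 1 ->
  rate_function (t *: x + (1 - t) *: y) <= t * rate_function x + (1 - t) * rate_function y.
Proof.
move=> /andP[t0 t1]; have [->|tN0] := eqVneq t 0.
  by rewrite scale0r add0r subr0 scale1r mul0r add0r mul1r.
have [->|tN1] := eqVneq t 1.
  by rewrite subrr scale0r addr0 scale1r mul0r addr0 mul1r.
by apply: rate_function_convex_aux; rewrite !lt_neqAle eq_sym tN0 t0 tN1.
Qed.

(** Convexity and boundedness on the ball of radius [|x| + 2] give a Lipschitz bound for unit
    displacements from the ball of radius [|x| + 1]. *)
Lemma rate_function_continuous : continuous rate_function.
Proof.
move=> x; have [C HC] := rate_function_le (`|x| + 2).
pose C' := Num.max C 1; have C'1 : 1 <= C' by rewrite le_max lexx orbT.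
have {}HC u : `|u| <= `|x| + 2 -> rate_function u <= C'.
  by move=> /HC uC; rewrite le_max uC.
(* a point at distance [t] from [u] is a convex combination of [u], with weight
   [1 - t], and of a point at distance 1 from [u] *)
have lip u v : `|u| <= `|x| + 1 -> `|v - u| <= 1 ->
    rate_function v - rate_function u <= `|v - u| * C'.
  move=> ux vu1; have [vu|vu] := eqVneq (v - u) 0.
    by move/eqP: (vu); rewrite subr_eq0 => /eqP ->; rewrite !subrr normr0 mul0r.
  pose t := `|v - u|; have t0 : 0 < t by rewrite normr_gt0.
  pose r := u + t^-1 *: (v - u).
  have rx : `|r| <= `|x| + 2.
    have tV : 0 <= t^-1 by rewrite invr_ge0 ltW.
    apply: (le_trans (ler_normD _ _)); rewrite normrZ (ger0_norm tV).
    by rewrite mulVf ?gt_eqF//; lra.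
  have vE : t *: r + (1 - t) *: u = v.
    by apply/rowP => j; rewrite /r !mxE; field; exact: lt0r_neq0.
  have t01 : 0 <= t <= 1 by rewrite ltW.
  have := rate_function_convex r u t01; rewrite vE.
  have := HC r rx; have := rate_function_ge0 u; rewrite -/t.
  move: (rate_function u) (rate_function r) (rate_function v) => a b b' a0 bC.
  have tb : t * b <= t * C' by rewrite ler_wpM2l// ltW.
  have ta : 0 <= t * a by rewrite mulr_ge0// ltW.
  move: tb ta; clearbody t; clear; lra.
apply/(@cvgrPdist_lt R R 'rV[R]_d (nbhs x) _ rate_function (rate_function x)) => e e0.
have C'0 : 0 < C' by lra.
near=> y.
have yx : `|y - x| < Num.min 1 (e / C').
  rewrite distrC; near: y; apply: cvgr_dist_lt => //.
  by rewrite lt_min ltr01 divr_gt0.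
move: yx; rewrite lt_min => /andP[yx1 yxe].
rewrite ltr_pdivlMr// in yxe.
have h1 : rate_function y - rate_function x <= `|y - x| * C'.
  by apply: lip; [lra|exact: ltW].
have h2 : rate_function x - rate_function y <= `|y - x| * C'.
  rewrite [`|y - x|]distrC; apply: lip; last by rewrite distrC ltW.
  by rewrite -[y](subrK x) (le_trans (ler_normD _ _))// addrC lerD2l ltW.
have h3 := le_lt_trans h1 yxe; have h4 := le_lt_trans h2 yxe.
by rewrite ltr_norml; apply/andP; split; [rewrite ltrNl opprB; exact: h3|exact: h4].
Unshelve. all: by end_near. Qed.

End RateFunction.

(** * Large deviation bounds *)

Section LargeDeviations.
Variables (R : realType) (d : nat) (K : ellipticity R).
Variable p : env_path d K -> R -> R -> lattice d -> probability (Borel (lattice d)) R.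
Hypothesis tf : forall omega, transition_function (p omega).
Hypothesis hg : forall omega, has_generator (p omega) (fun s => generator (omega s)).
Variable M : probability (Borel (env_path d K)) R.
Hypothesis erg : ergodic_environment M.
Implicit Types (w : env_path d K) (s t : R) (y z : lattice d) (x : 'rV[R]_d) (n q : nat).
Local Notation cost := (cost p).
Local Notation vec := (vec R).
Local Notation I := (rate_function (mean_cost p M)).

Lemma cost_cone (k : R) : exists2 C : R, 0 <= C & forall w s t y z,
  0 <= s -> 1 <= t - s -> `|vec (z - y)| <= k * (t - s) ->
  cost w s t y z <= C * (t - s).
Proof.
have [C C0 HC] := cost_le tf hg (d%:R * k); exists C => // w s t y z s0 st yz.
apply: HC => //; apply: (le_trans (norm1_vec_le R _)).
by rewrite -mulrA ler_wpM2l.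
Qed.

Lemma mean_cost_cone (k : R) : exists2 C : R, 0 <= C &
  forall n z, (0 < n)%N -> `|vec z| <= k * n%:R -> mean_cost p M n z <= C * n%:R.
Proof.
have [C C0 HC] := mean_cost_le tf hg M (d%:R * k); exists C => // n z n0 zk.
apply: HC => //; apply: (le_trans (norm1_vec_le R _)).
by rewrite -mulrA ler_wpM2l.
Qed.

(** A single event, about countably many pairs [(q, z)], on which both bounds hold for every open
    and every closed set. *)
Definition good_path w := forall q z, (0 < q)%N -> forall e : R, 0 < e ->
  exists N, forall n, (N <= n)%N ->
    (mean_rate p M q z - e) * n%:R <= cost w 0 (n * q)%:R 0 (z *+ n)
       <= (mean_rate p M q z + e) * n%:R.

Lemma good_path_ae : {ae M, forall w, good_path w}.
Proof.
pose P i (w : Borel (env_path d K)) := if unpickle i is Some (q, z) then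
  (0 < q)%N -> forall e : R, 0 < e ->
  exists N, forall n, (N <= n)%N ->
    (mean_rate p M q z - e) * n%:R <= cost w 0 (n * q)%:R 0 (z *+ n)
       <= (mean_rate p M q z + e) * n%:R else True.
have H : {ae M, forall w, forall i, P i w}.
  apply/ae_foralln => i; rewrite /P; case: (unpickle i) => [[q z]|]; last exact: aeW.
  have [->|q0] := posnP q; first exact: aeW.
  have := cost_limit tf hg erg z q0; apply: negligibleS => w /= h h'.
  by apply: h => _.
move: H; apply: negligibleS => w /= h Hw; apply: h => q z q0.
by have := Hw (pickle (q, z)); rewrite /P pickleK; apply.
Qed.

Definition region t (A : set 'rV[R]_d) : set (lattice d) :=
  [set y | A (t^-1 *: vec y)].

Lemma lower_bound w (O : set 'rV[R]_d) x (e : R) : good_path w -> open O -> O x ->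
  0 < e -> \forall t \near +oo,
  expR (- (I x + e) * t) <= mass (p w 0 t 0) (region t O).
Proof.
move=> gw oO Ox e0.
have [de de0 Hde] : exists2 de : R, 0 < de & forall v, `|v - x| < de -> O v.
  have /nbhs_ballP [de de0 Hde] : nbhs x O by exact: open_nbhs_nbhs.
  by exists de => // v vx; apply: Hde; rewrite -ball_normE /= distrC.
have e3 : 0 < e / 3 by rewrite divr_gt0.
have de2 : 0 < de / 2 by rewrite divr_gt0.
have [q [z [q0 qz Pqz]]] :=
  @rate_upper _ _ _ (mean_cost_ge0 p M) mean_cost_cone x _ _ e3 de2.
(* With opening 0 the cone contains only returns to the starting point: [C] is the price of waiting
   per unit time. *)
have [C C0 HC] := cost_cone 0.
have [N HN] := gw q z q0 _ e3.
have qR : 1 <= q%:R :> R by rewrite ler1n.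
have q0R : 0 < q%:R :> R by rewrite ltr0n.
have I0 : 0 <= I x by exact: rate_function_ge0 (mean_cost_ge0 p M) mean_cost_cone _.
have g1 : mean_rate p M q z <= (I x + e / 3) * q%:R.
  exact: le_trans (mean_rate_le p M q z) Pqz.
near=> t.
have t0 : 0 < t by near: t; exact: nbhs_pinfty_gt.
have tN : N.+3%:R * q%:R <= t by near: t; apply: nbhs_pinfty_ge; exact: num_real.
have tC : 6 * C * q%:R / e <= t by near: t; apply: nbhs_pinfty_ge; exact: num_real.
have tz : 4 * `|vec z| / de <= t by near: t; apply: nbhs_pinfty_ge; exact: num_real.
(* Go to [n z] at time [n q], between [t - 2 q] and [t - q], and wait there. *)
pose m := Num.truncn (t / q%:R).
have /andP[m1 m2] : m%:R <= t / q%:R < m.+1%:R by rewrite truncn_itv// divr_ge0// ltW.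
rewrite ler_pdivlMr// in m1; rewrite ltr_pdivrMr// in m2.
have mN : (N.+2 <= m)%N.
  have : (N.+3 < m.+1)%N.
    by rewrite -(ltr_nat R) -(ltr_pM2r q0R); apply: le_lt_trans tN m2.
  by rewrite ltnS; exact: ltnW.
(* One period is given up so that the wait lasts at least [q >= 1], as the triangle inequality for
   costs demands. *)
pose n := m.-1.
have mE : m%:R = n%:R + 1 :> R by rewrite natr1 /n prednK// (leq_trans _ mN).
have nN : (N < n)%N by rewrite /n -ltnS prednK// (leq_trans _ mN).
have n1R : 1 <= n%:R :> R by rewrite ler1n (leq_trans _ nN).
rewrite -natr1 mE in m2; rewrite mE in m1.
have nqt : n%:R * q%:R + q%:R <= t by lra.
have nqt2 : t - n%:R * q%:R <= 2 * q%:R by lra.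
have nq1 : 1 <= n%:R * q%:R :> R by exact: mulr_ege1.
have inO : region t O (z *+ n).
  apply: Hde; rewrite vecMn.
  have -> : t^-1 *: (n%:R *: vec z) - x =
      (q%:R^-1 *: vec z - x) - ((t - n%:R * q%:R) / (t * q%:R)) *: vec z.
    by apply/rowP => j; rewrite !mxE; field; rewrite !lt0r_neq0.
  apply: (le_lt_trans (ler_normB _ _)).
  have -> : de = de / 2 + de / 2 by field.
  apply: ltr_leD => //; rewrite normrZ ger0_norm; last first.
    by rewrite divr_ge0 ?mulr_ge0 ?ltW//; lra.
  apply: (@le_trans _ _ (2 / t * `|vec z|)).
    rewrite ler_wpM2r// ler_pdivrMr ?mulr_gt0//.
    by rewrite mulrA divfK ?gt_eqF.
  rewrite ler_pdivrMr// in tz.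
  by rewrite mulrAC ler_pdivrMr//; lra.
have c1 : cost w 0 t 0 (z *+ n) <= (I x + e) * t.
  have nqE : (n * q)%:R = n%:R * q%:R :> R by rewrite natrM.
  have /andP[_ h1] := HN n (ltnW nN).
  have h2 : cost w (n * q)%:R t (z *+ n) (z *+ n) <= C * (t - (n * q)%:R).
    apply: HC; rewrite ?nqE//; first by lra.
    by rewrite vecB subrr normr0 mul0r.
  have h3 : cost w 0 t 0 (z *+ n) <= cost w 0 (n * q)%:R 0 (z *+ n)
      + cost w (n * q)%:R t (z *+ n) (z *+ n).
    by apply: (cost_triangle tf hg); rewrite ?subr0 ?nqE//; lra.
  have h4 : (mean_rate p M q z + e / 3) * n%:R <= (I x + e / 3) * t + e / 3 * t.
    rewrite mulrDl; apply: lerD.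
      apply: (@le_trans _ _ ((I x + e / 3) * (n%:R * q%:R))).
        by rewrite [n%:R * _]mulrC mulrA ler_wpM2r.
      by rewrite ler_wpM2l ?addr_ge0 ?(ltW e3)//; lra.
    rewrite ler_wpM2l ?(ltW e3)//; apply: (@le_trans _ _ (n%:R * q%:R)); last lra.
    by rewrite ler_peMr.
  have h5 : C * (t - (n * q)%:R) <= e / 3 * t.
    apply: (@le_trans _ _ (C * (2 * q%:R))); first by rewrite nqE ler_wpM2l.
    by rewrite ler_pdivrMr// in tC; lra.
  have -> : (I x + e) * t = (I x + e / 3) * t + e / 3 * t + e / 3 * t by field.
  apply: (le_trans h3); apply: lerD; first exact: le_trans h1 h4.
  exact: le_trans h2 h5.
apply: (@le_trans _ _ (mass (p w 0 t 0) [set z *+ n])); last first.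
  by apply: le_mass => y /= ->.
by rewrite (massE_cost tf hg) ?subr0// ?ler_expR ?mulNr ?lerN2//; lra.
Unshelve. all: by end_near. Qed.

Lemma upper_local w x (l e : R) : good_path w -> l < I x -> 0 < e ->
  exists2 de : R, 0 < de & \forall t \near +oo,
  mass (p w 0 t 0) (region t [set v | `|v - x| < de]) <= expR (- (l - e) * t).
Proof.
move=> gw lI e0.
(* Here the trivial bound 1 suffices. In the other case positivity allows [t] to be replaced by the
   later time [n q]. *)
have [le0|le0] := leP (l - e / 2) 0.
  exists 1 => //; near=> t; apply: (le_trans (mass_le1 _ _)).
  have t0 : 0 < t by near: t; exact: nbhs_pinfty_gt.
  by rewrite -[leLHS]expR0 ler_expR mulr_ge0 ?ltW//; lra.
have e4 : 0 < e / 4 by rewrite divr_gt0.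
have [d1 d10 Hd1] := rate_lower (mean_cost_ge0 p M) mean_cost_cone x e4.
(* The opening comes from [n z - y = (t + u) (z / q - x) + u x - t (y / t - x)], where [u] is the
   time left: for [de <= 1] the three terms are at most [2 u], [u |x|] and [u]. *)
have [C C0 HC] := cost_cone (3 + `|x|).
(* [de <= d1] puts [z / q] where [rate_lower] applies, and [C * de <= e / 4] makes the additional
   duration, about [de * t], cheap. *)
pose de := Num.min (Num.min 1 d1) (e / (4 * (C + 1))).
have C1 : 0 < 4 * (C + 1) by lra.
have de0 : 0 < de by rewrite !lt_min ltr01 d10 divr_gt0.
have de1 : de <= 1 by rewrite !ge_min lexx.
have ded : de <= d1 by rewrite !ge_min lexx orbT.
have deC : C * de <= e / 4.
  have : de <= e / (4 * (C + 1)) by rewrite !ge_min lexx orbT.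
  rewrite ler_pdivlMr//; lra.
have [q [z [q0 qz]]] := lattice_dense x de0.
have [N HN] := gw q z q0 _ e4.
have qR : 1 <= q%:R :> R by rewrite ler1n.
have q0R : 0 < q%:R :> R by rewrite ltr0n.
(* Every multiple [(n q, n z)] has the same direction [z / q], within [d1] of [x], so the bound on
   mean costs applies to all terms of the infimum. *)
have g1 : (I x - e / 4) * q%:R <= mean_rate p M q z.
  apply: mean_rate_ge => n n0.
  rewrite -mulrA -natrM mulnC; apply: Hd1; first by rewrite muln_gt0 n0.
  rewrite vecMn scalerA natrM invfM mulrAC mulVf ?mul1r; last by rewrite gt_eqF// ltr0n.
  exact: lt_le_trans qz ded.
exists de => //; near=> t.
have t0 : 0 < t by near: t; exact: nbhs_pinfty_gt.
have tN : N.+1%:R * q%:R <= t by near: t; apply: nbhs_pinfty_ge; exact: num_real.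
have tde : 1 / de <= t by near: t; apply: nbhs_pinfty_ge; exact: num_real.
have tC : 4 * C * q%:R / e <= t by near: t; apply: nbhs_pinfty_ge; exact: num_real.
rewrite ler_pdivrMr// in tC; rewrite ler_pdivrMr// in tde.
(* From near [t x] at time [t], a path can be continued to [n z] at time [n q],
   which is close to [(1 + de) t], at a small cost. *)
pose n := (Num.truncn ((1 + de) * t / q%:R)).+1.
have a0 : 0 <= (1 + de) * t / q%:R by rewrite divr_ge0 ?mulr_ge0//; lra.
have /andP[n1 n2] := truncn_itv a0.
rewrite -/n in n2; rewrite ltr_pdivrMr// in n2; rewrite ler_pdivlMr// in n1.
pose u := n%:R * q%:R - t.
have u1 : de * t <= u by rewrite /u; lra.
have u2 : u <= de * t + q%:R by rewrite /u /n -natr1; lra.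
have nN : (N <= n)%N.
  rewrite -(ler_nat R) -(ler_pM2r q0R); apply: (@le_trans _ _ t); last by nra.
  by apply: le_trans tN; rewrite ler_wpM2r// ler_nat.
have u_1 : 1 <= u by lra.
have u0 : 0 <= u by lra.
have nqE : (n * q)%:R = n%:R * q%:R :> R by rewrite natrM.
have nqt : n%:R * q%:R = t + u by rewrite /u; lra.
have n0 : 0 <= n%:R :> R by [].
set rg := region _ _.
have t0' := ltW t0.
have key y : rg y -> expR (- (C * u)) <= mass (p w t (n * q)%:R y) [set z *+ n].
  move=> ry; rewrite (massE_cost tf hg) ?ler_expR ?lerN2 ?t0'//; last first.
    by rewrite nqE nqt; lra.
  have -> : u = (n * q)%:R - t by rewrite nqE nqt; lra.
  apply: HC => //; first by rewrite nqE nqt; lra.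
  have -> : (n * q)%:R - t = u by rewrite nqE nqt; lra.
  rewrite vecB vecMn.
  have -> : n%:R *: vec z - vec y = (t + u) *: (q%:R^-1 *: vec z - x) + u *: x
      - t *: (t^-1 *: vec y - x).
    by rewrite -nqt; apply/rowP => j; rewrite !mxE /u; field; rewrite !lt0r_neq0.
  have h1 : `|(t + u) *: (q%:R^-1 *: vec z - x)| <= u + u.
    rewrite normrZ ger0_norm; last by rewrite addr_ge0// ltW.
    apply: (@le_trans _ _ ((t + u) * de)).
      by apply: ler_wpM2l; [exact: addr_ge0|exact: ltW].
    have : u * de <= u by rewrite ler_piMr.
    lra.
  have h2 : `|u *: x| <= u * `|x| by rewrite normrZ ger0_norm.
  have h3 : `|t *: (t^-1 *: vec y - x)| <= u.
    rewrite normrZ gtr0_norm//; apply: le_trans u1; rewrite mulrC ler_wpM2r ?ltW//.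
  apply: (le_trans (ler_normB _ _)).
  have -> : (3 + `|x|) * u = u + u + u * `|x| + u by ring.
  by apply: lerD h3; apply: (le_trans (ler_normD _ _)); exact: lerD.
have tnq : t <= (n * q)%:R by rewrite nqE nqt; lra.
have := chapman_ge (tf w) 0 (lexx 0) (ltW t0) tnq key.
have nq1 : 1 <= (n * q)%:R - 0 :> R by rewrite subr0 nqE nqt; lra.
rewrite (massE_cost tf hg w 0 (z *+ n) (lexx 0) nq1).
have /andP[h1 _] := HN n nN.
rewrite -(ler_pM2l (expR_gt0 (C * u))) mulrA -!expRD subrr expR0 mul1r => /le_trans; apply.
rewrite ler_expR.
have h2 : (I x - e / 4) * q%:R * n%:R <= mean_rate p M q z * n%:R by rewrite ler_wpM2r.
have h3 : e / 4 * n%:R <= e / 4 * (n%:R * q%:R) by rewrite ler_wpM2l ?(ltW e4)// ler_peMr.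
have h4 : (l - e / 2) * t <= (I x - e / 2) * (n%:R * q%:R).
  apply: (@le_trans _ _ ((l - e / 2) * (n%:R * q%:R))).
    by rewrite ler_wpM2l ?(ltW le0)// nqt; lra.
  by rewrite ler_wpM2r ?mulr_ge0//; lra.
have h5 : C * u <= e / 4 * t + e / 4 * t.
  apply: (@le_trans _ _ (C * (de * t + q%:R))); first by rewrite ler_wpM2l.
  rewrite mulrDr; apply: lerD; last by lra.
  by rewrite mulrA ler_wpM2r// ltW.
move: h1 h2 h3 h4 h5; set a := cost _ _ _ _ _; move: (I x) (mean_rate p M q z) => i g.
clear; lra.
Unshelve. all: by end_near. Qed.


Lemma region_cover w l (s : seq 'rV[R]_d) (de : 'rV[R]_d -> R) :
  (forall x, x \in s -> \forall t \near +oo,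
     mass (p w 0 t 0) (region t [set v | `|v - x| < de x]) <= expR (- l * t)) ->
  \forall t \near +oo,
    mass (p w 0 t 0) (region t [set v | exists2 x, x \in s & `|v - x| < de x])
      <= (size s)%:R * expR (- l * t).
Proof.
elim: s => [_|x s IH H].
  near=> t; rewrite mul0r (_ : region _ _ = set0) ?/mass ?measure0//.
  by apply/seteqP; split => // y [].
have Hx := H x (mem_head _ _).
have {}IH := IH (fun (y : 'rV[R]_d) ys => H y (mem_behead (s := x :: s) ys)).
near=> t.
have t1 : mass (p w 0 t 0) (region t [set v | `|v - x| < de x]) <= expR (- l * t).
  by near: t.
have t2 : mass (p w 0 t 0) (region t [set v | exists2 x, x \in s & `|v - x| < de x])
      <= (size s)%:R * expR (- l * t) by near: t.
rewrite -natr1 mulrDl mul1r addrC; apply: le_trans (lerD t1 t2).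
apply: le_trans (le_massU _ _ _); apply: le_mass => y [v]; rewrite inE.
by case/orP => [/eqP ->|vs] vy; [left|right; exists v].
Unshelve. all: by end_near. Qed.

Lemma upper_bound w (C : set 'rV[R]_d) (l e : R) : good_path w -> closed C ->
  (forall x, C x -> l < I x) -> 0 < e ->
  \forall t \near +oo, mass (p w 0 t 0) (region t C) <= expR (- (l - e) * t).
Proof.
move=> gw cC lC e0; have e2 : 0 < e / 2 by rewrite divr_gt0.
(* With this radius the bound of [trans_tail] becomes [e^(- |l| t)], which is no more than the bound
   sought. *)
pose k := max_rate d K * expR 1 + `|l|.
pose B := C `&` [set v | `|v| <= k].
have cB : compact B.
  apply: bounded_closed_compact.
    exists k; split; first exact: num_real.
    by move=> r kr v [_ /= vk]; exact: le_trans vk (ltW kr).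
  apply: closedI => //.
  have := @closed_comp _ _ (@Num.norm _ 'rV[R]_d) [set r | r <= k].
  by apply; [move=> v _; exact: norm_continuous|exact: closed_le].
have /choice[de Hde] x : exists de, C x -> 0 < de /\ \forall t \near +oo,
    mass (p w 0 t 0) (region t [set v | `|v - x| < de]) <= expR (- (l - e / 2) * t).
  have [Cx|Cx] := pselect (C x); last by exists 0.
  by have [de de0 Hde] := upper_local gw (lC _ Cx) e2; exists de.
rewrite compact_cover in cB.
have [x Bx|v Bv|D DB BD] := cB _ B (fun x => ball x (de x)).
- exact: ball_open.
- by exists v => //; apply: ballxx; apply: (Hde v _).1; exact: Bv.1.
have /finite_seqP[s sE] := finite_fset D.
have Hs (x : 'rV[R]_d) : x \in s -> \forall t \near +oo,
    mass (p w 0 t 0) (region t [set v | `|v - x| < de x]) <= expR (- (l - e / 2) * t).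
  move=> xs; have : [set` s] x := xs; rewrite -sE => xD.
  by apply: (Hde x _).2; have := DB x xD; rewrite inE => -[].
have := region_cover Hs; set N := size _ => HN.
near=> t.
have t0 : 0 < t by near: t; exact: nbhs_pinfty_gt.
have tN : N%:R * 2 / e <= t by near: t; apply: nbhs_pinfty_ge; exact: num_real.
have t1 : mass (p w 0 t 0) (region t [set v | exists2 x, x \in s & `|v - x| < de x])
    <= N%:R * expR (- (l - e / 2) * t) by near: t.
have nr1 y (u : unit_vector d) : `|vec (y + (u : lattice d))| <= `|vec y| + 1.
  by rewrite vecD; apply: (le_trans (ler_normD _ _)); rewrite lerD2l vec_unit_le.
have := trans_tail (tf w) (hg w) 0 (k * t) nr1 (ltW t0).
rewrite vec0 normr0 addr0 /k mulrDl opprD addNKr => t2.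
have {}t2 : mass (p w 0 t 0) [set y | k * t <= `|vec y|] <= expR (- (l - e / 2) * t).
  rewrite /k mulrDl; apply: (le_trans t2); rewrite ler_expR -mulNr.
  apply: ler_wpM2r; first exact: ltW.
  by rewrite lerN2; have := ler_norm l; lra.
have t3 : mass (p w 0 t 0) (region t C) <= (N%:R + 1) * expR (- (l - e / 2) * t).
  rewrite mulrDl mul1r; apply: le_trans (lerD t1 t2).
  apply: le_trans (le_massU _ _ _); apply: le_mass => y Cy.
  have [yk|yk] := leP (k * t) `|vec y|; first by right.
  left; have [|x xD] := BD (t^-1 *: vec y).
    split => //=; rewrite normrZ ger0_norm ?invr_ge0 ?(ltW t0)//.
    by rewrite mulrC ler_pdivrMr//; exact: ltW.
  by rewrite -ball_normE /= distrC => xy; exists x => //; by move: xD; rewrite sE.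
apply: (le_trans t3).
(* The inequality [1 + r <= e^r] at [r = e t / 2] absorbs the number [N + 1] of terms into the
   remaining half of the slack. *)
have -> : - (l - e) * t = e / 2 * t + - (l - e / 2) * t by field.
rewrite expRD ler_wpM2r ?expR_ge0//; apply: le_trans (expR_ge1Dx _).
by rewrite ler_pdivrMr// in tN; lra.
Unshelve. all: by end_near. Qed.

End LargeDeviations.

(** * Logarithmic rates and limits at infinity *)

Section LogRate.
Variables (R : realType) (d : nat).
Variables (P : probability (Borel (walk_path R d)) R).
Variables (m : R -> probability (Borel (lattice d)) R).
Hypothesis Pm : forall (B : set (lattice d)) (t : R), 0 <= t ->
  P [set X : walk_path R d | B (X t)] = m t B.
Implicit Types (A : set 'rV[R]_d) (a t : R).

Lemma log_rateE A t : 0 <= t ->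
  log_rate P A t = ((t^-1)%:E * lne (mass (m t) (region t A))%:E)%E.
Proof. by move=> t0; rewrite massE -Pm. Qed.

Lemma log_rate_ge A a t : 0 < t -> expR (a * t) <= mass (m t) (region t A) ->
  (a%:E <= log_rate P A t)%E.
Proof.
move=> t0 H; have m0 := lt_le_trans (expR_gt0 _) H.
rewrite log_rateE ?(ltW t0)// lne_EFin// -EFinM lee_fin mulrC ler_pdivlMr//.
by rewrite -[leLHS]expRK ler_ln ?posrE ?expR_gt0.
Qed.

Lemma log_rate_le A a t : 0 < t -> mass (m t) (region t A) <= expR (a * t) ->
  (log_rate P A t <= a%:E)%E.
Proof.
move=> t0 H; rewrite log_rateE ?(ltW t0)//.
have := mass_ge0 (m t) (region t A); rewrite le_eqVlt => /predU1P[<-|m0].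
  by rewrite le0_lneNy// gt0_muleNy ?lte_fin ?invr_gt0// leNye.
rewrite lne_EFin// -EFinM lee_fin mulrC ler_pdivrMr//.
by rewrite -[leRHS]expRK ler_ln ?posrE ?expR_gt0.
Qed.

End LogRate.

Section LimitsAtInfinity.
Variable R : realType.
Implicit Types (f : R -> \bar R) (a : \bar R).
Local Open Scope ereal_scope.

Lemma limf_einf_ge f a : (\forall t \near +oo%R, a <= f t) ->
  a <= limf_einf f (pinfty_nbhs R).
Proof.
move=> H; rewrite limf_einfE; apply: le_ereal_sup_tmp.
exists (ereal_inf (f @` [set t | a <= f t])); first by exists [set t | a <= f t].
by apply: le_ereal_inf_tmp => _ [t at_ <-].
Qed.

Lemma limf_esup_le f a : (\forall t \near +oo%R, f t <= a) ->
  limf_esup f (pinfty_nbhs R) <= a.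
Proof.
move=> H; rewrite limf_esupE; apply: ge_ereal_inf.
exists (ereal_sup (f @` [set t | f t <= a])); first by exists [set t | f t <= a].
by apply: ge_ereal_sup => _ [t at_ <-].
Qed.

End LimitsAtInfinity.

Theorem theorem1p1 (R : realType) (d : nat) (d_ge1 : (1 <= d)%N)
    (K : ellipticity R)
    (Q : R.-pker Borel (environment d K) ~> Borel (env_path d K))
    (mu : probability (Borel (environment d K)) R)
    (P : env_path d K -> lattice d -> probability (Borel (walk_path R d)) R) :
  markov_process Q ->
  invariant_measure Q mu ->
  translation_invariant mu ->
  ergodic_environment (env_mixture Q mu) ->
  (forall omega : env_path d K, quenched_law omega (P omega)) ->
  exists I : 'rV[R]_d -> R,
    [/\ convex_function setT I,
        continuous I,
        forall x, 0 <= I x,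
        forall O : set 'rV[R]_d, open O ->
          {ae env_mixture Q mu, forall omega : env_path d K,
            (- ereal_inf [set (I x)%:E | x in O] <=
             limf_einf (log_rate (P omega 0%R) O) (pinfty_nbhs R))%E} &
        forall C : set 'rV[R]_d, closed C ->
          {ae env_mixture Q mu, forall omega : env_path d K,
            (limf_esup (log_rate (P omega 0%R) C) (pinfty_nbhs R) <=
             - ereal_inf [set (I x)%:E | x in C])%E}].
Proof.
move=> _ _ _ erg law; pose M : probability _ R := env_law Q mu.
have {}erg : ergodic_environment M := erg.
(* The choice has no regularity in [omega]; [trans_measurable] supplies it afterwards. *)
have [p pE] := choice law.
have tf omega : transition_function (p omega) by case: (pE omega).
have hg omega : has_generator (p omega) (fun s => generator (omega s)).
  by case: (pE omega).
have Pp omega (B : set (lattice d)) (t : R) : 0 <= t ->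
    P omega 0 [set X : walk_path R d | B (X t)] = p omega 0 t 0 B.
  by move=> t0; have [_ _ /(_ 0)[P1 mP]] := pE omega; exact: walk_marginal.
have c0 := mean_cost_ge0 p M; have cC := mean_cost_cone tf hg M.
have cD := mean_costD tf hg erg.
exists (rate_function (mean_cost p M)); split.
- move=> t x y _ _.
  have t01 : 0 <= t%:num <= 1 by apply/andP; split.
  exact: (rate_function_convex c0 cC cD x y t01).
- exact: (rate_function_continuous c0 cC cD).
- exact: (rate_function_ge0 c0 cC).
- move=> O oO; have := good_path_ae tf hg erg.
  apply: negligibleS => w /= + gw; apply.
  rewrite leeNl; apply: le_ereal_inf_tmp => _ [x Ox <-]; rewrite leeNl -EFinN.
  apply/lee_addgt0Pr => e e0; rewrite -leeBlDr// -EFinB.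
  apply: limf_einf_ge; have H := lower_bound tf hg gw oO Ox e0.
  near=> t; apply: (log_rate_ge (Pp w)); first by near: t; exact: nbhs_pinfty_gt.
  by rewrite -opprD; near: t.
- move=> C cC'; have := good_path_ae tf hg erg.
  apply: negligibleS => w /= + gw; apply; rewrite leeNr.
  set i := ereal_inf _; set L := limf_esup _ _.
  (* Working with real [l] below the infimum also covers an empty [C]: the infimum is then [+oo],
     every [l] is allowed, and the upper limit is [-oo]. *)
  have H l : (l%:E < i)%E -> (l%:E <= - L)%E.
    move=> li; apply/lee_addgt0Pr => e e0; rewrite -leeBlDr// -EFinB leeNr -EFinN.
    apply: limf_esup_le.
    have lI x : C x -> l < rate_function (mean_cost p M) x.
      by move=> Cx; rewrite -lte_fin; apply: lt_le_trans li _; apply: ereal_inf_lbound; exists x.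
    have H := upper_bound tf hg gw cC' lI e0.
    near=> t; apply: (log_rate_le (Pp w)); first by near: t; exact: nbhs_pinfty_gt.
    by near: t.
  case: i H => [r| |] H; last by rewrite leNye.
  + apply/lee_addgt0Pr => e e0; rewrite -leeBlDr// -EFinB; apply: H.
    by rewrite lte_fin gtrBl.
  + by rewrite (eq_infty (fun r => H r (ltry r))).
Unshelve. all: by end_near. Qed.
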